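(* There exist absolute constants $c_1,c_2,c_3>0$ and, for every $d$, a distribution $\mathcal{D}$ over covariance matrices $\Sigma\in\mathbb{R}^{d\times d}$ with $\mathbb{I}\preceq\Sigma\preceq 2\mathbb{I}$ such that the following holds. Let $\alpha\le c_1/\sqrt{d}$, let $\varepsilon,\delta\in[0,1]$ with $\delta\le c_2\min\left\{\frac{1}{n},\frac{d^2}{n\log(n/d^2)}\right\}$, and let $M:\mathbb{R}^{n\times d}\to\mathbb{R}^{d\times d}$ be an $(\varepsilon,\delta)$-differentially private mechanism such that, for $\Sigma\sim\mathcal{D}$ and $X\sim\mathcal{N}(0,\Sigma)^{\otimes n}$, it satisfies $\mathbb{E}_{X,M}\left[\|\Sigma^{-1/2}(M(X)-\Sigma)\Sigma^{-1/2}\|_2^2\right]\le\alpha^2$. Then $n\ge c_3\frac{d^{1.5}}{\alpha\varepsilon}$. (That is, $\alpha=O(1/\sqrt d)$, $\delta\le O(\min\{1/n, d^2/(n\log(n/d^2))\})$, and $n\ge\Omega(d^{1.5}/(\alpha\varepsilon))$.)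
   Context: A randomized algorithm $M:\mathcal{X}^n\to\mathcal{Y}$ is $(\varepsilon,\delta)$-differentially private if for every pair of datasets $X,X'\in\mathcal{X}^n$ differing in exactly one entry and every measurable $Y\subseteq\mathcal{Y}$, $\Pr[M(X)\in Y]\le e^{\varepsilon}\Pr[M(X')\in Y]+\delta$. $\|\cdot\|_2$ denotes the spectral norm of a matrix. $\mathcal{N}(0,\Sigma)^{\otimes n}$ denotes $n$ i.i.d. samples from $\mathcal{N}(0,\Sigma)$; the expectation is over the samples and the internal randomness of $M$. *)

(* Defs.v *)
From HB Require Import structures.
From mathcomp Require Import all_boot all_order all_algebra.
From mathcomp Require Import all_classical all_reals all_analysis.
From mathcomp Require Import measurable_realfun.

Set Implicit Arguments.
Unset Strict Implicit.
Unset Printing Implicit Defensive.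

Import Order.TTheory GRing.Theory Num.Theory.
Import numFieldNormedType.Exports.

Local Open Scope classical_set_scope.
Local Open Scope ring_scope.

Definition measure_matrix_display : measure_display -> measure_display.
Proof. exact. Qed.

(* The product sigma-algebra on matrices: it is generated by the entries, so it
   is the Borel sigma-algebra when the entries are real. *)
Section measurable_matrix.
Context {d} {T : measurableType d}.
Variables m n : nat.

Definition matrix_cylinder : set (set 'M[T]_(m, n)) :=
  [set B | exists (i : 'I_m) (j : 'I_n) (A : set T),
     measurable A /\ B = [set x : 'M[T]_(m, n) | A (x i j)]].

Let matrix_set0 : <<s matrix_cylinder >> set0.
Proof. exact: sigma_algebra0. Qed.

Let matrix_setC A : <<s matrix_cylinder >> A -> <<s matrix_cylinder >> (~` A).
Proof. exact: sigma_algebraC. Qed.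

Let matrix_bigcup (F : (set 'M[T]_(m, n))^nat) :
  (forall i, <<s matrix_cylinder >> (F i)) ->
  <<s matrix_cylinder >> (\bigcup_i F i).
Proof. exact: sigma_algebra_bigcup. Qed.

HB.instance Definition _ := @isMeasurable.Build (measure_matrix_display d)
  'M[T]_(m, n) <<s matrix_cylinder >> matrix_set0 matrix_setC matrix_bigcup.

End measurable_matrix.

Lemma measurable_fun_matrixP d1 d2 (T1 : measurableType d1)
    (T2 : measurableType d2) m n (f : T1 -> 'M[T2]_(m, n)) :
  measurable_fun setT f <->
  forall i j, measurable_fun setT (fun x => f x i j).
Proof.
split=> [mf i j|mf].
  move=> _ A mA; rewrite setTI.
  have mB : measurable [set x : 'M[T2]_(m, n) | A (x i j)].
    by apply: sub_sigma_algebra; exists i, j, A.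
  by have := mf measurableT _ mB; rewrite setTI.
apply: (@measurability _ _ _ _ _ _ (@matrix_cylinder _ T2 m n)) => //.
move=> _ [_ [i [j [A [mA ->]]]] <-].
by have := mf i j measurableT _ mA.
Qed.

(* The law of n independent draws from P. *)
Section iid.
Context {d} {T : measurableType d} {R : realType}.

Definition cons_pair n (x : T * n.-tuple T) : n.+1.-tuple T :=
  [tuple of x.1 :: x.2].

Let measurable_cons_pair n : measurable_fun setT (@cons_pair n).
Proof. by apply: measurable_cons. Qed.

HB.instance Definition _ n :=
  isMeasurableFun.Build _ _ _ _ (@cons_pair n) (@measurable_cons_pair n).

Fixpoint iid (P : probability T R) (n : nat) : probability (n.-tuple T) R :=
  if n is k.+1 then distribution (P \x iid P k)%E (@cons_pair k)
  else dirac [tuple].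

End iid.

Section linear_algebra.
Context {R : realType}.

Definition psd d (A : 'M[R]_d) : Prop :=
  A^T = A /\ forall v : 'cV[R]_d, 0 <= (v^T *m A *m v) 0 0.

Definition loewner_le d (A B : 'M[R]_d) : Prop := psd (B - A).

(* The unique psd square root of S when S is psd, and 0 otherwise. *)
Definition sqrtmx d (S : 'M[R]_d) : 'M[R]_d :=
  xget 0 [set B | psd B /\ B *m B = S].

Definition invsqrtmx d (S : 'M[R]_d) : 'M[R]_d := invmx (sqrtmx S).

Definition l2norm d (v : 'cV[R]_d) : R := Num.sqrt (\sum_i v i 0 ^+ 2).

Definition spectral_norm m n (A : 'M[R]_(m, n)) : R :=
  sup [set l2norm (A *m v) | v in [set v : 'cV[R]_n | l2norm v <= 1]].

End linear_algebra.

(* N(0, S) on row vectors, as the law of g *m S^(1/2) for g a row of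
   independent standard normals. *)
Section multivariate_normal.
Context {R : realType}.

Definition normal_map d (S : 'M[R]_d)
    (g : d.-tuple (measurableTypeR R)) : 'rV[R]_d :=
  (\row_i tnth g i : 'rV[R]_d) *m sqrtmx S.

Let measurable_normal_map d (S : 'M[R]_d) : measurable_fun setT (normal_map S).
Proof.
apply/measurable_fun_matrixP => i j.
under eq_fun do rewrite /normal_map mxE.
apply: measurable_sum => k.
apply: measurable_funM => //.
under eq_fun do rewrite mxE.
exact: measurable_tnth.
Qed.

HB.instance Definition _ d (S : 'M[R]_d) :=
  isMeasurableFun.Build _ _ _ _ (normal_map S) (@measurable_normal_map d S).

Definition mvnormal d (S : 'M[R]_d) :
    probability 'rV[R]_d R :=
  distribution (iid (normal_prob (0 : R) 1) d) (normal_map S).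

End multivariate_normal.

Section differential_privacy.
Context {dX dY} {X : measurableType dX} {Y : measurableType dY} {R : realType}.

Definition neighbors n (x x' : n.-tuple X) : Prop :=
  exists i : 'I_n, tnth x i <> tnth x' i /\
    forall j : 'I_n, j != i -> tnth x j = tnth x' j.

(* A randomized algorithm is a probability kernel: M x is the law of its output
   on the dataset x. *)
Definition diff_private n (eps delta : R) (M : R.-pker (n.-tuple X) ~> Y) :
    Prop :=
  forall x x' : n.-tuple X, neighbors x x' ->
  forall A : set Y, measurable A ->
  (M x A <= (expR eps)%:E * M x' A + delta%:E)%E.

End differential_privacy.

Section covariance_estimation.
Context {R : realType}.

Definition cov_error d (S A : 'M[R]_d) : R :=
  spectral_norm (invsqrtmx S *m (A - S) *m invsqrtmx S) ^+ 2.

(* The n samples in R^d (the rows of the data matrix) are an n-tuple of row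
   vectors. The covariance S is itself drawn from D, so the expectation of the
   error over the experiment averages over S as well; in particular a mechanism
   whose expected error is at most e for D-almost every S satisfies
   expected_cov_error D M <= e. *)
Definition expected_cov_error d n (D : probability 'M[R]_d R)
    (M : R.-pker (n.-tuple 'rV[R]_d) ~> 'M[R]_d) : \bar R :=
  (\int[D]_S \int[iid (mvnormal S) n]_x \int[M x]_A (cov_error S A)%:E)%E.

(* min {1/n, d^2 / (n log (n/d^2))}. When n <= d^2 the logarithm is not
   positive and the second term is read as +oo. *)
Definition delta_max (d n : nat) : R :=
  if (d ^ 2 < n)%N then
    Num.min n%:R^-1 (d%:R ^+ 2 / (n%:R * ln (n%:R / d%:R ^+ 2)))
  else n%:R^-1.

End covariance_estimation.

(* Main.v *)
Require Import Defs.
From HB Require Import structures.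
From mathcomp Require Import all_boot all_order all_algebra.
From mathcomp Require Import all_classical all_reals all_analysis.
From mathcomp Require Import measurable_realfun ring lra zify.

Set Implicit Arguments.
Unset Strict Implicit.
Unset Printing Implicit Defensive.

Import Order.TTheory GRing.Theory Num.Theory.
Import numFieldNormedType.Exports.

Local Open Scope classical_set_scope.
Local Open Scope ring_scope.

(* The covariance is drawn from a family that encodes a random q x p regression
   matrix B, with q p of order d^2: if x and g are independent standard normal
   vectors, the covariance of (x, x B^T + g) determines B. The entries of B are
   independent and uniform on [-eta, eta] with eta = 1 / (8 d), so that the
   covariance, suitably scaled, stays between 1 and 2. For d = 1 the single
   statistic x + (x B^T + g) is used instead.

   Fingerprinting: given an estimate of B with error at most beta^2 = 16 d alpha^2
   in squared Frobenius norm, correlate the (windowed) estimation error with the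
   score of each sample. Integration by parts in each entry of B shows that these
   correlations sum up to at least a constant times q p in expectation. Replacing
   a sample by a fresh one centers its correlation with the output, so by privacy
   each sample contributes at most O(eps beta + delta eta q p). Comparing the two
   bounds gives n >= c d^2 / (eps beta), which is the claim.

   The law of x A, for a standard normal vector x, depends on A only through
   A^T A; this identifies the normal law defined by the symmetric square root of
   the covariance with the regression model. *)

(** * Integration *)

Section integration.
Context d (T : measurableType d) (R : realType).
Local Open Scope ereal_scope.

Lemma integral_probability_cst (P : probability T R) (c : \bar R) :
  \int[P]_x c = c.
Proof.
rewrite [LHS]integral_cst // -[RHS]mule1; congr (_ * _).
exact: probability_setT.
Qed.

Lemma integrable_bounded (P : probability T R) (f : T -> R) (b : R) :
  measurable_fun setT f -> (forall x, (`|f x| <= b)%R) ->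
  P.-integrable setT (EFin \o f).
Proof.
move=> mf fb; apply: (@le_integrable _ _ _ _ _ measurableT _ (cst b%:E)) => //.
- exact/measurable_EFinP.
- by move=> x _; rewrite /= lee_fin (le_trans (fb x)) // ler_norm.
- exact: finite_measure_integrable_cst.
Qed.

Lemma integral_norm_le1 (P : probability T R) (f : T -> R) :
  measurable_fun setT f -> \int[P]_x (f x ^+ 2)%:E <= 1 ->
    \int[P]_x `|f x|%:E <= 1.
Proof.
move=> mf f2; have half_ge0 : 0 <= (1 / 2 : R)%:E by rewrite lee_fin; lra.
have mf2 : measurable_fun setT (fun x => (f x ^+ 2)%:E).
  by apply/measurable_EFinP; exact: measurable_funX.
apply: (@le_trans _ _ (\int[P]_x ((1 / 2)%:E * (f x ^+ 2)%:E + (1 / 2)%:E))).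
  apply: ge0_le_integral => //.
  - by apply/measurable_EFinP; exact: measurableT_comp.
  - by apply: emeasurable_funD => //; exact: measurable_funeM.
  - move=> x _; rewrite -EFinM -EFinD lee_fin -(real_normK (num_real (f x))).
    by have := sqr_ge0 (`|f x| - 1); nra.
rewrite ge0_integralD //; last 2 first.
- by move=> x _; rewrite mule_ge0 // lee_fin sqr_ge0.
- exact: measurable_funeM.
rewrite integral_probability_cst ge0_integralZl //; last first.
  by move=> x _; rewrite lee_fin sqr_ge0.
apply: (le_trans (leeD2r _ (lee_wpmul2l half_ge0 f2))).
by rewrite mule1 -EFinD lee_fin; lra.
Qed.

Lemma EFin_Rintegral (mu : {measure set T -> \bar R}) (f : T -> R) :
  mu.-integrable setT (EFin \o f) ->
  (\int[mu]_x f x)%R%:E = \int[mu]_x (f x)%:E.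
Proof.
by move=> fi; rewrite fineK //;
  exact: (integrable_fin_num measurableT fi).
Qed.

(* The integral of a nonnegative function is the supremum of the integrals of
   the simple functions below it, so that measurability is not needed. *)
Lemma ge0_le_integral_nonmeasurable (mu : {measure set T -> \bar R})
    (f g : T -> \bar R) :
  (forall x, 0 <= f x) -> (forall x, f x <= g x) ->
  \int[mu]_x f x <= \int[mu]_x g x.
Proof.
move=> f0 fg; have g0 x : 0 <= g x by exact: le_trans (fg x).
rewrite (ge0_integralTE mu f0) (ge0_integralTE mu g0).
apply: ub_ereal_sup => _ [h /= hf <-]; apply: ereal_sup_ubound.
by exists h => // x; exact: le_trans (fg x).
Qed.

End integration.

Section density.
Local Open Scope ereal_scope.
Context d (T : measurableType d) (R : realType).
Variables (mu nu : {measure set T -> \bar R}) (g : T -> R).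
Hypotheses (g0 : forall x, (0 <= g x)%R) (mg : measurable_fun setT g).
Hypothesis nuE : forall A, measurable A -> nu A = \int[mu]_(x in A) (g x)%:E.

Import HBNNSimple.

Let integral_density_nnsfun (h : {nnsfun T >-> R}) :
  \int[nu]_x (h x)%:E = \int[mu]_x ((h x)%:E * (g x)%:E).
Proof.
rewrite integralT_nnsfun sintegralE.
transitivity (\int[mu]_x \sum_(r \in range h)
    (r%:E * ((\1_(h @^-1` [set r]) x)%:E * (g x)%:E))); last first.
  apply: eq_integral => x _; rewrite [in RHS](fimfunE h x) -fsumEFin //.
  rewrite ge0_mule_fsuml; last first.
    by move=> r; rewrite EFinM; exact: nnfun_muleindic_ge0.
  by apply: eq_fsbigr => r _; rewrite EFinM muleA.
have mi r : measurable_fun setT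
    (fun x => (\1_(h @^-1` [set r]) x)%:E * (g x)%:E).
  apply: emeasurable_funM; last exact/measurable_EFinP.
  exact/measurable_EFinP/measurable_indic.
have i0 r x : 0 <= (\1_(h @^-1` [set r]) x)%:E * (g x)%:E.
  by rewrite mule_ge0 // lee_fin.
rewrite ge0_integral_fsum //; last 2 first.
- by move=> r; exact: measurable_funeM.
- by move=> r x _; rewrite muleA mule_ge0 ?lee_fin //;
    exact: nnfun_muleindic_ge0.
apply: eq_fsbigr => r; rewrite inE => -[y _ <-].
rewrite ge0_integralZl ?lee_fin // nuE //; congr (_ * _).
rewrite integral_mkcond; apply: eq_integral => x _.
by rewrite patchE indicE; case: ifPn => xin; rewrite ?mul1e ?mul0e.
Qed.

Lemma ge0_integral_density (f : T -> \bar R) :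
  measurable_fun setT f -> (forall x, 0 <= f x) ->
  \int[nu]_x f x = \int[mu]_x (f x * (g x)%:E).
Proof.
move=> mf f0; pose f_ := nnsfun_approx measurableT mf.
transitivity (limn (fun n => \int[nu]_x (f_ n x)%:E)).
  rewrite -monotone_convergence //.
  - apply: eq_integral => y _; apply/esym/cvg_lim => //.
    exact: cvg_nnsfun_approx.
  - by move=> n; exact/measurable_EFinP/measurable_funP.
  - by move=> n y _; rewrite lee_fin.
  - by move=> y _ m n mn; rewrite lee_fin; exact/lefP/nd_nnsfun_approx.
under eq_fun do rewrite integral_density_nnsfun.
rewrite -monotone_convergence //.
- apply: eq_integral => y _; apply/cvg_lim => //.
  by apply: cvgeZr => //; exact: cvg_nnsfun_approx.
- move=> n; apply: emeasurable_funM; last exact/measurable_EFinP.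
  exact/measurable_EFinP/measurable_funP.
- by move=> n y _; rewrite mule_ge0 // lee_fin.
- move=> y _ m n mn; apply: lee_wpmul2r; rewrite lee_fin //.
  exact/lefP/nd_nnsfun_approx.
Qed.

Lemma integral_density (f : T -> R) : measurable_fun setT f ->
  \int[nu]_x (f x)%:E = \int[mu]_x (f x * g x)%:E.
Proof.
move=> mf; have mfE : measurable_fun setT (EFin \o f) by exact/measurable_EFinP.
rewrite integralE [RHS]integralE; congr (_ - _).
  rewrite ge0_integral_density //; last exact: measurable_funepos.
  apply: eq_integral => x _; rewrite !funeposE.
  by rewrite -!EFin_max -EFinM maxr_pMl // mul0r.
rewrite ge0_integral_density //; last exact: measurable_funeneg.
apply: eq_integral => x _; rewrite !funenegE.
by rewrite -!EFinN -!EFin_max -EFinM maxr_pMl // mul0r mulNr.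
Qed.

End density.

Section with_density.
Local Open Scope ereal_scope.
Context d (T : measurableType d) (R : realType).
Variables (mu : {measure set T -> \bar R}) (g : T -> R).
Hypotheses (g0 : forall x, (0 <= g x)%R) (mg : measurable_fun setT g).

Definition with_density of (forall x, 0 <= g x)%R & measurable_fun setT g :
  set T -> \bar R := fun A => \int[mu]_(x in A) (g x)%:E.

Let with_density0 : with_density g0 mg set0 = 0.
Proof. exact: integral_set0. Qed.

Let with_density_ge0 A : 0 <= with_density g0 mg A.
Proof. by apply: integral_ge0 => x _; rewrite lee_fin. Qed.

Let with_density_sigma_additive : semi_sigma_additive (with_density g0 mg).
Proof.
move=> F mF tF mUF; rewrite /with_density; apply: cvg_toP.
  apply: ereal_nondecreasing_is_cvgn => m n mn.
  by apply: lee_sum_nneg_natr => // k _ _; exact: with_density_ge0.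
rewrite ge0_integral_bigcup //=.
- exact/measurable_EFinP/measurable_funTS.
- by move=> x _; rewrite lee_fin.
Qed.

HB.instance Definition _ := isMeasure.Build _ _ _ (with_density g0 mg)
  with_density0 with_density_ge0 with_density_sigma_additive.

End with_density.

Section kernel_probability.
Context d d' (X : measurableType d) (Y : measurableType d') (R : realType).
Variable k : R.-pker X ~> Y.

Let kernel_measure (x : X) : set Y -> \bar R := k x.

HB.instance Definition _ x := Measure.copy (kernel_measure x) (k x).

HB.instance Definition _ x :=
  Measure_isProbability.Build _ _ _ (kernel_measure x) (prob_kernel x).

Definition kernel_probability (x : X) : probability Y R := kernel_measure x.

End kernel_probability.

Section kernel_joint.
Local Open Scope ereal_scope.
Context d d' (X : measurableType d) (Y : measurableType d') (R : realType).
Variables (P : probability X R) (k : R.-pker X ~> Y).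

HB.instance Definition _ (x : X) :=
  isMeasurableFun.Build _ _ _ _ (@pair X Y x) (measurable_pair1 x).

Let graph_kernel (z : unit * X) : {measure set (X * Y) -> \bar R} :=
  distribution (kernel_probability k z.2) (pair z.2).

Let measurable_graph_kernel A : measurable A ->
  measurable_fun setT (graph_kernel ^~ A).
Proof.
move=> mA; have mk : measurable_fun setT (fun x => k x (xsection A x)).
  by apply: (measurable_fun_xsection_finite_kernel k); rewrite inE.
have := measurableT_comp mk (@measurable_snd _ _ unit X).
by apply: eq_measurable_fun => z _; rewrite /= xsectionE.
Qed.

HB.instance Definition _ :=
  isKernel.Build _ _ _ _ _ graph_kernel measurable_graph_kernel.

HB.instance Definition _ := Kernel_isProbability.Build _ _ _ _ _ graph_kernel
  (fun z =>
    probability_setT (distribution (kernel_probability k z.2) (pair z.2))).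

(* The law of a pair (x, y) with x drawn from P and y drawn from k x. *)
Definition kernel_joint : set (X * Y) -> \bar R :=
  kcomp (kprobability (measurable_cst (P : pprobability X R))) graph_kernel tt.

HB.instance Definition _ := Measure.on kernel_joint.

Lemma ge0_integral_kernel_joint (f : X * Y -> \bar R) :
  measurable_fun setT f -> (forall z, 0 <= f z) ->
  \int[kernel_joint]_z f z = \int[P]_x \int[k x]_y f (x, y).
Proof.
move=> mf f0; rewrite integral_kcomp //; apply: eq_integral => x _.
exact: (ge0_integral_distribution (P := kernel_probability k x) (pair x) mf f0).
Qed.

Let kernel_joint_setT : kernel_joint setT = 1.
Proof.
transitivity (\int[P]_x 1); last exact: integral_probability_cst.
by apply: eq_integral => x _; exact: prob_kernel.
Qed.

HB.instance Definition _ :=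
  Measure_isProbability.Build _ _ _ kernel_joint kernel_joint_setT.

End kernel_joint.

Section tuples.
Context d (T : measurableType d).

Lemma measurable_fun_tnth d1 (T1 : measurableType d1) n (f : T1 -> n.-tuple T)
    (i : 'I_n) :
  measurable_fun setT f -> measurable_fun setT (fun x => tnth (f x) i).
Proof. by move=> /measurable_fun_tnthP/(_ i). Qed.

Lemma measurable_cons_pair1 n (x : T) :
  measurable_fun setT (fun t : n.-tuple T => cons_pair (x, t)).
Proof.
exact: (measurableT_comp (measurable_funPT (@cons_pair _ T n))
  (measurable_pair1 x)).
Qed.

Definition set_tnth n (i : 'I_n) (t : n.-tuple T) (y : T) : n.-tuple T :=
  [tuple if j == i then y else tnth t j | j < n].

Lemma tnth_set_tnth n (i j : 'I_n) t y :
  tnth (set_tnth i t y) j = if j == i then y else tnth t j.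
Proof. by rewrite tnth_mktuple. Qed.

Lemma measurable_set_tnth n (i : 'I_n) :
  measurable_fun setT (fun z : n.-tuple T * T => set_tnth i z.1 z.2).
Proof.
apply/measurable_fun_tnthP => j; rewrite /comp.
under eq_fun do rewrite tnth_set_tnth.
by case: eqP => _; [exact: measurable_snd|apply: measurable_fun_tnth].
Qed.

Lemma set_tnth_ord0 n x (t : n.-tuple T) y :
  set_tnth ord0 (cons_pair (x, t)) y = cons_pair (y, t).
Proof.
apply: eq_from_tnth => j; rewrite tnth_set_tnth.
have [k ->|->] := unliftP ord0 j; last by rewrite eqxx.
by rewrite eq_sym (negbTE (neq_lift _ _)) /cons_pair !tnthS.
Qed.

Lemma set_tnth_lift n (i : 'I_n) x (t : n.-tuple T) y :
  set_tnth (lift ord0 i) (cons_pair (x, t)) y = cons_pair (x, set_tnth i t y).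
Proof.
apply: eq_from_tnth => j; rewrite tnth_set_tnth.
have [k ->|->] := unliftP ord0 j; last by rewrite (negbTE (neq_lift _ _)).
by rewrite (inj_eq lift_inj) /cons_pair !tnthS tnth_set_tnth.
Qed.

Lemma measurable_cat_tuple p q :
  measurable_fun setT (fun z : p.-tuple T * q.-tuple T => cat_tuple z.1 z.2).
Proof.
apply/measurable_fun_tnthP => i; rewrite /comp.
case: (split_ordP i) => j ->.
  by under eq_fun do rewrite tnth_lshift; exact: measurable_fun_tnth.
by under eq_fun do rewrite tnth_rshift; exact: measurable_fun_tnth.
Qed.

Lemma measurable_map_tuple d1 (T1 : measurableType d1) (psi : T -> T1) n :
  measurable_fun setT psi ->
  measurable_fun setT (map_tuple psi : n.-tuple T -> n.-tuple T1).
Proof.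
move=> mpsi; apply/measurable_fun_tnthP => i; rewrite /comp.
under eq_fun do rewrite tnth_map.
by apply: measurableT_comp => //; exact: measurable_fun_tnth.
Qed.

End tuples.

Section iid_integral.
Local Open Scope ereal_scope.
Context {d} {T : measurableType d} {R : realType}.
Variable P : probability T R.

Lemma ge0_integral_iid0 (f : 0.-tuple T -> \bar R) :
  measurable_fun setT f -> (forall t, 0 <= f t) ->
  \int[iid P 0]_t f t = f [tuple].
Proof. by move=> mf f0; rewrite /= integral_dirac // diracT mul1e. Qed.

Lemma ge0_integral_iidS n (f : n.+1.-tuple T -> \bar R) :
  measurable_fun setT f -> (forall t, 0 <= f t) ->
  \int[iid P n.+1]_t f t = \int[P]_x \int[iid P n]_t f (cons_pair (x, t)).
Proof.
move=> mf f0; rewrite /= (ge0_integral_distribution (@cons_pair _ _ n)) //.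
rewrite (@fubini_tonelli1 _ _ _ _ _ P (iid P n) (fun z => f (cons_pair z))) //.
exact: measurableT_comp.
Qed.

Lemma measurable_integral_iid_cons n (f : n.+1.-tuple T -> \bar R) :
  measurable_fun setT f -> (forall t, 0 <= f t) ->
  measurable_fun setT (fun x => \int[iid P n]_t f (cons_pair (x, t))).
Proof.
move=> mf f0;
  apply: (measurable_fun_fubini_tonelli_F (fun z => f (cons_pair z))) => //.
exact: measurableT_comp.
Qed.

Lemma ge0_integral_iid_resample n (i : 'I_n) (f : n.-tuple T -> \bar R) :
  measurable_fun setT f -> (forall t, 0 <= f t) ->
  \int[iid P n]_t f t = \int[iid P n]_t \int[P]_y f (set_tnth i t y).
Proof.
elim: n i f => [[]//|n IH] i f mf f0.
have mfs : measurable_fun setT (fun t => \int[P]_y f (set_tnth i t y)).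
  apply: (measurable_fun_fubini_tonelli_F
    (fun z : n.+1.-tuple T * T => f (set_tnth i z.1 z.2))) => //.
  exact: measurableT_comp mf (measurable_set_tnth i).
rewrite ge0_integral_iidS // [RHS]ge0_integral_iidS //; last first.
  by move=> t; exact: integral_ge0.
have [j ->|->] := unliftP ord0 i.
  apply: eq_integral => x _; rewrite (IH j) //; last first.
    exact: measurableT_comp mf (measurable_cons_pair1 x).
  by apply: eq_integral => t _; apply: eq_integral => y _;
    rewrite set_tnth_lift.
rewrite -[RHS](eq_integral _
  (fun=> \int[iid P n]_t \int[P]_y f (cons_pair (y, t)))); last first.
  move=> x _; apply: eq_integral => t _; apply: eq_integral => y _.
  by rewrite set_tnth_ord0.
rewrite integral_probability_cst.
rewrite (@fubini_tonelli _ _ _ _ _ P (iid P n) (fun z => f (cons_pair z))) //.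
exact: measurableT_comp.
Qed.

Lemma integral_iid_resample n (i : 'I_n) (f : n.-tuple T -> \bar R) :
  (iid P n).-integrable setT f ->
  \int[iid P n]_t f t = \int[iid P n]_t \int[P]_y f (set_tnth i t y).
Proof.
move=> /[dup] intf /integrableP[mf fi].
pose h (z : n.-tuple T * T) := f (set_tnth i z.1 z.2).
have mh : measurable_fun setT h.
  exact: measurableT_comp mf (measurable_set_tnth i).
have ih : (iid P n \x P).-integrable setT h.
  apply/integrable12ltyP => //.
  rewrite -(ge0_integral_iid_resample i (f := fun t => `|f t|)) //.
  exact: measurableT_comp.
have resample g g' : measurable_fun setT g -> (forall t, 0 <= g t) ->
    (forall z, g' z = g (set_tnth i z.1 z.2)) ->
    \int[iid P n]_t g t = \int[iid P n \x P]_z g' z.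
  move=> mg g0 gE; under [RHS]eq_integral do rewrite gE.
  rewrite (ge0_integral_iid_resample i) // fubini_tonelli1 //.
  exact: measurableT_comp mg (measurable_set_tnth i).
apply: etrans (esym (@integral12_prod_meas1 _ _ _ _ _ (iid P n) P h ih)).
rewrite integralE [RHS]integralE; congr (_ - _); apply: resample => //.
- exact: measurable_funepos.
- by move=> z; rewrite !funeposE.
- exact: measurable_funeneg.
- by move=> z; rewrite !funenegE.
Qed.

Lemma ge0_integral_iid_tnth n (i : 'I_n) (f : T -> \bar R) :
  measurable_fun setT f -> (forall x, 0 <= f x) ->
  \int[iid P n]_t f (tnth t i) = \int[P]_y f y.
Proof.
move=> mf f0; rewrite (ge0_integral_iid_resample i) //; last first.
  by apply: measurableT_comp => //; exact: measurable_fun_tnth.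
under eq_integral do under eq_integral do rewrite tnth_set_tnth eqxx.
exact: integral_probability_cst.
Qed.

Lemma ge0_integral_iid_cat p q (f : (p + q).-tuple T -> \bar R) :
  measurable_fun setT f -> (forall t, 0 <= f t) ->
  \int[iid P (p + q)]_t f t =
  \int[iid P p]_t \int[iid P q]_s f (cat_tuple t s).
Proof.
elim: p f => [|p IH] f mf f0.
  rewrite ge0_integral_iid0; last by move=> x; exact: integral_ge0.
    by apply: eq_integral => x _; congr f; exact: val_inj.
  apply: (measurable_fun_fubini_tonelli_F
    (fun z : 0.-tuple T * q.-tuple T => f (cat_tuple z.1 z.2))) => //.
  exact: measurableT_comp mf (@measurable_cat_tuple _ T _ q).
rewrite [LHS](@ge0_integral_iidS (p + q) f) // [RHS]ge0_integral_iidS.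
- apply: eq_integral => x _; rewrite IH //.
    apply: eq_integral => y _; apply: eq_integral => z _; congr f.
    exact: val_inj.
  exact: measurableT_comp mf (@measurable_cons_pair1 _ _ (p + q) x).
- apply: (measurable_fun_fubini_tonelli_F
    (fun z : p.+1.-tuple T * q.-tuple T => f (cat_tuple z.1 z.2))) => //.
  exact: measurableT_comp mf (@measurable_cat_tuple _ T _ q).
- by move=> x; exact: integral_ge0.
Qed.

End iid_integral.

Section iid_density.
Local Open Scope ereal_scope.
Context d1 d2 (T1 : measurableType d1) (T2 : measurableType d2) (R : realType).
Variables (P : probability T1 R) (Q : probability T2 R).
Variables (psi : T2 -> T1) (l : T2 -> R).
Hypotheses (mpsi : measurable_fun setT psi) (ml : measurable_fun setT l).
Hypothesis PQ : forall f : T1 -> \bar R,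
  measurable_fun setT f -> (forall x, 0 <= f x) ->
  \int[P]_x f x = \int[Q]_y (f (psi y) * (expR (l y))%:E).

Let measurable_weighted n (f : n.-tuple T1 -> \bar R) : measurable_fun setT f ->
  measurable_fun setT (fun t : n.-tuple T2 =>
    f (map_tuple psi t) * (expR (\sum_(i < n) l (tnth t i)))%:E).
Proof.
move=> mf; apply: emeasurable_funM.
  by apply: measurableT_comp => //; exact: measurable_map_tuple.
apply/measurable_EFinP; apply: measurableT_comp => //.
apply: measurable_sum => i; apply: measurableT_comp => //.
exact: measurable_fun_tnth.
Qed.

Let weighted_ge0 n (f : n.-tuple T1 -> \bar R) : (forall t, 0 <= f t) ->
  forall t : n.-tuple T2,
  0 <= f (map_tuple psi t) * (expR (\sum_(i < n) l (tnth t i)))%:E.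
Proof. by move=> f0 t; rewrite mule_ge0 // lee_fin expR_ge0. Qed.

Lemma ge0_integral_iid_density n (f : n.-tuple T1 -> \bar R) :
  measurable_fun setT f -> (forall t, 0 <= f t) ->
  \int[iid P n]_t f t =
  \int[iid Q n]_t (f (map_tuple psi t) * (expR (\sum_(i < n) l (tnth t i)))%:E).
Proof.
elim: n f => [|n IH] f mf f0.
  rewrite !ge0_integral_iid0 //;
    [|exact: measurable_weighted|exact: weighted_ge0].
  by rewrite big_ord0 expR0 mule1; congr f; exact: val_inj.
rewrite ge0_integral_iidS // [RHS]ge0_integral_iidS //.
- rewrite PQ; first last.
  + by move=> x; exact: integral_ge0.
  + exact: measurable_integral_iid_cons.
  apply: eq_integral => y _.
  have mfy := measurableT_comp mf (@measurable_cons_pair1 _ T1 n (psi y)).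
  rewrite IH // muleC -ge0_integralZl //; first last.
  + by move=> t _; exact: (weighted_ge0 (fun s => f0 (cons_pair (psi y, s)))).
  + exact: (measurable_weighted mfy).
  apply: eq_integral => t _; rewrite muleCA -EFinM -expRD big_ord_recl.
  congr (f _ * (expR (_ + _))%:E); first exact: val_inj.
  by apply: eq_bigr => i _; rewrite /cons_pair tnthS.
- exact: measurable_weighted.
- exact: weighted_ge0.
Qed.

End iid_density.

Section kernel_precomp.
Context d d1 d2 (W : measurableType d) (X : measurableType d1)
  (Y : measurableType d2) (R : realType).
Variables (k : R.-pker X ~> Y) (f : W -> X).

Definition kernel_precomp of measurable_fun setT f :
  W -> {measure set Y -> \bar R} := fun w => k (f w).

Hypothesis mf : measurable_fun setT f.

Let measurable_kernel_precomp A : measurable A ->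
  measurable_fun setT (kernel_precomp mf ^~ A).
Proof.
by move=> mA; exact: (measurableT_comp (measurable_kernel k _ mA) mf).
Qed.

HB.instance Definition _ := isKernel.Build _ _ _ _ _
  (kernel_precomp mf) measurable_kernel_precomp.

HB.instance Definition _ := Kernel_isProbability.Build _ _ _ _ _
  (kernel_precomp mf) (fun w => prob_kernel (f w)).

End kernel_precomp.

(** * Quadratic forms, matrix square roots and spectral norms *)

Section sqnorm.
Context (R : realType).

Definition sqnorm m n (A : 'M[R]_(m, n)) : R := \sum_i \sum_j A i j ^+ 2.

Lemma sqnorm_ge0 m n (A : 'M[R]_(m, n)) : 0 <= sqnorm A.
Proof. by apply: sumr_ge0 => i _; apply: sumr_ge0 => j _; exact: sqr_ge0. Qed.

Lemma sqnorm0 m n : sqnorm (0 : 'M[R]_(m, n)) = 0.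
Proof. by apply: big1 => i _; apply: big1 => j _; rewrite mxE expr0n. Qed.

Lemma sqnorm_eq0 m n (A : 'M[R]_(m, n)) : (sqnorm A == 0) = (A == 0).
Proof.
apply/eqP/eqP => [/eqP|->]; last exact: sqnorm0.
rewrite psumr_eq0 => [/allP A0|i _]; last first.
  by apply: sumr_ge0 => j _; exact: sqr_ge0.
apply/matrixP => i j; have := A0 i (mem_index_enum i).
rewrite psumr_eq0 => [/allP Ai0|k _]; last exact: sqr_ge0.
by have := Ai0 j (mem_index_enum j); rewrite mxE /= sqrf_eq0 => /eqP.
Qed.

Lemma sqnormZ m n c (A : 'M[R]_(m, n)) : sqnorm (c *: A) = c ^+ 2 * sqnorm A.
Proof.
rewrite /sqnorm mulr_sumr; apply: eq_bigr => i _; rewrite mulr_sumr.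
by apply: eq_bigr => j _; rewrite mxE exprMn.
Qed.

Lemma sqnorm_tr m n (A : 'M[R]_(m, n)) : sqnorm A^T = sqnorm A.
Proof.
rewrite /sqnorm exchange_big; apply: eq_bigr => i _; apply: eq_bigr => j _.
by rewrite mxE.
Qed.

Lemma sqnorm_mxtrace m n (A : 'M[R]_(m, n)) : sqnorm A = \tr (A *m A^T).
Proof.
apply: eq_bigr => i _; rewrite mxE; apply: eq_bigr => j _.
by rewrite mxE expr2.
Qed.

Lemma sqnorm_cV n (v : 'cV[R]_n) : sqnorm v = (v^T *m v) 0 0.
Proof. by rewrite sqnorm_mxtrace mxtrace_mulC /mxtrace big_ord1. Qed.

Lemma sqnormB_rV n (x y : 'rV[R]_n) :
  sqnorm (x - y) = sqnorm x - 2 * (x *m y^T) 0 0 + sqnorm y.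
Proof.
rewrite /sqnorm !big_ord1 mxE mulr_sumr -sumrB -big_split;
  apply: eq_bigr => i _.
by rewrite !mxE /=; ring.
Qed.

Lemma sqnorm_mulmx_orthogonal m n (A : 'M[R]_(m, n)) (Q : 'M[R]_n) :
  Q *m Q^T = 1%:M -> sqnorm (A *m Q) = sqnorm A.
Proof.
by move=> QQ; rewrite !sqnorm_mxtrace trmx_mul mulmxA -(mulmxA A) QQ mulmx1.
Qed.

Lemma sqnorm_row_mx m n1 n2 (A : 'M[R]_(m, n1)) (B : 'M[R]_(m, n2)) :
  sqnorm (row_mx A B) = sqnorm A + sqnorm B.
Proof.
rewrite /sqnorm -big_split; apply: eq_bigr => i _; rewrite big_split_ord /=.
congr (_ + _); apply: eq_bigr => j _; first by rewrite row_mxEl.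
by rewrite row_mxEr.
Qed.

Lemma sqnorm_col_mx m1 m2 n (A : 'M[R]_(m1, n)) (B : 'M[R]_(m2, n)) :
  sqnorm (col_mx A B) = sqnorm A + sqnorm B.
Proof. by rewrite -sqnorm_tr tr_col_mx sqnorm_row_mx !sqnorm_tr. Qed.

Lemma sqnorm_mxvec m n (A : 'M[R]_(m, n)) : sqnorm (mxvec A) = sqnorm A.
Proof.
rewrite /sqnorm big_ord1 (reindex _ (curry_mxvec_bij _ _)) pair_bigA /=.
by apply: eq_bigr => -[i j] _; rewrite mxvecE.
Qed.

Lemma sqnorm_sum_col m n (A : 'M[R]_(m, n)) :
  sqnorm A = \sum_j sqnorm (A *m (delta_mx j 0 : 'cV[R]_n)).
Proof.
rewrite /sqnorm exchange_big; apply: eq_bigr => j _; apply: eq_bigr => i _.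
by rewrite big_ord1 -colE mxE.
Qed.

Lemma sqnorm_delta_mx m n (i : 'I_m) (j : 'I_n) :
  sqnorm (delta_mx i j : 'M[R]_(m, n)) = 1.
Proof.
rewrite /sqnorm (bigD1 i) //= (bigD1 j) //= mxE !eqxx expr1n.
rewrite !big1 ?addr0 // => [k ki|k kj].
  by apply: big1 => l _; rewrite mxE (negbTE ki) expr0n.
by rewrite mxE (negbTE kj) andbF expr0n.
Qed.

End sqnorm.

Section max_norm.
Context (R : realType).

Lemma ler_mx_norm_entry m n (A : 'M[R]_(m, n)) i j : `|A i j| <= `|A|.
Proof.
rewrite [leRHS]mx_normrE.
exact: (@le_bigmax_cond _ _ _ _ (i, j) xpredT (fun ij => `|A ij.1 ij.2|)).
Qed.

Lemma mx_norm_le m n (A : 'M[R]_(m, n)) (c : R) : 0 <= c ->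
  (forall i j, `|A i j| <= c) -> `|A| <= c.
Proof.
by move=> c0 Ac; rewrite [leLHS]mx_normrE; apply: bigmax_le => // -[].
Qed.

Lemma mx_norm_mulmx m n p (A : 'M[R]_(m, n)) (B : 'M[R]_(n, p)) :
  `|A *m B| <= n%:R * (`|A| * `|B|).
Proof.
apply: mx_norm_le => [|i j]; first by rewrite !mulr_ge0.
rewrite mxE; apply: le_trans (ler_norm_sum _ _ _) _.
rewrite mulr_natl -[X in _ *+ X]card_ord -sumr_const; apply: ler_sum => k _.
by rewrite normrM; apply: ler_pM => //; exact: ler_mx_norm_entry.
Qed.

Lemma mx_norm_trmx m n (A : 'M[R]_(m, n)) : `|A^T| = `|A|.
Proof.
have le k l (B : 'M[R]_(k, l)) : `|B^T| <= `|B|.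
  by apply: mx_norm_le => // i j; rewrite mxE; exact: ler_mx_norm_entry.
by apply/eqP; rewrite eq_le le -{1}[A]trmxK le.
Qed.

Lemma quad_form_le d (A : 'M[R]_d) (v : 'cV[R]_d) :
  `|(v^T *m A *m v) 0 0| <= d%:R * `|A| * sqnorm v.
Proof.
have sqE : sqnorm v = \sum_i v i 0 ^+ 2.
  by apply: eq_bigr => i _; rewrite big_ord1.
have -> : d%:R * `|A| * sqnorm v =
    \sum_j \sum_i `|A| * ((v i 0 ^+ 2 + v j 0 ^+ 2) / 2).
  under eq_bigr do rewrite -mulr_sumr -mulr_suml big_split sumr_const card_ord.
  rewrite -mulr_sumr -mulr_suml big_split /= sumr_const card_ord sumrMnl -sqE.
  rewrite -!(mulr_natl (sqnorm v)); move: (d%:R) (sqnorm v) (`|A|) => x s a.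
  by field.
rewrite mxE; apply: le_trans (ler_norm_sum _ _ _) _.
apply: ler_sum => j _; rewrite mxE mulr_suml.
apply: le_trans (ler_norm_sum _ _ _) _; apply: ler_sum => i _.
rewrite mxE mulrAC mulrC !normrM; apply: ler_pM; rewrite ?ler_mx_norm_entry //.
rewrite -(real_normK (num_real (v i 0))) -(real_normK (num_real (v j 0))).
by have := sqr_ge0 (`|v i 0| - `|v j 0|); nra.
Qed.

End max_norm.

Section loewner.
Context (R : realType).

Lemma quad_form_subr d (A B : 'M[R]_d) (v : 'cV[R]_d) :
  (v^T *m (A - B) *m v) 0 0 = (v^T *m A *m v) 0 0 - (v^T *m B *m v) 0 0.
Proof. by rewrite mulmxBr mulmxBl !mxE. Qed.

Lemma quad_formZ d c (A : 'M[R]_d) (v : 'cV[R]_d) :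
  (v^T *m (c *: A) *m v) 0 0 = c * (v^T *m A *m v) 0 0.
Proof. by rewrite -scalemxAr -scalemxAl mxE. Qed.

Lemma quad_form_scalar d a (v : 'cV[R]_d) :
  (v^T *m a%:M *m v) 0 0 = a * sqnorm v.
Proof. by rewrite mul_mx_scalar -scalemxAl mxE -sqnorm_cV. Qed.

Lemma loewner_le_scalarl d a (S : 'M[R]_d) : S^T = S ->
  loewner_le a%:M S <->
  forall v : 'cV[R]_d, a * sqnorm v <= (v^T *m S *m v) 0 0.
Proof.
move=> sS; split=> [[_ aS] v|aS].
  by have := aS v; rewrite quad_form_subr quad_form_scalar subr_ge0.
split=> [|v]; first by rewrite linearB /= sS tr_scalar_mx.
by rewrite quad_form_subr quad_form_scalar subr_ge0.
Qed.

Lemma loewner_le_scalarr d a (S : 'M[R]_d) : S^T = S ->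
  loewner_le S a%:M <->
  forall v : 'cV[R]_d, (v^T *m S *m v) 0 0 <= a * sqnorm v.
Proof.
move=> sS; split=> [[_ aS] v|aS].
  by have := aS v; rewrite quad_form_subr quad_form_scalar subr_ge0.
split=> [|v]; first by rewrite linearB /= sS tr_scalar_mx.
by rewrite quad_form_subr quad_form_scalar subr_ge0.
Qed.

Lemma loewner_le_scalar_unitmx d a (S : 'M[R]_d) : 0 < a -> S^T = S ->
  loewner_le a%:M S -> S \in unitmx.
Proof.
move=> a0 sS /(loewner_le_scalarl _ sS) aS; rewrite unitmxE unitfE.
apply/det0P => -[v v0 vS]; have := aS v^T.
rewrite trmxK vS mul0mx mxE pmulr_rle0 // => v1.
by move: v0; rewrite -[v]trmxK trmx_eq0 -sqnorm_eq0 eq_le v1 sqnorm_ge0.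
Qed.

Lemma loewner_perturbed_identity d (E : 'M[R]_d) (a b c r : R) :
  E^T = E -> d%:R * `|E| <= r -> 0 <= c ->
  a <= c * (1 - r) -> c * (1 + r) <= b ->
  loewner_le a%:M (c *: (1%:M - E)) /\ loewner_le (c *: (1%:M - E)) b%:M.
Proof.
move=> sE Er c0 ac cb; set S := c *: _.
have sS : S^T = S by rewrite /S linearZ /= linearB /= trmx1 sE.
have SE (v : 'cV[R]_d) :
  (v^T *m S *m v) 0 0 = c * (sqnorm v - (v^T *m E *m v) 0 0).
  by rewrite /S quad_formZ quad_form_subr quad_form_scalar mul1r.
have Ev (v : 'cV[R]_d) : `|(v^T *m E *m v) 0 0| <= r * sqnorm v.
  by apply: le_trans (quad_form_le E v) _; rewrite ler_wpM2r // sqnorm_ge0.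
split; [apply/(loewner_le_scalarl _ sS)|apply/(loewner_le_scalarr _ sS)] => v;
  rewrite SE; have := Ev v; rewrite ler_norml => /andP[Ev_ge Ev_le].
  apply: le_trans (ler_wpM2r (sqnorm_ge0 v) ac) _.
  by rewrite -mulrA ler_wpM2l // mulrBl mul1r lerB.
apply: le_trans _ (ler_wpM2r (sqnorm_ge0 v) cb).
by rewrite -mulrA ler_wpM2l // mulrDl mul1r lerD2l lerNl.
Qed.

End loewner.

HB.instance Definition _ (R : realType) m n := Complete.on 'M[R]_(m, n).

Section square_root.
Context (R : realType).

(* For n = 0 both sides vanish, since x / 0 = 0. *)
Lemma ler_natl_div n (a x : R) : 0 <= a -> x <= a / n%:R -> n%:R * x <= a.
Proof.
case: n => [|n] a0; first by rewrite mul0r.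
by rewrite ler_pdivlMr ?ltr0n // mulrC.
Qed.

(* A fixed point Y = (E + Y^2) / 2 satisfies (1 - Y)^2 = 1 - E. The map is a
   contraction of the ball of radius 1 / (2d) for the entrywise maximum norm. *)
Section fixed_point.
Variables (d : nat) (E : 'M[R]_d).
Hypothesis Eb : `|E| <= 3 / 4 / d%:R.

Let r : R := 1 / 2 / d%:R.
Let ball0 : set 'M[R]_d := [set Y | `|Y| <= r].
Let iteration (Y : 'M[R]_d) : 'M[R]_d := 2^-1 *: (E + Y *m Y).

Let r_ge0 : 0 <= r.
Proof. by rewrite /r; apply: divr_ge0. Qed.

Let dr_le : d%:R * r <= 1 / 2.
Proof. by apply: ler_natl_div. Qed.

Let mulmx_ball0 (X Y : 'M[R]_d) : ball0 X -> `|X *m Y| <= 1 / 2 * `|Y|.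
Proof.
move=> Xr; apply: le_trans (mx_norm_mulmx X Y) _; rewrite mulrA ler_wpM2r //.
by apply: le_trans dr_le; exact: ler_wpM2l.
Qed.

Let mulmx_ball0r (X Y : 'M[R]_d) : ball0 Y -> `|X *m Y| <= 1 / 2 * `|X|.
Proof.
move=> Yr; rewrite -mx_norm_trmx trmx_mul -(mx_norm_trmx X).
by apply: mulmx_ball0; rewrite /ball0 /= mx_norm_trmx.
Qed.

Let normr_half (Y : 'M[R]_d) : `|2^-1 *: Y| = 2^-1 * `|Y|.
Proof. by rewrite normrZ ger0_norm. Qed.

Let iteration_ball0 : {homo iteration : Y / ball0 Y >-> ball0 Y}.
Proof.
move=> Y Yr; rewrite /ball0 /iteration /= normr_half.
have triangle := ler_normD E (Y *m Y); have YY_le := mulmx_ball0 Y Yr.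
have radiusE : 3 / 4 / d%:R = 3 / 2 * r.
  by rewrite /r mulrA; congr (_ / _); field.
by move: Yr Eb; rewrite /ball0 /= radiusE; lra.
Qed.

Let iteration_lipschitz (X Y : 'M[R]_d) : ball0 X -> ball0 Y ->
  `|iteration X - iteration Y| <= 1 / 2 * `|X - Y|.
Proof.
move=> Xr Yr; rewrite /iteration -scalerBr normr_half.
have -> : E + X *m X - (E + Y *m Y) = X *m (X - Y) + (X - Y) *m Y.
  by rewrite mulmxBr mulmxBl addrA subrK opprD addrACA subrr add0r.
have triangle := ler_normD (X *m (X - Y)) ((X - Y) *m Y).
have left_le := mulmx_ball0 (X - Y) Xr.
have right_le := mulmx_ball0r (X - Y) Yr.
by lra.
Qed.

Let iteration_fun : {fun ball0 >-> ball0} := mkfun iteration_ball0.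

Let iteration_contraction : is_contraction iteration_fun.
Proof.
exists (2^-1)%:nng; split; first by rewrite /=; lra.
by move=> [X Y] [/= Xr Yr]; have := iteration_lipschitz Xr Yr; rewrite mul1r.
Qed.

Lemma half_square_fixed_point : E^T = E ->
  exists Y : 'M[R]_d,
    [/\ Y^T = Y, `|Y| <= 1 / 2 / d%:R & Y = 2^-1 *: (E + Y *m Y)].
Proof.
move=> sE.
have closed_ball0 : closed ball0.
  by apply: closed_comp (@closed_le R r) => Y _; exact: norm_continuous.
have ball0_neq0 : ball0 !=set0 by exists 0; rewrite /ball0 /= normr0.
have [Y Yr YE] :=
  banach_fixed_point iteration_contraction closed_ball0 ball0_neq0.
exists Y; split=> //.
apply: (contraction_fixpoint_unique iteration_contraction) => //.
  by rewrite /ball0 /= mx_norm_trmx.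
by rewrite {1}YE /= /iteration linearZ linearD /= trmx_mul sE.
Qed.

End fixed_point.

Lemma psd_square_root_perturbed_identity d (E : 'M[R]_d) (c : R) :
  0 <= c -> E^T = E -> `|E| <= 3 / 4 / d%:R ->
  exists B : 'M[R]_d, psd B /\ B *m B = c *: (1%:M - E).
Proof.
move=> c0 sE Eb; have [Y [sY Yb YE]] := half_square_fixed_point Eb sE.
exists (Num.sqrt c *: (1%:M - Y)); split; last first.
  rewrite -scalemxAl -scalemxAr scalerA -expr2 sqr_sqrtr //; congr (_ *: _).
  rewrite mulmxBl mul1mx mulmxBr mulmx1 opprB.
  have -> : Y *m Y = 2 *: Y - E.
    by rewrite {3}YE scalerA divff // scale1r addrAC subrr add0r.
  by apply/matrixP => i j; rewrite !mxE; ring.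
have dY : d%:R * `|Y| <= 1.
  by have := ler_natl_div _ Yb; lra.
have c1 : 0 <= Num.sqrt c * (1 - 1) by rewrite subrr mulr0.
have [psdY _] :=
  loewner_perturbed_identity sY dY (sqrtr_ge0 c) c1
    (lexx (Num.sqrt c * (1 + 1))).
by move: psdY; rewrite /loewner_le raddf0 subr0.
Qed.

Lemma sqrtmxP d (S : 'M[R]_d) : (exists B, psd B /\ B *m B = S) ->
  psd (sqrtmx S) /\ sqrtmx S *m sqrtmx S = S.
Proof.
by case=> B BS;
  exact: (xgetPex 0 (ex_intro [set B | psd B /\ B *m B = S] B BS)).
Qed.

End square_root.

Section spectral_norm.
Context (R : realType).

Lemma l2norm_ge0 n (v : 'cV[R]_n) : 0 <= l2norm v.
Proof. exact: sqrtr_ge0. Qed.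

Lemma sqr_l2norm n (v : 'cV[R]_n) : l2norm v ^+ 2 = sqnorm v.
Proof.
rewrite sqr_sqrtr; last by apply: sumr_ge0 => i _; exact: sqr_ge0.
by apply: eq_bigr => i _; rewrite big_ord1.
Qed.

Lemma l2normZ n c (v : 'cV[R]_n) : 0 <= c -> l2norm (c *: v) = c * l2norm v.
Proof.
move=> c0; apply/eqP; rewrite -(eqrXn2 (n := 2)) ?mulr_ge0 ?l2norm_ge0 //.
by rewrite exprMn !sqr_l2norm sqnormZ.
Qed.

Lemma l2norm0 n : l2norm (0 : 'cV[R]_n) = 0.
Proof. by apply/eqP; rewrite -sqrf_eq0 sqr_l2norm sqnorm0. Qed.

Lemma ler_entry_l2norm n (v : 'cV[R]_n) i : `|v i 0| <= l2norm v.
Proof.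
rewrite -sqrtr_sqr ler_sqrt; last by apply: sumr_ge0 => j _; exact: sqr_ge0.
by rewrite (bigD1 i) //= lerDl; apply: sumr_ge0 => j _; exact: sqr_ge0.
Qed.

Lemma spectral_norm_has_ubound m n (K : 'M[R]_(m, n)) :
  has_ubound [set l2norm (K *m v) | v in [set v : 'cV[R]_n | l2norm v <= 1]].
Proof.
exists (Num.sqrt (\sum_i (\sum_j `|K i j|) ^+ 2)) => _ [v /= v1 <-].
rewrite ler_sqrt; last by apply: sumr_ge0 => i _; exact: sqr_ge0.
apply: ler_sum => i _; rewrite -real_normK ?num_real //.
apply: lerXn2r; rewrite ?nnegrE //; first exact: sumr_ge0.
rewrite mxE; apply: le_trans (ler_norm_sum _ _ _) _; apply: ler_sum => j _.
by rewrite normrM ler_piMr //; exact: le_trans (ler_entry_l2norm v j) v1.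
Qed.

Lemma l2norm_mulmx m n (K : 'M[R]_(m, n)) (v : 'cV[R]_n) :
  l2norm (K *m v) <= spectral_norm K * l2norm v.
Proof.
have [v0|v0] := eqVneq (l2norm v) 0.
  move/eqP: v0; rewrite -sqrf_eq0 sqr_l2norm sqnorm_eq0 => /eqP ->.
  by rewrite mulmx0 !l2norm0 mulr0.
have lv : 0 < l2norm v by rewrite lt_neqAle eq_sym v0 l2norm_ge0.
rewrite -ler_pdivrMr //; apply: ub_le_sup;
  first exact: spectral_norm_has_ubound.
exists ((l2norm v)^-1 *: v);
  first by rewrite /= l2normZ ?invr_ge0 ?mulVf // ltW.
by rewrite -scalemxAr l2normZ ?invr_ge0 1?mulrC // ltW.
Qed.

Lemma sqnorm_mulmx_spectral m n (K : 'M[R]_(m, n)) (v : 'cV[R]_n) :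
  sqnorm (K *m v) <= spectral_norm K ^+ 2 * sqnorm v.
Proof.
rewrite -!sqr_l2norm -exprMn; have Kv := l2norm_mulmx K v.
apply: lerXn2r => //; rewrite nnegrE ?l2norm_ge0 //.
exact: le_trans (l2norm_ge0 _) Kv.
Qed.

(* Writing A - S = S^(1/2) K S^(1/2), each of the d columns of A - S has square
   norm at most 2 |K|^2 2. *)
Lemma sqnorm_le_cov_error d (S A : 'M[R]_d) :
  (exists B, psd B /\ B *m B = S) -> loewner_le 1%:M S -> loewner_le S 2%:M ->
  sqnorm (A - S) <= 4 * d%:R * cov_error S A.
Proof.
move=> /sqrtmxP[]; rewrite /cov_error /invsqrtmx; set B := sqrtmx S.
move=> [sB _] BB S1 S2; set K := _ *m _ *m _.
have sS : S^T = S by rewrite -BB trmx_mul sB.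
have uB : B \in unitmx.
  have := loewner_le_scalar_unitmx ltr01 sS S1.
  by rewrite -BB unitmx_mul => /andP[].
have AE : A - S = B *m (K *m B) by rewrite /K mulmxKV // mulKVmx.
have sqnormB (v : 'cV[R]_d) : sqnorm (B *m v) <= 2 * sqnorm v.
  rewrite (_ : sqnorm (B *m v) = (v^T *m S *m v) 0 0).
    exact: (loewner_le_scalarr _ sS).1 S2 v.
  by rewrite sqnorm_cV trmx_mul sB -BB !mulmxA.
rewrite sqnorm_sum_col mulrAC mulrC mulr_natl -[X in _ *+ X]card_ord
  -sumr_const.
apply: ler_sum => j _; set u : 'cV[R]_d := delta_mx j 0.
have outer_le := sqnormB (K *m (B *m u)).
have spectral_le := sqnorm_mulmx_spectral K (B *m u).
have inner_le := sqnormB u; rewrite sqnorm_delta_mx in inner_le.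
have middle_le := ler_wpM2l (sqr_ge0 (spectral_norm K)) inner_le.
by rewrite AE -(mulmxA B (K *m B)) -(mulmxA K B); lra.
Qed.

End spectral_norm.

(** * Standard normal vectors *)

Section measurable_matrix_functions.
Context (R : realType) dT (T : measurableType dT).

Lemma measurable_fun_mx_entry m n (f : T -> 'M[R]_(m, n)) i j :
  measurable_fun setT f -> measurable_fun setT (fun x => f x i j).
Proof. by move=> /measurable_fun_matrixP. Qed.

Lemma measurable_fun_scalar_mx n (f : T -> R) :
  measurable_fun setT f -> measurable_fun setT (fun x => (f x)%:M : 'M[R]_n).
Proof.
move=> mf; apply/measurable_fun_matrixP => i j.
under eq_fun do rewrite mxE mulrb.
by case: (i == j); [|exact: measurable_cst].
Qed.

Lemma measurable_fun_addmx m n (f g : T -> 'M[R]_(m, n)) :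
  measurable_fun setT f -> measurable_fun setT g ->
  measurable_fun setT (fun x => f x + g x).
Proof.
move=> mf mg; apply/measurable_fun_matrixP => i j.
under eq_fun do rewrite mxE.
by apply: measurable_funD; exact: measurable_fun_mx_entry.
Qed.

Lemma measurable_fun_scalemx m n (h : T -> R) (f : T -> 'M[R]_(m, n)) :
  measurable_fun setT h -> measurable_fun setT f ->
  measurable_fun setT (fun x => h x *: f x).
Proof.
move=> mh mf; apply/measurable_fun_matrixP => i j.
under eq_fun do rewrite mxE.
by apply: measurable_funM => //; exact: measurable_fun_mx_entry.
Qed.

Lemma measurable_fun_trmx m n (f : T -> 'M[R]_(m, n)) :
  measurable_fun setT f -> measurable_fun setT (fun x => (f x)^T).
Proof.
move=> mf; apply/measurable_fun_matrixP => i j.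
by under eq_fun do rewrite mxE; exact: measurable_fun_mx_entry.
Qed.

Lemma measurable_fun_mulmx m n p (f : T -> 'M[R]_(m, n))
  (g : T -> 'M[R]_(n, p)) :
  measurable_fun setT f -> measurable_fun setT g ->
  measurable_fun setT (fun x => f x *m g x).
Proof.
move=> mf mg; apply/measurable_fun_matrixP => i j.
under eq_fun do rewrite mxE; apply: measurable_sum => k.
by apply: measurable_funM; exact: measurable_fun_mx_entry.
Qed.

Lemma measurable_fun_row_mx m n1 n2 (f : T -> 'M[R]_(m, n1))
    (g : T -> 'M[R]_(m, n2)) :
  measurable_fun setT f -> measurable_fun setT g ->
  measurable_fun setT (fun x => row_mx (f x) (g x)).
Proof.
move=> mf mg; apply/measurable_fun_matrixP => i j.
case: (split_ordP j) => k ->.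
  by under eq_fun do rewrite row_mxEl; exact: measurable_fun_mx_entry.
by under eq_fun do rewrite row_mxEr; exact: measurable_fun_mx_entry.
Qed.

Lemma measurable_fun_col_mx m1 m2 n (f : T -> 'M[R]_(m1, n))
    (g : T -> 'M[R]_(m2, n)) :
  measurable_fun setT f -> measurable_fun setT g ->
  measurable_fun setT (fun x => col_mx (f x) (g x)).
Proof.
move=> mf mg; apply/measurable_fun_matrixP => i j.
case: (split_ordP i) => k ->.
  by under eq_fun do rewrite col_mxEu; exact: measurable_fun_mx_entry.
by under eq_fun do rewrite col_mxEd; exact: measurable_fun_mx_entry.
Qed.

Lemma measurable_fun_sqnorm m n (f : T -> 'M[R]_(m, n)) :
  measurable_fun setT f -> measurable_fun setT (fun x => sqnorm (f x)).
Proof.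
move=> mf; apply: measurable_sum => i; apply: measurable_sum => j.
by apply: measurable_funX; exact: measurable_fun_mx_entry.
Qed.

End measurable_matrix_functions.

Ltac measurability := repeat first
  [ assumption | exact: measurable_cst | exact: measurable_id
  | exact: measurable_fst | exact: measurable_snd
  | apply: measurable_fun_sqnorm
  | apply: measurable_fun_addmx | apply: measurable_fun_mulmx
  | apply: measurable_fun_scalemx | apply: measurable_fun_row_mx
  | apply: measurable_fun_col_mx
  | apply: measurable_fun_trmx | apply: measurable_fun_scalar_mx
  | apply: (iffRL (measurable_EFinP _ _))
  | apply: measurable_sum => ? | apply: measurable_funD | apply: measurable_funB
  | apply: emeasurable_funM | apply: measurable_funM | apply: measurable_funX
  | apply: (measurableT_comp (@measurable_expR _))
  | apply: (measurableT_comp (@oppr_measurable _ _))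
  | apply: (measurableT_comp (@normr_measurable _ _))
  | apply: measurable_fun_tnth | apply: measurable_fun_mx_entry
  | apply: (measurableT_comp measurable_fst)
  | apply: (measurableT_comp measurable_snd) ].

Section lebesgue_affine.
Context (R : realType).
Local Notation leb := (@lebesgue_measure R).
Local Open Scope ereal_scope.

Lemma ge0_integral_lebesgueN (f : measurableTypeR R -> \bar R) :
  measurable_fun setT f -> (forall x, 0 <= f x) ->
  \int[leb]_x f (- x)%R = \int[leb]_x f x.
Proof.
move=> mf f0;
  have mN : measurable_fun setT (-%R : measurableTypeR R -> measurableTypeR R).
  exact: oppr_measurable.
have := ge0_integral_pushforward mN leb measurableT mf (fun x _ => f0 x).
rewrite preimage_setT => <-.
by apply: eq_measure_integral => A mA _; exact: lebesgue_measureN.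
Qed.

Let gt0_integral_lebesgue_affine (a b : R) (f : measurableTypeR R -> \bar R) :
  (0 < a)%R -> measurable_fun setT f -> (forall x, 0 <= f x) ->
  a%:E * \int[leb]_x f (a * x + b)%R = \int[leb]_x f x.
Proof.
move=> a0 mf f0.
pose phi (x : measurableTypeR R) : measurableTypeR R := (a * x + b)%R.
have mphi : measurable_fun setT phi.
  by apply: measurable_funD => //; apply: measurable_funM.
pose m' : {measure set (measurableTypeR R) -> \bar R} :=
  mscale (NngNum (ltW a0)) (pushforward leb phi).
pose m := m' mphi.
have lebE A : measurable A -> leb A = m A.
  apply: lebesgue_measure_unique => _ [[x y] /= xy <-].
  rewrite /mscale /= /pushforward.
  have -> : phi @^-1` `]x, y] = `]((x - b) / a)%R, ((y - b) / a)%R]%classic.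
    apply/seteqP; split=> t; rewrite /phi /= !in_itv /=;
      by rewrite ltr_pdivrMr // ler_pdivlMr // [(t * a)%R]mulrC ltrBlDr lerBrDr.
  rewrite !lebesgue_measure_itv /= !lte_fin ltr_pM2r ?invr_gt0 // ltrD2r.
  case: ifPn => _; last by rewrite mule0.
  by rewrite -!EFinD -EFinM; congr (_%:E); field; rewrite gt_eqF.
rewrite [RHS](eq_measure_integral m) => [|A mA _]; last exact: lebE.
by rewrite ge0_integral_mscale //; congr (_ * _);
  rewrite ge0_integral_pushforward.
Qed.

Lemma ge0_integral_lebesgue_affine (a b : R) (f : measurableTypeR R -> \bar R) :
  a != 0%R -> measurable_fun setT f -> (forall x, 0 <= f x) ->
  `|a|%:E * \int[leb]_x f (a * x + b)%R = \int[leb]_x f x.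
Proof.
move=> a0 mf f0; case: (ltgtP a 0%R) a0 => // a0 _.
- rewrite -(ge0_integral_lebesgueN mf f0) ltr0_norm //.
  rewrite -[RHS](@gt0_integral_lebesgue_affine (- a) (- b)) ?oppr_gt0 //.
    by congr (_ * _); apply: eq_integral => x _; rewrite mulNr -opprD opprK.
  by apply: (measurableT_comp mf); exact: oppr_measurable.
- by rewrite gtr0_norm //; exact: gt0_integral_lebesgue_affine.
Qed.

End lebesgue_affine.

Section stdnormal.
Context (R : realType).
Local Notation normal01 := (normal_prob (0 : R) 1).
Local Open Scope ereal_scope.

Definition row_of_tuple d (g : d.-tuple (measurableTypeR R)) : 'rV[R]_d :=
  \row_i tnth g i.

Let measurable_row_of_tuple d : measurable_fun setT (@row_of_tuple d).
Proof.
apply/measurable_fun_matrixP => i j; under eq_fun do rewrite mxE.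
exact: measurable_tnth.
Qed.

HB.instance Definition _ d :=
  isMeasurableFun.Build _ _ _ _ (@row_of_tuple d) (@measurable_row_of_tuple d).

Definition stdnormal d : probability 'rV[R]_d R :=
  distribution (iid normal01 d) (@row_of_tuple d).

Lemma ge0_integral_stdnormal d (f : 'rV[R]_d -> \bar R) :
  measurable_fun setT f -> (forall x, 0 <= f x) ->
  \int[stdnormal d]_x f x = \int[iid normal01 d]_g f (row_of_tuple g).
Proof. exact: (ge0_integral_distribution (@row_of_tuple d)). Qed.

Lemma ge0_integral_stdnormal1 (f : 'rV[R]_1 -> \bar R) :
  measurable_fun setT f -> (forall x, 0 <= f x) ->
  \int[stdnormal 1]_x f x = \int[normal01]_t f t%:M.
Proof.
move=> mf f0; rewrite ge0_integral_stdnormal //.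
rewrite -(ge0_integral_iid_tnth normal01 (ord0 : 'I_1) (f := fun t => f t%:M)) //.
  apply: eq_integral => g _; congr f; apply/rowP => i.
  by rewrite !mxE !ord1 eqxx mulr1n.
by apply: (measurableT_comp mf); exact: measurable_fun_scalar_mx.
Qed.

Lemma ge0_integral_stdnormal_row_mx p q (f : 'rV[R]_(p + q) -> \bar R) :
  measurable_fun setT f -> (forall x, 0 <= f x) ->
  \int[stdnormal (p + q)]_x f x =
  \int[stdnormal p]_x \int[stdnormal q]_y f (row_mx x y).
Proof.
move=> mf f0; pose F (z : 'rV[R]_p * 'rV[R]_q) := f (row_mx z.1 z.2).
have mF : measurable_fun setT F.
  by apply: (measurableT_comp mf); measurability.
rewrite ge0_integral_stdnormal // ge0_integral_iid_cat //; last first.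
  exact: (measurableT_comp mf (measurable_funPT (@row_of_tuple (p + q)))).
rewrite [RHS]ge0_integral_stdnormal; last 2 first.
- by apply: (measurable_fun_fubini_tonelli_F F) => // z; exact: f0.
- by move=> x; exact: integral_ge0.
apply: eq_integral => g _; rewrite ge0_integral_stdnormal //; last first.
  exact: (measurableT_comp mF (measurable_pair1 _)).
apply: eq_integral => h _; congr f; apply/rowP => i; rewrite mxE.
case: (split_ordP i) => j ->; first by rewrite tnth_lshift row_mxEl mxE.
by rewrite tnth_rshift row_mxEr mxE.
Qed.

End stdnormal.

(** * Linear changes of variables in Gaussian integrals *)

Section flat_integral.
Context (R : realType).
Local Notation normal01 := (normal_prob (0 : R) 1).

(* The Lebesgue integral on 'rV_d divided by (2 pi)^(d/2), obtained by
   cancelling the density of the standard normal law. *)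
Definition flat_integral d (f : 'rV[R]_d -> \bar R) : \bar R :=
  (\int[stdnormal R d]_x (f x * (expR (sqnorm x / 2))%:E))%E.

Let measurable_flat_integrand d (f : 'rV[R]_d -> \bar R) :
  measurable_fun setT f ->
  measurable_fun setT (fun x => f x * (expR (sqnorm x / 2))%:E)%E.
Proof. by move=> mf; measurability. Qed.

Let flat_integrand_ge0 d (f : 'rV[R]_d -> \bar R) x :
  (forall y, (0 <= f y)%E) ->
  (0 <= f x * (expR (sqnorm x / 2))%:E)%E.
Proof. by move=> f0; rewrite mule_ge0 // lee_fin expR_ge0. Qed.

Lemma flat_integral_ge0 d (f : 'rV[R]_d -> \bar R) :
  (forall x, (0 <= f x)%E) -> (0 <= flat_integral f)%E.
Proof. by move=> f0; apply: integral_ge0 => x _; exact: flat_integrand_ge0. Qed.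

Lemma integral_stdnormal_flat d (f : 'rV[R]_d -> \bar R) :
  (\int[stdnormal R d]_x f x =
   flat_integral (fun x => f x * (expR (- (sqnorm x / 2)))%:E))%E.
Proof.
by apply: eq_integral => x _; rewrite -muleA -EFinM -expRD addNr expR0 mule1.
Qed.

Lemma flat_integral1 (f : 'rV[R]_1 -> \bar R) :
  measurable_fun setT f -> (forall x, (0 <= f x)%E) ->
  (flat_integral f =
   (normal_peak (1 : R))%:E * \int[lebesgue_measure]_t f t%:M)%E.
Proof.
move=> mf f0; rewrite /flat_integral ge0_integral_stdnormal1 //; last first.
  by move=> x; exact: flat_integrand_ge0.
  exact: measurable_flat_integrand.
have mfM : measurable_fun setT (fun t : measurableTypeR R => f t%:M).
  by apply: (measurableT_comp mf); measurability.
rewrite (@ge0_integral_density _ _ _ lebesgue_measure normal01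
  (normal_pdf 0 1)).
- rewrite -ge0_integralZl //; last by rewrite lee_fin normal_peak_ge0.
  apply: eq_integral => t _; rewrite -muleA muleC; congr (_ * _)%E.
  rewrite -EFinM normal_pdfE // mulrCA -expRD /normal_fun subr0 expr1n.
  rewrite /sqnorm !big_ord1 mxE eqxx mulr1n.
  by rewrite (_ : (_ + _) = 0) ?expR0 ?mulr1 // mulNr addrN.
- by move=> t; exact: normal_pdf_ge0.
- exact: measurable_normal_pdf.
- by [].
- by measurability.
- by move=> t; exact: flat_integrand_ge0.
Qed.

Section blocks.
Variables (p q : nat) (f : 'rV[R]_(p + q) -> \bar R).
Hypotheses (mf : measurable_fun setT f) (f0 : forall x, (0 <= f x)%E).

Let F (z : 'rV[R]_p * 'rV[R]_q) : \bar R :=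
  (f (row_mx z.1 z.2) *
   (expR (sqnorm z.1 / 2) * expR (sqnorm z.2 / 2))%:E)%E.

Let mF : measurable_fun setT F.
Proof.
apply: emeasurable_funM; last by measurability.
by apply: (measurableT_comp mf); measurability.
Qed.

Let F0 z : (0 <= F z)%E.
Proof. by rewrite mule_ge0 // lee_fin mulr_ge0 // expR_ge0. Qed.

Let flat_integralF :
  (flat_integral f = \int[stdnormal R p]_x \int[stdnormal R q]_y F (x, y))%E.
Proof.
rewrite /flat_integral ge0_integral_stdnormal_row_mx.
- apply: eq_integral => x _; apply: eq_integral => y _; rewrite /F /=.
  by rewrite -expRD -mulrDl -sqnorm_row_mx.
- exact: measurable_flat_integrand.
- by move=> x; exact: flat_integrand_ge0.
Qed.

Let mfx x : measurable_fun setT (fun y => f (row_mx x y)).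
Proof. by apply: (measurableT_comp mf); measurability. Qed.

Let mfy y : measurable_fun setT (fun x => f (row_mx x y)).
Proof. by apply: (measurableT_comp mf); measurability. Qed.

Lemma measurable_flat_integral_row_mx :
  measurable_fun setT (fun x => flat_integral (fun y => f (row_mx x y))).
Proof.
apply: (measurable_fun_fubini_tonelli_F (fun z : 'rV[R]_p * 'rV[R]_q =>
  f (row_mx z.1 z.2) * (expR (sqnorm z.2 / 2))%:E)%E); last first.
  by move=> z; rewrite mule_ge0 // lee_fin expR_ge0.
apply: emeasurable_funM; last by measurability.
by apply: (measurableT_comp mf); measurability.
Qed.

Lemma flat_integral_row_mx :
  flat_integral f =
  flat_integral (fun x => flat_integral (fun y => f (row_mx x y))).
Proof.
rewrite flat_integralF; apply: eq_integral => x _; rewrite muleC /flat_integral.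
rewrite -ge0_integralZl ?lee_fin ?expR_ge0 //.
- by apply: eq_integral => y _; rewrite /F EFinM muleCA.
- exact: measurable_flat_integrand.
- by move=> y _; rewrite mule_ge0 // lee_fin expR_ge0.
Qed.

Lemma flat_integral_row_mx_swap :
  flat_integral f =
  flat_integral (fun y => flat_integral (fun x => f (row_mx x y))).
Proof.
rewrite flat_integralF (fubini_tonelli F) //; apply: eq_integral => y _.
rewrite muleC /flat_integral -ge0_integralZl ?lee_fin ?expR_ge0 //.
- by apply: eq_integral => x _; rewrite /F mulrC EFinM muleCA.
- exact: measurable_flat_integrand.
- by move=> x _; rewrite mule_ge0 // lee_fin expR_ge0.
Qed.

End blocks.

Let flat_integral1_affine (a : R) (b : 'rV[R]_1) (f : 'rV[R]_1 -> \bar R) :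
  a != 0 -> measurable_fun setT f -> (forall x, (0 <= f x)%E) ->
  (`|a|%:E * flat_integral (fun x => f (a *: x + b)%R) = flat_integral f)%E.
Proof.
move=> a0 mf f0; rewrite !flat_integral1 //; last first.
  by apply: (measurableT_comp mf); measurability.
have mfM : measurable_fun setT (fun t : measurableTypeR R => f t%:M).
  by apply: (measurableT_comp mf); measurability.
rewrite -(ge0_integral_lebesgue_affine (b 0 0) a0 mfM) // muleCA.
congr (_ * (_ * _))%E; apply: eq_integral => t _; congr f.
by rewrite [in LHS](mx11_scalar b) scale_scalar_mx -raddfD.
Qed.

Lemma flat_integral_translate d (f : 'rV[R]_d -> \bar R) (r : 'rV[R]_d) :
  measurable_fun setT f -> (forall x, (0 <= f x)%E) ->
  flat_integral (fun x => f (x + r)) = flat_integral f.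
Proof.
elim: d f r => [|d IH] f r mf f0.
  by congr flat_integral; apply/funext => x;
    rewrite [(x + r)]thinmx0 [x]thinmx0.
change (measurable_fun setT (f : 'rV[R]_(1 + d) -> \bar R)) in mf.
have mfr : measurable_fun setT (fun x : 'rV[R]_(1 + d) => f (x + r)).
  by apply: (measurableT_comp mf); measurability.
apply: etrans (@flat_integral_row_mx 1 d _ mfr (fun x => f0 _)) _; apply/esym.
apply: etrans (@flat_integral_row_mx 1 d f mf f0) _; apply/esym.
pose g x := flat_integral (fun y : 'rV[R]_d => f (row_mx (x : 'rV[R]_1) y)).
have mg : measurable_fun setT g
  by exact: (@measurable_flat_integral_row_mx 1 d).
have g0 x : (0 <= g x)%E by exact: flat_integral_ge0.
rewrite -/(flat_integral g).
rewrite -(flat_integral1_affine (lsubmx (r : 'rV[R]_(1 + d)))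
  (oner_neq0 _) mg g0).
rewrite normr1 mul1e; congr flat_integral; apply/funext => x; rewrite /g.
rewrite -[RHS](IH _ (rsubmx (r : 'rV[R]_(1 + d)))) //; last first.
  by apply: (measurableT_comp mf); measurability.
congr flat_integral; apply/funext => y; congr f.
by rewrite -[in LHS](hsubmxK (r : 'rV[R]_(1 + d))) add_row_mx scale1r.
Qed.

Definition flat_change_of_variables d (A : 'M[R]_d) :=
  forall f : 'rV[R]_d -> \bar R,
  measurable_fun setT f -> (forall x, (0 <= f x)%E) ->
  (`|\det A|%:E * flat_integral (fun x => f (x *m A)) = flat_integral f)%E.

Let measurable_comp_mulmxr m d (f : 'rV[R]_d -> \bar R) (A : 'M[R]_(m, d)) :
  measurable_fun setT f -> measurable_fun setT (fun x : 'rV[R]_m => f (x *m A)).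
Proof. by move=> mf; apply: (measurableT_comp mf); measurability. Qed.

Lemma flat_change_of_variables_mulmx d (A B : 'M[R]_d) :
  flat_change_of_variables A -> flat_change_of_variables B ->
  flat_change_of_variables (A *m B).
Proof.
move=> cA cB f mf f0; rewrite -(cB f mf f0).
rewrite -(cA (fun x => f (x *m B))) //; last exact: measurable_comp_mulmxr.
rewrite det_mulmx normrM mulrC EFinM -muleA;
  congr (_ * (_ * flat_integral _))%E.
by apply/funext => x; rewrite mulmxA.
Qed.

Lemma flat_change_of_variables_scalar1 (a : R) :
  a != 0 -> flat_change_of_variables (a%:M : 'M[R]_1).
Proof.
move=> a0 f mf f0; rewrite det_scalar expr1.
rewrite -(@flat_integral1_affine a 0 f) //.
congr (_ * flat_integral _)%E; apply/funext => x.
by rewrite mul_mx_scalar addr0.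
Qed.

Lemma flat_change_of_variables_block_diag p q (A : 'M[R]_p) (B : 'M[R]_q) :
  flat_change_of_variables A -> flat_change_of_variables B ->
  flat_change_of_variables (block_mx A 0 0 B).
Proof.
move=> cA cB f mf f0; rewrite det_ublock normrM.
have mfA := measurable_comp_mulmxr (block_mx A 0 0 B) mf.
rewrite (flat_integral_row_mx mfA (fun x => f0 _)) (flat_integral_row_mx mf f0).
pose g x := flat_integral (fun y : 'rV[R]_q => f (row_mx (x : 'rV[R]_p) y)).
have mg : measurable_fun setT g by exact: measurable_flat_integral_row_mx.
have g0 x : (0 <= g x)%E by exact: flat_integral_ge0.
apply: etrans (cA g mg g0).
rewrite EFinM -muleA; congr (_ * _)%E.
rewrite /flat_integral -ge0_integralZl ?lee_fin //; first last.
- by move=> x _; rewrite mule_ge0 ?lee_fin ?expR_ge0 // flat_integral_ge0.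
- exact: measurable_flat_integrand (measurable_flat_integral_row_mx mfA _).
apply: eq_integral => x _; rewrite muleA; congr (_ * _)%E.
rewrite -/(flat_integral _) /g -(cB (fun y => f (row_mx (x *m A) y))) //.
  congr (_ * flat_integral _)%E; apply/funext => y.
  by rewrite mul_row_block !mulmx0 addr0 add0r.
by apply: (measurableT_comp mf); measurability.
Qed.

Lemma flat_change_of_variables_ushear p q (C : 'M[R]_(p, q)) :
  flat_change_of_variables (block_mx 1%:M C 0 1%:M).
Proof.
move=> f mf f0; rewrite det_ublock !det1 mulr1 normr1 mul1e.
have mfU := measurable_comp_mulmxr (block_mx 1%:M C 0 1%:M) mf.
rewrite (flat_integral_row_mx mfU (fun x => f0 _)) (flat_integral_row_mx mf f0).
congr flat_integral; apply/funext => x.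
have mfx : measurable_fun setT (fun y => f (row_mx x y)).
  by apply: (measurableT_comp mf); measurability.
rewrite -[RHS](flat_integral_translate (x *m C) mfx (fun y => f0 _)).
congr flat_integral; apply/funext => y; rewrite mul_row_block.
by rewrite !mulmx1 mulmx0 addr0 addrC.
Qed.

Lemma flat_change_of_variables_lshear p q (C : 'M[R]_(q, p)) :
  flat_change_of_variables (block_mx 1%:M 0 C 1%:M).
Proof.
move=> f mf f0; rewrite det_lblock !det1 mulr1 normr1 mul1e.
have mfL := measurable_comp_mulmxr (block_mx 1%:M 0 C 1%:M) mf.
rewrite (flat_integral_row_mx_swap mfL (fun x => f0 _)).
rewrite (flat_integral_row_mx_swap mf f0); congr flat_integral;
  apply/funext => y.
have mfy : measurable_fun setT (fun x => f (row_mx x y)).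
  by apply: (measurableT_comp mf); measurability.
rewrite -[RHS](flat_integral_translate (y *m C) mfy (fun x => f0 _)).
congr flat_integral; apply/funext => x; rewrite mul_row_block.
by rewrite !mulmx1 mulmx0 add0r.
Qed.

Lemma unitmx_ushear_corner_neq0 d (A : 'M[R]_(1 + d)) : A \in unitmx ->
  exists r : 'rV[R]_d, ulsubmx (block_mx 1%:M r 0 1%:M *m A) 0 0 != 0.
Proof.
move=> uA; have ulE (r : 'rV[R]_d) :
    ulsubmx (block_mx 1%:M r 0 1%:M *m A) = ulsubmx A + r *m dlsubmx A.
  by rewrite -{1}[A]submxK mulmx_block block_mxKul mul1mx.
have [a0|a0] := eqVneq (ulsubmx A 0 0) 0; last first.
  by exists 0; rewrite ulE mul0mx addr0.
have ul0 : ulsubmx A = 0 by rewrite [LHS]mx11_scalar a0 raddf0.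
have [c0|/cV0Pn[i ci]] := eqVneq (dlsubmx A) 0; last first.
  by exists (delta_mx 0 i); rewrite ulE ul0 add0r -rowE mxE.
move: uA;
  rewrite unitmxE unitfE -[A]submxK c0 det_ublock ul0 det0 ?mul0r ?eqxx //.
Qed.

Lemma block_LDU d (a : R) (r : 'rV[R]_d) (c : 'cV[R]_d) (D : 'M[R]_d) :
  a != 0 ->
  block_mx (a%:M : 'M[R]_1) r c D =
  block_mx 1%:M 0 (a^-1 *: c) 1%:M *m
  block_mx a%:M 0 0 (D - a^-1 *: (c *m r)) *m block_mx 1%:M (a^-1 *: r) 0 1%:M.
Proof.
move=> a0; rewrite !mulmx_block !(mul1mx, mulmx1, mul0mx, mulmx0, addr0, add0r).
rewrite !mul_scalar_mx !mul_mx_scalar !scalerA divff // !scale1r.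
by rewrite -scalemxAr addrC subrK.
Qed.

(* A shear makes the corner entry of A nonzero, and A is then a product of
   shears and of a block diagonal matrix. *)
Let flat_change_of_variables_unitmxS d (A : 'M[R]_(1 + d)) :
  (forall S : 'M[R]_d, S \in unitmx -> flat_change_of_variables S) ->
  A \in unitmx -> flat_change_of_variables A.
Proof.
move=> IH uA; have [r] := unitmx_ushear_corner_neq0 uA.
set U := block_mx 1%:M r 0 1%:M; set B := U *m A; set a := ulsubmx B 0 0 => a0.
have VU : block_mx 1%:M (- r) 0 1%:M *m U = 1%:M.
  rewrite mulmx_block !(mul1mx, mulmx1, mul0mx, mulmx0, addr0, add0r) subrr.
  by rewrite -scalar_mx_block.
have -> : A = block_mx 1%:M (- r) 0 1%:M *m B by rewrite mulmxA VU mul1mx.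
apply: flat_change_of_variables_mulmx.
  exact: flat_change_of_variables_ushear.
have uB : B \in unitmx.
  by rewrite unitmx_mul uA andbT; have [] := mulmx1_unit VU.
have BE := block_LDU (ursubmx B) (dlsubmx B) (drsubmx B) a0.
rewrite -{1}mx11_scalar submxK in BE; move: uB; rewrite BE !unitmx_mul.
set S := drsubmx B - _ => /andP[/andP[_ uS] _].
apply: flat_change_of_variables_mulmx; last first.
  exact: flat_change_of_variables_ushear.
apply: flat_change_of_variables_mulmx.
  exact: flat_change_of_variables_lshear.
apply: flat_change_of_variables_block_diag.
  exact: flat_change_of_variables_scalar1.
by apply: IH; move: uS; rewrite !unitmxE det_ublock unitrM => /andP[].
Qed.

Lemma flat_change_of_variables_unitmx d (A : 'M[R]_d) :
  A \in unitmx -> flat_change_of_variables A.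
Proof.
elim: d A => [|d IH] A uA; last exact: (@flat_change_of_variables_unitmxS d).
move=> f mf f0; rewrite det_mx00 normr1 mul1e; congr flat_integral.
by apply/funext => x; rewrite [x *m A]thinmx0 [x]thinmx0.
Qed.

End flat_integral.

Section stdnormal_theory.
Context (R : realType).
Local Notation normal01 := (normal_prob (0 : R) 1).
Local Notation stdnormal := (stdnormal R).

Lemma stdnormal_orthogonal d (Q : 'M[R]_d) (f : 'rV[R]_d -> \bar R) :
  Q *m Q^T = 1%:M -> measurable_fun setT f -> (forall x, (0 <= f x)%E) ->
  (\int[stdnormal d]_x f (x *m Q) = \int[stdnormal d]_x f x)%E.
Proof.
move=> QQ mf f0; have [uQ _] := mulmx1_unit QQ.
have detQ : `|\det Q| = 1.
  apply/eqP; rewrite -(eqrXn2 (n := 2)) // expr1n real_normK ?num_real //.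
  by rewrite expr2 -{2}det_tr -det_mulmx QQ det1.
pose g (x : 'rV[R]_d) := (f x * (expR (- (sqnorm x / 2)))%:E)%E.
have mg : measurable_fun setT g by rewrite /g; measurability.
have g0 x : (0 <= g x)%E by rewrite mule_ge0 // lee_fin expR_ge0.
rewrite (integral_stdnormal_flat (fun x => f (x *m Q))) integral_stdnormal_flat.
rewrite -/g -(flat_change_of_variables_unitmx uQ mg g0) detQ mul1e.
congr flat_integral; apply/funext => x.
by rewrite /g (sqnorm_mulmx_orthogonal _ QQ).
Qed.

(* The law of x A, for x standard normal, depends only on the covariance A^T A:
   x A B^-1 is again standard normal because A B^-1 is orthogonal. *)
Lemma stdnormal_gram d (A B : 'M[R]_d) (f : 'rV[R]_d -> \bar R) :
  A^T *m A \in unitmx -> A^T *m A = B^T *m B ->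
  measurable_fun setT f -> (forall x, (0 <= f x)%E) ->
  (\int[stdnormal d]_x f (x *m A) = \int[stdnormal d]_x f (x *m B))%E.
Proof.
move=> uAA AB mf f0.
have uB : B \in unitmx by move: uAA; rewrite AB unitmx_mul => /andP[].
have QQ : (A *m invmx B) *m (A *m invmx B)^T = 1%:M.
  apply: mulmx1C; rewrite trmx_mul trmx_inv mulmxA -(mulmxA _ A^T) AB.
  by rewrite mulmxA mulVmx ?unitmx_tr // mul1mx mulmxV.
rewrite -[RHS](stdnormal_orthogonal (f := fun x => f (x *m B)) QQ) //.
  by apply: eq_integral => x _; rewrite mulmxA mulmxKV.
by apply: (measurableT_comp mf); measurability.
Qed.

Lemma stdnormal_translate d (f : 'rV[R]_d -> \bar R) (r : 'rV[R]_d) :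
  measurable_fun setT f -> (forall x, (0 <= f x)%E) ->
  (\int[stdnormal d]_x f (x + r)%R =
   \int[stdnormal d]_x (f x * (expR ((x *m r^T) 0 0 - sqnorm r / 2))%:E))%E.
Proof.
move=> mf f0.
pose g (x : 'rV[R]_d) := (f x * (expR (- (sqnorm (x - r) / 2)))%:E)%E.
have mg : measurable_fun setT g by rewrite /g; measurability.
have g0 x : (0 <= g x)%E by rewrite mule_ge0 // lee_fin expR_ge0.
rewrite (integral_stdnormal_flat (fun x => f (x + r))).
transitivity (flat_integral (fun x => g (x + r))).
  by congr flat_integral; apply/funext => x; rewrite /g addrK.
rewrite (flat_integral_translate r mg g0); apply: eq_integral => x _.
rewrite /g -muleA -EFinM -expRD; congr (_ * (expR _)%:E)%E.
by rewrite sqnormB_rV; field.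
Qed.

Lemma stdnormal_opp d (f : 'rV[R]_d -> \bar R) :
  measurable_fun setT f -> (forall x, (0 <= f x)%E) ->
  (\int[stdnormal d]_x f (- x)%R = \int[stdnormal d]_x f x)%E.
Proof.
move=> mf f0; rewrite -[RHS](stdnormal_orthogonal (Q := - 1%:M)) //.
  by apply: eq_integral => x _; rewrite mulmxN mulmx1.
by rewrite linearN /= trmx1 mulNmx mulmxN mulmx1 opprK.
Qed.

(* Rescaling t by s in the Gaussian integral. *)
Let integral_normal_expR_sqr (s : R) : 0 < s ->
  (\int[normal01]_t (expR ((1 - s ^+ 2) / 2 * t ^+ 2))%:E = (s^-1)%:E)%E.
Proof.
move=> s0; pose h (x : 'rV[R]_1) : \bar R := (expR (- (sqnorm x / 2)))%:E.
have mh : measurable_fun setT h by rewrite /h; measurability.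
have h0 x : (0 <= h x)%E by rewrite lee_fin expR_ge0.
have sqnorm1 (t : R) : sqnorm (t%:M : 'M[R]_1) = t ^+ 2.
  by rewrite /sqnorm !big_ord1 mxE eqxx.
have flat_h : flat_integral h = 1%E.
  rewrite -[RHS](integral_probability_cst (stdnormal 1))
    integral_stdnormal_flat.
  by congr flat_integral; apply/funext => x; rewrite mul1e.
have us : (s%:M : 'M[R]_1) \in unitmx.
  by rewrite unitmxE det_scalar expr1 unitfE gt_eqF.
have := flat_change_of_variables_unitmx us mh h0.
rewrite flat_h det_scalar expr1 gtr0_norm // => sh1.
have <- : flat_integral (fun x => h (x *m s%:M)) = (s^-1)%:E.
  have := congr1 (fun z => (s^-1)%:E * z)%E sh1.
  by rewrite muleA -EFinM mulVf ?gt_eqF // mul1e mule1.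
rewrite /flat_integral ge0_integral_stdnormal1.
- apply: eq_integral => t _; rewrite -EFinM -expRD mul_mx_scalar sqnormZ.
  by rewrite sqnorm1; congr (expR _)%:E; field.
- by rewrite /h; measurability.
- by move=> x; rewrite mule_ge0 // lee_fin expR_ge0.
Qed.

Let measurable_expR_sqr (h : R) :
  measurable_fun setT (fun t : measurableTypeR R => (expR (h * t ^+ 2))%:E).
Proof. by measurability. Qed.

Let integrable_expR_sqr (s : R) : 0 < s -> normal01.-integrable setT
  (fun t : measurableTypeR R => (expR ((1 - s ^+ 2) / 2 * t ^+ 2))%:E).
Proof.
move=> s0; apply/integrableP; split; first exact: measurable_expR_sqr.
under eq_integral do rewrite gee0_abs ?lee_fin ?expR_ge0 //.
by rewrite integral_normal_expR_sqr // ltry.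
Qed.

Lemma integrable_normal_sqr :
  normal01.-integrable setT (fun t : measurableTypeR R => (t ^+ 2)%:E).
Proof.
have := integrableZl measurableT (8 / 3)
  (integrable_expR_sqr (s := 1 / 2) ltac:(lra)).
apply: le_integrable => //; first by measurability.
move=> t _; rewrite -EFinM lee_fin ger0_norm ?sqr_ge0 // ger0_norm; last first.
  by apply: mulr_ge0; [lra|exact: expR_ge0].
have := expR_ge1Dx ((1 - (1 / 2) ^+ 2) / 2 * t ^+ 2).
have -> : (1 - (1 / 2) ^+ 2) / 2 = 3 / 8 :> R by field.
by lra.
Qed.

(* Integrating 1 + h t^2 <= exp (h t^2) for h = (1 - s^2) / 2 gives
   1 + h v <= 1 / s for the second moment v, and s = v^(-1/2) forces v = 1. *)
Lemma integral_normal_sqr : (\int[normal01]_t (t ^+ 2)%:E = 1)%E.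
Proof.
have isqr := integrable_normal_sqr; rewrite -(EFin_Rintegral isqr).
set v := (\int[normal01]_t _)%R; have v_ge0 : 0 <= v.
  by apply: Rintegral_ge0 => t _; exact: sqr_ge0.
have vs s : 0 < s -> 1 + (1 - s ^+ 2) / 2 * v <= s^-1.
  move=> s0; rewrite -lee_fin -integral_normal_expR_sqr // EFinD EFinM.
  have ih := integrableZl measurableT ((1 - s ^+ 2) / 2) isqr.
  have i1 : normal01.-integrable setT (cst 1%E).
    exact: finite_measure_integrable_cst.
  rewrite (EFin_Rintegral isqr) -(integralZl measurableT isqr).
  rewrite -[X in (X + _)%E](integral_probability_cst normal01) -integralD //.
  apply: le_integral => //; [exact: integrableD|exact: integrable_expR_sqr|].
  by move=> t _; rewrite -EFinM -EFinD lee_fin expR_ge1Dx.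
have v_gt0 : 0 < v.
  rewrite lt_neqAle v_ge0 andbT eq_sym; apply/eqP => v0.
  by have := vs 2 ltac:(lra); rewrite v0; lra.
have w0 : 0 < Num.sqrt v by rewrite sqrtr_gt0.
have := vs (Num.sqrt v)^-1; rewrite invr_gt0 invrK => /(_ w0).
have -> : (1 - (Num.sqrt v)^-1 ^+ 2) / 2 * v = (Num.sqrt v ^+ 2 - 1) / 2.
  by rewrite exprVn sqr_sqrtr //; field; rewrite gt_eqF.
move=> w_le; have /eqP : (Num.sqrt v - 1) ^+ 2 = 0.
  by apply/eqP; rewrite eq_le sqr_ge0 andbT; lra.
rewrite sqrf_eq0 subr_eq0 => /eqP w1.
by rewrite -(sqr_sqrtr v_ge0) w1 expr1n.
Qed.

Let ge0_integral_normal_opp (f : measurableTypeR R -> \bar R) :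
  measurable_fun setT f -> (forall t, (0 <= f t)%E) ->
  (\int[normal01]_t f (- t)%R = \int[normal01]_t f t)%E.
Proof.
move=> mf f0; pose g (x : 'rV[R]_1) := f (x 0 0).
have mg : measurable_fun setT g by apply: (measurableT_comp mf); measurability.
have mgN : measurable_fun setT (fun x : 'rV[R]_1 => g (- x)).
  under eq_fun do rewrite /g mxE.
  by apply: (measurableT_comp mf); measurability.
transitivity (\int[normal01]_t g (- t%:M)%R)%E.
  by apply: eq_integral => t _; rewrite /g !mxE eqxx.
rewrite -(ge0_integral_stdnormal1 mgN (fun x => f0 _)).
rewrite (stdnormal_opp mg (fun x => f0 _)).
rewrite (ge0_integral_stdnormal1 mg (fun x => f0 _)).
by apply: eq_integral => t _; rewrite /g mxE eqxx.
Qed.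

(* Averaging over the symmetry t -> -t removes the cross term. *)
Lemma integral_normal_affine_sqr (a m : R) :
  (\int[normal01]_t ((a * t + m) ^+ 2)%:E = (a ^+ 2 + m ^+ 2)%:E)%E.
Proof.
have mf c : measurable_fun setT
    (fun t : measurableTypeR R => ((c * t + m) ^+ 2)%:E) by measurability.
have f0 c t : (0 <= ((c * t + m) ^+ 2)%:E :> \bar R)%E
  by rewrite lee_fin sqr_ge0.
set I := (\int[normal01]_t _)%E.
have IN : I = (\int[normal01]_t ((- a * t + m) ^+ 2)%:E)%E.
  rewrite /I -(ge0_integral_normal_opp (mf a)) //.
  by apply: eq_integral => t _; rewrite mulrN mulNr.
have : (I + I = (2 * (a ^+ 2 + m ^+ 2))%:E)%E.
  rewrite {2}IN /I -ge0_integralD //.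
  transitivity (\int[normal01]_t
      ((2 * a ^+ 2)%:E * (t ^+ 2)%:E + (2 * m ^+ 2)%:E))%E.
    by apply: eq_integral => t _; rewrite -EFinM -!EFinD; congr (_%:E); ring.
  rewrite integralD //; last 2 first.
  - exact: (integrableZl measurableT (2 * a ^+ 2) integrable_normal_sqr).
  - exact: finite_measure_integrable_cst.
  rewrite (integralZl measurableT integrable_normal_sqr) integral_normal_sqr
    mule1.
  by rewrite integral_probability_cst -EFinD -mulrDr.
by case: I {IN} => [r| |] //; rewrite -EFinD => -[rE]; congr (_%:E); lra.
Qed.

Lemma integral_stdnormal_affine_sqr d (c : 'cV[R]_d) (m : R) :
  (\int[stdnormal d]_x (((x *m c) 0 0 + m) ^+ 2)%:E = (sqnorm c + m ^+ 2)%:E)%E.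
Proof.
have mq k (e : 'cV[R]_k) (b : R) : measurable_fun setT
    (fun x : 'rV[R]_k => (((x *m e) 0 0 + b) ^+ 2)%:E) by measurability.
have q0 k (e : 'cV[R]_k) (b : R) (x : 'rV[R]_k) :
    (0 <= (((x *m e) 0 0 + b) ^+ 2)%:E :> \bar R)%E by rewrite lee_fin sqr_ge0.
elim: d c m => [|d IH] c m.
  rewrite -[RHS](integral_probability_cst (stdnormal 0)).
  apply: eq_integral => x _.
  by rewrite [c]flatmx0 mulmx0 mxE sqnorm0 !add0r.
have {}IH (a : 'cV[R]_1) (e : 'cV[R]_d) :
    (\int[stdnormal (1 + d)]_x (((x *m col_mx a e) 0 0 + m) ^+ 2)%:E =
     (sqnorm (col_mx a e) + m ^+ 2)%:E)%E.
  have mqa := mq 1 a m; have qa0 := q0 1 a m.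
  rewrite (ge0_integral_stdnormal_row_mx (mq _ _ m) (q0 _ _ m)).
  transitivity (\int[stdnormal 1]_x
      ((sqnorm e)%:E + (((x *m a) 0 0 + m) ^+ 2)%:E))%E.
    apply: eq_integral => x _; rewrite -EFinD -IH; apply: eq_integral => y _.
    by rewrite mul_row_col mxE -addrA addrCA.
  rewrite (ge0_integralD _ measurableT _ _ _ mqa) //; last first.
    by move=> x _; rewrite lee_fin sqnorm_ge0.
  rewrite integral_probability_cst (ge0_integral_stdnormal1 mqa qa0).
  under eq_integral do rewrite mul_scalar_mx mxE mulrC.
  rewrite integral_normal_affine_sqr -EFinD sqnorm_col_mx.
  have -> : sqnorm a = a 0 0 ^+ 2 by rewrite /sqnorm !big_ord1.
  by rewrite addrCA addrA.
by rewrite -[c](@vsubmxK _ 1 d); exact: IH.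
Qed.

Lemma ge0_integral_mvnormal d (S : 'M[R]_d) (f : 'rV[R]_d -> \bar R) :
  measurable_fun setT f -> (forall x, (0 <= f x)%E) ->
  (\int[mvnormal S]_x f x = \int[stdnormal d]_x f (x *m sqrtmx S))%E.
Proof.
move=> mf f0; apply: etrans (ge0_integral_distribution (normal_map S) mf f0) _.
rewrite ge0_integral_stdnormal //.
by apply: (measurableT_comp mf); measurability.
Qed.

Lemma ge0_integral_mvnormal_gram d (S A : 'M[R]_d) (f : 'rV[R]_d -> \bar R) :
  (exists B, psd B /\ B *m B = S) -> S \in unitmx -> A^T *m A = S ->
  measurable_fun setT f -> (forall x, (0 <= f x)%E) ->
  (\int[mvnormal S]_x f x = \int[stdnormal d]_x f (x *m A))%E.
Proof.
move=> /sqrtmxP[[sB _] BB] uS AA mf f0; rewrite ge0_integral_mvnormal //.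
by apply: stdnormal_gram => //; rewrite sB BB.
Qed.

End stdnormal_theory.

(** * Differential privacy *)

Section indistinguishable.
Context dZ (Z : measurableType dZ) (R : realType).
Local Open Scope ereal_scope.

Definition indistinguishable (e delta : R) (N N' : set Z -> \bar R) : Prop :=
  forall A, measurable A -> N A <= e%:E * N' A + delta%:E.

Local Notation mu := (@lebesgue_measure R).

Let half_line : set (measurableTypeR R) := `[0%R, +oo[%classic.

Let measurable_box_indic (c b : R) :
  measurable_fun half_line (fun r => (c * \1_`[0%R, b] r)%:E).
Proof.
apply/measurable_EFinP/measurable_funM; first exact: measurable_cst.
by apply: measurable_funTS; exact: measurable_indic.
Qed.

Let integral_box_indic_le (c b : R) : (0 <= c)%R -> (0 <= b)%R ->
  \int[mu]_(r in half_line) (c * \1_`[0%R, b] r)%:E <= (c * b)%:E.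
Proof.
move=> c0 b0; have mhalf : measurable half_line by exact: measurable_itv.
under eq_integral do rewrite EFinM.
rewrite ge0_integralZl //; last first.
  by apply/measurable_EFinP; apply: measurable_funTS; exact: measurable_indic.
rewrite integral_indic // EFinM lee_wpmul2l ?lee_fin //.
apply: (@le_trans _ _ (mu `[0%R, b]%classic)); first exact: measureIl.
by rewrite lebesgue_measure_itv /=; case: ifP => _; rewrite ?sube0 lee_fin.
Qed.

(* A function f is the integral of the indicators of its superlevel sets
   {f > r}, which are empty for r >= b. *)
Lemma indistinguishable_integral_le (e delta b : R) (N N' : probability Z R)
    (f : Z -> R) :
  (0 <= e)%R -> (0 <= delta)%R -> indistinguishable e delta N N' ->
  measurable_fun setT f -> (forall z, (0 <= f z <= b)%R) ->
  \int[N]_z (f z)%:E <= e%:E * \int[N']_z (f z)%:E + (delta * b)%:E.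
Proof.
move=> e0 d0 NN mf fb.
have f0 z : (0 <= f z)%R by have /andP[] := fb z.
have b0 : (0 <= b)%R by have /andP[/le_trans] := fb point; apply.
pose X (Q : probability Z R) : {RV Q >-> R} := mfun_Sub (mem_set mf).
have mhalf : measurable half_line by exact: measurable_itv.
have layer_cake (Q : probability Z R) :
    \int[Q]_z (f z)%:E = \int[mu]_(r in half_line) ccdf (X Q) r.
  by rewrite -(ge0_expectation_ccdf (X := X Q) f0) unlock.
have mccdf (Q : probability Z R) : measurable_fun half_line (ccdf (X Q)).
  by apply: measurable_funTS; exact: ccdf_measurable.
rewrite !layer_cake; apply: le_trans (leeD2l _ (integral_box_indic_le d0 b0)).
rewrite -ge0_integralZl // -ge0_integralD //; last 3 first.
- by move=> r _; rewrite mule_ge0 // lee_fin.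
- exact: measurable_funeM.
- by move=> r _; rewrite lee_fin mulr_ge0.
apply: ge0_le_integral => //.
  by apply: emeasurable_funD;
    [exact: measurable_funeM|exact: measurable_box_indic].
move=> r; rewrite /half_line /= in_itv /= andbT => r0.
have [rb|br] := leP r b.
  rewrite indicE mem_set ?mulr1 /= ?in_itv /= ?r0 //.
  by apply: NN; rewrite -[X in measurable X]setTI;
    exact: (mf measurableT _ (measurable_itv _)).
have -> : ccdf (X N) r = 0.
  rewrite -(measure0 N); congr (N _); apply/seteqP; split=> z //=.
  have /andP[_ fzb] := fb z.
  by rewrite in_itv /= andbT ltNge (le_trans fzb) // ltW.
by rewrite adde_ge0 // ?lee_fin ?mulr_ge0 // mule_ge0.
Qed.

End indistinguishable.

Section diff_private.
Context dX dY dZ (X : measurableType dX) (Y : measurableType dY)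
  (Z : measurableType dZ) (R : realType).
Variables (n : nat) (eps delta : R).
Hypotheses (eps0 : 0 <= eps) (delta0 : 0 <= delta).

Lemma diff_private_indistinguishable (k : R.-pker n.-tuple X ~> Z) (i : 'I_n)
    (x x' : n.-tuple X) : diff_private eps delta k ->
  (forall j, j != i -> tnth x j = tnth x' j) ->
  indistinguishable (expR eps) delta (k x) (k x').
Proof.
move=> kdp xx'; have [xi|xi] := pselect (tnth x i = tnth x' i); last first.
  by apply: kdp; exists i.
have -> : x' = x.
  by apply: eq_from_tnth => j; have [->|/xx' ->] := eqVneq j i.
move=> A _; rewrite -[leLHS]adde0; apply: leeD; last by rewrite lee_fin.
by rewrite -[leLHS]mul1e lee_wpmul2r // lee_fin -expR0 ler_expR.
Qed.

Lemma diff_private_map_tuple (k : R.-pker n.-tuple X ~> Z) (f : Y -> X)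
    (mf : measurable_fun setT f) : diff_private eps delta k ->
  diff_private eps delta (kernel_precomp k (measurable_map_tuple mf)).
Proof.
move=> kdp y y' [i [_ yy']];
  apply: (diff_private_indistinguishable (i := i)) => //.
by move=> j ji; rewrite !tnth_map yy'.
Qed.

End diff_private.

(* The correlation between the sample ys_i and the output of a private
   mechanism is compared with that of an independent sample, for which the
   conditional mean is zero. *)
Section private_correlation.
Context dY dZ (Y : measurableType dY) (Z : measurableType dZ) (R : realType).
Variables (n : nat) (eps delta : R) (P : probability Y R).
Variable k : R.-pker n.-tuple Y ~> Z.
Hypotheses (eps0 : 0 <= eps) (delta0 : 0 <= delta)
  (kdp : diff_private eps delta k).
Variable i : 'I_n.
Local Open Scope ereal_scope.
Local Notation e := (expR eps).

Let indistinguishable_resample (ys : n.-tuple Y) (y : Y) :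
  indistinguishable e delta (k (set_tnth i ys y)) (k ys) /\
  indistinguishable e delta (k ys) (k (set_tnth i ys y)).
Proof.
by split; apply: (diff_private_indistinguishable eps0 delta0 kdp (i := i))
  => j ji;
  rewrite tnth_set_tnth (negbTE ji).
Qed.

Section nonnegative.
Variables (c : Y * Z -> R) (b : Y -> R) (B : R).
Hypotheses (mc : measurable_fun setT c) (c0 : forall z, (0 <= c z)%R).
Hypotheses (cb : forall y z, (c (y, z) <= b y)%R) (mb : measurable_fun setT b).
Hypothesis bB : \int[P]_y (b y)%:E <= B%:E.

Let sampled := \int[iid P n]_ys \int[k ys]_z (c (tnth ys i, z))%:E.
Let independent := \int[iid P n]_ys \int[P]_y \int[k ys]_z (c (y, z))%:E.

Let mcE : measurable_fun setT (EFin \o c). Proof. exact/measurable_EFinP. Qed.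

Let mcy y : measurable_fun setT (fun z => c (y, z)).
Proof. exact: measurableT_comp mc (measurable_pair1 y). Qed.

Let cy_bounds y z : (0 <= c (y, z) <= b y)%R. Proof. by rewrite c0 cb. Qed.

Let integral_c_ge0 ys y : 0 <= \int[k ys]_z (c (y, z))%:E.
Proof. by apply: integral_ge0 => z _; rewrite lee_fin. Qed.

Let b_ge0 y : (0 <= b y)%R. Proof. exact: le_trans (cb y point). Qed.

Let measurable_integral_kernel dW (W : measurableType dW) (ys : W -> n.-tuple Y)
    (y : W -> Y) : measurable_fun setT ys -> measurable_fun setT y ->
  measurable_fun setT (fun w => \int[k (ys w)]_z (c (y w, z))%:E).
Proof.
move=> mys my; apply: (measurable_fun_integral_finite_kernel
  (fun w => (c (y w.1, w.2))%:E) (kernel_precomp k mys)).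
  by move=> w; rewrite lee_fin.
apply: (measurableT_comp mcE); apply: measurable_fun_pair => //.
exact: measurableT_comp my measurable_fst.
Qed.

Let sampledE : sampled =
  \int[iid P n]_ys \int[P]_y \int[k (set_tnth i ys y)]_z (c (y, z))%:E.
Proof.
pose F (ys : n.-tuple Y) := \int[k ys]_z (c (tnth ys i, z))%:E.
have mF : measurable_fun setT F.
  by apply: measurable_integral_kernel => //; exact: measurable_fun_tnth.
have F0 ys : 0 <= F ys by apply: integral_ge0 => z _; rewrite lee_fin.
apply: etrans (ge0_integral_iid_resample P i mF F0) _.
apply: eq_integral => ys _; apply: eq_integral => y _.
by apply: eq_integral => z _; rewrite tnth_set_tnth eqxx.
Qed.

Let measurable_resampled : measurable_fun setT
  (fun w : n.-tuple Y * Y => \int[k (set_tnth i w.1 w.2)]_z (c (w.2, z))%:E).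
Proof.
by apply: measurable_integral_kernel => //; exact: measurable_set_tnth.
Qed.

Let measurable_independent :
  measurable_fun setT (fun w : n.-tuple Y * Y => \int[k w.1]_z (c (w.2, z))%:E).
Proof. exact: measurable_integral_kernel. Qed.

Let average_le (F G : n.-tuple Y * Y -> \bar R) :
  measurable_fun setT F -> measurable_fun setT G ->
  (forall w, 0 <= F w) -> (forall w, 0 <= G w) ->
  (forall w, F w <= e%:E * G w + (delta * b w.2)%:E) ->
  \int[iid P n]_ys \int[P]_y F (ys, y) <=
  e%:E * (\int[iid P n]_ys \int[P]_y G (ys, y)) + (delta * B)%:E.
Proof.
move=> mF mG F0 G0 FG.
have bB' : \int[P]_y (delta * b y)%:E <= (delta * B)%:E.
  under eq_integral do rewrite EFinM.
  rewrite ge0_integralZl ?lee_fin //; last 2 first.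
  - exact/measurable_EFinP.
  - by move=> y _; rewrite lee_fin.
  by rewrite EFinM lee_wpmul2l ?lee_fin.
have mGy ys : measurable_fun setT (fun y => G (ys, y)).
  exact: measurableT_comp mG (measurable_pair1 ys).
apply: (@le_trans _ _
    (\int[iid P n]_ys (e%:E * \int[P]_y G (ys, y) + (delta * B)%:E))).
  apply: ge0_le_integral_nonmeasurable => ys.
    by apply: integral_ge0.
  apply: (@le_trans _ _ (\int[P]_y (e%:E * G (ys, y) + (delta * b y)%:E))).
    by apply: ge0_le_integral_nonmeasurable => y; [exact: F0|exact: FG].
  rewrite ge0_integralD //; last 4 first.
  - by move=> y _; rewrite mule_ge0 // lee_fin expR_ge0.
  - exact: measurable_funeM.
  - by move=> y _; rewrite lee_fin mulr_ge0.
  - by apply/measurable_EFinP; exact: measurable_funM.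
  by rewrite ge0_integralZl ?lee_fin ?expR_ge0 // leeD2l.
have mGE : measurable_fun setT (fun ys => \int[P]_y G (ys, y)).
  exact: measurable_fun_fubini_tonelli_F.
have B0 : (0 <= delta * B)%R.
  apply: mulr_ge0 => //; rewrite -lee_fin; apply: le_trans bB.
  by apply: integral_ge0 => y _; rewrite lee_fin.
rewrite ge0_integralD //; last 2 first.
- by move=> ys _; rewrite mule_ge0 ?lee_fin ?expR_ge0 //; exact: integral_ge0.
- exact: measurable_funeM.
rewrite integral_probability_cst ge0_integralZl ?lee_fin ?expR_ge0 //.
by move=> ys _; exact: integral_ge0.
Qed.

Let sampled_le_independent : sampled <= e%:E * independent + (delta * B)%:E.
Proof.
rewrite sampledE;
  apply: (average_le measurable_resampled measurable_independent) => //.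
move=> -[ys y]; have [kk _] := indistinguishable_resample ys y.
exact: (indistinguishable_integral_le (N := kernel_probability k _)
  (N' := kernel_probability k _) (expR_ge0 _) delta0 kk (mcy y) (cy_bounds y)).
Qed.

Let independent_le_sampled : independent <= e%:E * sampled + (delta * B)%:E.
Proof.
rewrite sampledE;
  apply: (average_le measurable_independent measurable_resampled) => //.
move=> -[ys y]; have [_ kk] := indistinguishable_resample ys y.
exact: (indistinguishable_integral_le (N := kernel_probability k _)
  (N' := kernel_probability k _) (expR_ge0 _) delta0 kk (mcy y) (cy_bounds y)).
Qed.

Let independentE :
  independent = \int[iid P n]_ys \int[k ys]_z \int[P]_y (c (y, z))%:E.
Proof.
apply: eq_integral => ys _.
by apply: (@fubini_tonelli _ _ _ _ _ P (kernel_probability k ys)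
  (fun w => (c w)%:E)).
Qed.

Lemma private_correlation_ge0 (g : Z -> \bar R) :
  (forall z, \int[P]_y (c (y, z))%:E = g z) ->
  let a := \int[iid P n]_ys \int[k ys]_z g z in
  a <= B%:E /\ sampled <= e%:E * a + (delta * B)%:E /\
  a <= e%:E * sampled + (delta * B)%:E.
Proof.
move=> gE; have -> : \int[iid P n]_ys \int[k ys]_z g z = independent.
  rewrite independentE; apply: eq_integral => ys _.
  by apply: eq_integral => z _; rewrite gE.
split; last by split;
  [exact: sampled_le_independent|exact: independent_le_sampled].
rewrite -(integral_probability_cst (iid P n) B%:E).
apply: ge0_le_integral_nonmeasurable => ys; first exact: integral_ge0.
apply: le_trans bB; apply: ge0_le_integral_nonmeasurable => y //.
rewrite -(integral_probability_cst (kernel_probability k ys) (b y)%:E).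
by apply: ge0_le_integral_nonmeasurable => z; rewrite lee_fin.
Qed.

End nonnegative.

Variables (c : Y * Z -> R) (b : Y -> R) (B : R) (v : Z -> R).
Hypotheses (mc : measurable_fun setT c) (mb : measurable_fun setT b).
Hypotheses (cb : forall y z, (`|c (y, z)| <= b y)%R).
Hypothesis bB : \int[P]_y (b y)%:E <= B%:E.
Hypothesis c_mean : forall z, \int[P]_y (c (y, z))%:E = 0.
Hypothesis c_abs : forall z, \int[P]_y `|c (y, z)|%:E <= (2 * v z)%:E.

Let mcz z : measurable_fun setT (fun y => c (y, z)).
Proof. exact: measurableT_comp mc (measurable_pair2 z). Qed.

Let integrable_cz z : P.-integrable setT (fun y => (c (y, z))%:E).
Proof.
apply/integrableP; split; first exact/measurable_EFinP.
apply: le_lt_trans (ltry B); apply: le_trans bB.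
by apply: ge0_le_integral_nonmeasurable => y; rewrite lee_fin.
Qed.

Let mean_pos_neg z :
  \int[P]_y (c^\+ (y, z))%:E = \int[P]_y (c^\- (y, z))%:E.
Proof.
have ic := integrable_cz z; have := c_mean z.
rewrite integralE (funerpos (fun y => c (y, z))) (funerneg (fun y => c (y, z))).
have := integrable_pos_fin_num measurableT ic; rewrite funerpos.
have := integrable_neg_fin_num measurableT ic; rewrite funerneg.
move=> /fineK <- /fineK <-; rewrite -EFinB => -[/eqP].
by rewrite subr_eq0 => /eqP ->.
Qed.

Let mean_pos_le z : \int[P]_y (c^\+ (y, z))%:E <= (v z)%:E.
Proof.
have mpos : measurable_fun setT (fun y => (c^\+ (y, z))%:E).
  by apply/measurable_EFinP; exact: measurable_funrpos (mcz z).
have mneg : measurable_fun setT (fun y => (c^\- (y, z))%:E).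
  by apply/measurable_EFinP; exact: measurable_funrneg (mcz z).
rewrite -(lee_pmul2l (x := 2%:E)) ?lte_fin // -EFinM; apply: le_trans (c_abs z).
rewrite -[2%R]/(1 + 1)%R EFinD ge0_muleDl // mul1e {2}mean_pos_neg.
rewrite -ge0_integralD //; last 2 first.
- by move=> y _; rewrite lee_fin funrpos_ge0.
- by move=> y _; rewrite lee_fin funrneg_ge0.
rewrite le_eqVlt; apply/orP; left; apply/eqP; apply: eq_integral => y _.
by rewrite -EFinD; congr (_%:E); exact: (congr1 (@^~ (y, z)) (funrposDneg c)).
Qed.

Lemma private_correlation_le :
  \int[iid P n]_ys \int[k ys]_z (c^\+ (tnth ys i, z))%:E <=
  \int[iid P n]_ys \int[k ys]_z (c^\- (tnth ys i, z))%:E +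
  ((2 * (e - 1))%:E * (\int[iid P n]_ys \int[k ys]_z (v z)%:E) +
   (2 * delta * B)%:E).
Proof.
pose g z := \int[P]_y (c^\+ (y, z))%:E.
have posb y z : (c^\+ (y, z) <= b y)%R.
  by apply: le_trans (cb y z); rewrite /funrpos ge_max ler_norm normr_ge0.
have negb y z : (c^\- (y, z) <= b y)%R.
  by apply: le_trans (cb y z);
    rewrite /funrneg ge_max -normrN ler_norm normr_ge0.
have [aB [pos_le _]] := private_correlation_ge0 (g := g)
  (measurable_funrpos mc) (funrpos_ge0 c) posb mb bB (fun _ => erefl).
have [_ [_ neg_ge]] := private_correlation_ge0 (g := g)
  (measurable_funrneg mc) (funrneg_ge0 c) negb mb bB
    (fun z => esym (mean_pos_neg z)).
have g0 z : 0 <= g z by apply: integral_ge0 => y _; rewrite lee_fin funrpos_ge0.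
have a0 : 0 <= \int[iid P n]_ys \int[k ys]_z g z.
  by apply: integral_ge0 => ys _; exact: integral_ge0.
have m0 : 0 <= \int[iid P n]_ys \int[k ys]_z (c^\- (tnth ys i, z))%:E.
  apply: integral_ge0 => ys _; apply: integral_ge0 => z _.
  by rewrite lee_fin funrneg_ge0.
have a_le : \int[iid P n]_ys \int[k ys]_z g z <=
            \int[iid P n]_ys \int[k ys]_z (v z)%:E.
  apply: ge0_le_integral_nonmeasurable => ys; first exact: integral_ge0.
  by apply: ge0_le_integral_nonmeasurable => z //; exact: mean_pos_le.
have e1 : (0 <= e - 1)%R by rewrite subr_ge0 -expR0 ler_expR.
apply: le_trans (leeD2l _ (leeD2r _ (lee_wpmul2l _ a_le))); last first.
  by rewrite lee_fin mulr_ge0.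
apply: le_trans pos_le _; move: aB a0 m0 neg_ge {a_le}.
set a := \int[iid P n]_ys \int[k ys]_z g z.
set m := \int[iid P n]_ys \int[k ys]_z (c^\- _)%:E.
case: a m => [a| |] [m| |] //.
- rewrite -!EFinM -!EFinD !lee_fin => aB a0 m0 neg_ge.
  have dB : (0 <= delta * B)%R by rewrite mulr_ge0 // (le_trans a0).
  have e_sqr : (0 <= (e - 1) ^+ 2 * a)%R by rewrite mulr_ge0 // sqr_ge0.
  have e_dB : (0 <= (e - 1) * (delta * B))%R by rewrite mulr_ge0.
  by rewrite -(ler_pM2l (expR_gt0 eps)); nra.
- by move=> _ _ _ _; rewrite -!EFinM -!EFinD addye // leey.
Qed.

End private_correlation.

(** * A window vanishing at the ends of an interval *)

Lemma integral_deriv_expR (R : realType) (p r : {poly R}) (a b : R) :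
  a < b -> p.[a] = 0 -> p.[b] = 0 ->
  (\int[lebesgue_measure]_(t in `[a, b])
     ((p^`() + p * r^`()).[t] * expR r.[t])%:E = 0)%E.
Proof.
move=> ab pa pb; pose F (t : R) := p.[t] * expR r.[t].
have cexp : continuous (fun t : R => expR r.[t]).
  by move=> t; apply: (continuous_comp (@continuous_horner _ r t));
    exact: continuous_expR.
have dF (t : R) : is_derive t 1 F ((p^`() + p * r^`()).[t] * expR r.[t]).
  have dexp := @is_derive1_comp _ expR (horner r) t _ _
    (is_derive_expR _) (is_derive_poly r t).
  apply: (@is_derive_eq _ _ _ _ _ _ _ _ (is_deriveM (is_derive_poly p t) dexp)).
  have scaleE (x y : R) : x *: y = x * y by [].
  by rewrite !scaleE /= hornerD hornerM; ring.
have cF : continuous F.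
  by move=> t; apply: continuousM; [exact: continuous_horner|exact: cexp].
rewrite (@continuous_FTC2 _ (fun t => (p^`() + p * r^`()).[t] * expR r.[t]) F) //.
- by rewrite /F pa pb !mul0r subee.
- apply: continuous_subspaceT => t.
  by apply: continuousM; [exact: continuous_horner|exact: cexp].
- split; first by move=> t _; have [] := dF t.
  + exact/cvg_at_right_filter/cF.
  + exact/cvg_at_left_filter/cF.
- by move=> t _; rewrite derive1E; have [_] := dF t.
Qed.

Section window.
Context (R : realType) (eta : R).
Hypothesis eta0 : 0 < eta.
Local Notation uniform := (uniform_prob (gtrN eta0)).

Definition window_poly : {poly R} := 1 - (eta ^- 2) *: 'X^2.

Definition window (x : R) : R := \1_`[- eta, eta] x * window_poly.[x].

Definition window_deriv (x : R) : R := \1_`[- eta, eta] x * window_poly^`().[x].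

Let window_polyE x : window_poly.[x] = 1 - (x / eta) ^+ 2.
Proof.
by rewrite hornerD hornerN hornerZ hornerXn hornerC; field;
  rewrite gt_eqF.
Qed.

Let window_poly_derivE x : window_poly^`().[x] = - (2 * x / eta ^+ 2).
Proof.
rewrite derivB derivZ derivXn derivC hornerD hornerN hornerZ hornerMn hornerXn
  hornerC.
by rewrite expr1; field; rewrite gt_eqF.
Qed.

Let indic_box (x : R) :
  \1_`[- eta, eta] x = (if `|x| <= eta then 1 else 0) :> R.
Proof.
rewrite indicE ler_norml;
  have -> : (x \in `[- eta, eta]%classic) = (- eta <= x <= eta).
  by apply/idP/idP; rewrite inE /= in_itv.
by case: ifP.
Qed.

Lemma measurable_window : measurable_fun setT window.
Proof.
apply: measurable_funM; first exact: measurable_indic.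
by apply: continuous_measurable_fun; exact: continuous_horner.
Qed.

Lemma measurable_window_deriv : measurable_fun setT window_deriv.
Proof.
apply: measurable_funM; first exact: measurable_indic.
by apply: continuous_measurable_fun; exact: continuous_horner.
Qed.

Let ratio_sqr_le1 x : `|x| <= eta -> (x / eta) ^+ 2 <= 1.
Proof.
move=> xe; rewrite -(real_normK (num_real (x / eta))) normrM
  (gtr0_norm (_ : 0 < eta^-1)) ?invr_gt0 //.
by rewrite exprn_ile1 ?divr_ge0 ?ler_pdivrMr ?mul1r // ltW.
Qed.

Lemma window_bounds x : 0 <= window x <= 1.
Proof.
rewrite /window indic_box window_polyE; case: (leP `|x| eta) => xe; last first.
  by rewrite mul0r lexx ler01.
by have := ratio_sqr_le1 xe; have := sqr_ge0 (x / eta); rewrite mul1r; lra.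
Qed.

Lemma window_mul_le (m x : R) : `|m| <= eta -> `|window x * (m - x)| <= 2 * eta.
Proof.
move=> me; have e0 := eta0; have [xe|xe] := leP `|x| eta; last first.
  by rewrite /window indic_box (lt_geF xe) !mul0r normr0; lra.
have /andP[w0 w1] := window_bounds x.
rewrite normrM (ger0_norm w0); apply: le_trans (ler_piMl _ w1) _ => //.
by have := ler_normB m x; lra.
Qed.

Lemma window_deriv_mul_norm_le (m x : R) :
  `|m| <= eta -> `|window_deriv x * (m - x)| <= 4.
Proof.
move=> me; have e0 := eta0; have [xe|xe] := leP `|x| eta; last first.
  by rewrite /window_deriv indic_box (lt_geF xe) !mul0r normr0.
rewrite /window_deriv indic_box xe mul1r window_poly_derivE mulNr normrN.
rewrite mulrAC normrM (gtr0_norm (_ : 0 < (eta ^+ 2)^-1)) ?invr_gt0 ?exprn_gt0 //.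
rewrite ler_pdivrMr ?exprn_gt0 // !normrM (gtr0_norm (_ : 0 < 2 :> R)) //.
have : `|x| * `|m - x| <= eta * (2 * eta).
  by apply: ler_pM => //; have := ler_normB m x; lra.
by rewrite -mulrA; nra.
Qed.

(* AM-GM: (2 / eta) |m - x| <= 1 / 6 + 6 (m - x)^2 / eta^2. *)
Lemma window_deriv_mul_le (m x : R) :
  window_deriv x * (m - x) <= 1 / 6 + 6 / eta ^+ 2 * (m - x) ^+ 2.
Proof.
have rhs0 : 0 <= 6 / eta ^+ 2 * (m - x) ^+ 2.
  by rewrite mulr_ge0 ?sqr_ge0 // divr_ge0 // sqr_ge0.
rewrite /window_deriv indic_box window_poly_derivE.
have [xe|xe] := leP `|x| eta; last by rewrite !mul0r; lra.
set s := x / eta; set w := (m - x) / eta; rewrite (mul1r (- _)).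
have -> : - (2 * x / eta ^+ 2) * (m - x) = - (2 * s * w).
  by rewrite /s /w; field; rewrite gt_eqF.
have -> : 6 / eta ^+ 2 * (m - x) ^+ 2 = 6 * w ^+ 2.
  by rewrite /w; field; rewrite gt_eqF.
by have := ratio_sqr_le1 xe; rewrite -/s; have := sqr_ge0 (s + 6 * w); nra.
Qed.

Let integral_uniform_box (f : R -> R) : measurable_fun setT f ->
  (\int[uniform]_s (f s)%:E =
   \int[lebesgue_measure]_(s in `[(- eta)%R, eta]) ((2 * eta)^-1 * f s)%:E)%E.
Proof.
move=> mf; rewrite (integral_density (mu := lebesgue_measure)
  (fun x => uniform_pdf_ge0 x (gtrN eta0))
    (@measurable_uniform_pdf R (- eta) eta)) //.
rewrite [RHS]integral_mkcond; apply: eq_integral => s _.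
rewrite patchE mem_setE in_itv /= /uniform_pdf.
by case: ifP => _; rewrite ?mulr0 // opprK mulrC mulr2n mulrDl !mul1r.
Qed.

Let window_poly_bdry : window_poly.[- eta] = 0 /\ window_poly.[eta] = 0.
Proof. by rewrite !window_polyE mulNr sqrrN divff ?gt_eqF // expr1n subrr. Qed.

Let indic_in_box (s : R) :
  s \in `[- eta, eta]%classic -> \1_`[- eta, eta] s = 1 :> R.
Proof. by rewrite indicE => ->. Qed.

Lemma integral_window : (\int[uniform]_s (window s)%:E = (2 / 3)%:E)%E.
Proof.
have iw : uniform.-integrable setT (EFin \o window).
  apply: (@integrable_bounded _ _ _ uniform window 1 measurable_window) => s.
  by have /andP[w0 w1] := window_bounds s; rewrite ger0_norm.
have ic : uniform.-integrable setT (fun=> (2 / 3)%:E).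
  exact: finite_measure_integrable_cst.
suff : (\int[uniform]_s (window s - 2 / 3)%:E = 0)%E.
  under eq_integral do rewrite EFinB.
  rewrite (integralB measurableT iw ic) integral_probability_cst.
  by rewrite -(EFin_Rintegral iw) -EFinB => -[/eqP];
    rewrite subr_eq0 => /eqP ->.
pose p : {poly R} := (6 * eta)^-1 *: ('X * window_poly).
have [wN wP] := window_poly_bdry.
rewrite integral_uniform_box; last first.
  by apply: measurable_funB => //; exact: measurable_window.
rewrite -[RHS](integral_deriv_expR (p := p) 0 (gtrN eta0)); last 2 first.
- by rewrite hornerZ hornerM wN !mulr0.
- by rewrite hornerZ hornerM wP !mulr0.
apply: eq_integral => s /indic_in_box s1; congr (_%:E).
rewrite deriv0 mulr0 addr0 derivZ derivM derivX hornerZ hornerD !hornerM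
  horner0.
rewrite hornerC hornerX expR0 /window s1 window_polyE window_poly_derivE.
by field; rewrite gt_eqF.
Qed.

(* Integration by parts against the window, which has no boundary terms. *)
Lemma integral_window_ibp (c : R) (r : {poly R}) :
  (\int[uniform]_s ((window s * (c - s) * r^`().[s] - window s +
     window_deriv s * (c - s)) * expR r.[s])%:E = 0)%E.
Proof.
pose p : {poly R} := (2 * eta)^-1 *: (window_poly * (c%:P - 'X)).
have [wN wP] := window_poly_bdry.
have mpoly (q : {poly R}) : measurable_fun setT (fun s : R => q.[s]).
  by apply: continuous_measurable_fun; exact: continuous_horner.
have mc : measurable_fun setT (fun s : R => c - s) by exact: measurable_funB.
rewrite integral_uniform_box; last first.
  apply: measurable_funM; last exact: measurableT_comp (mpoly r).
  apply: measurable_funD; last by apply: measurable_funM => //;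
    exact: measurable_window_deriv.
  apply: measurable_funB; last exact: measurable_window.
  by do 2 apply: measurable_funM => //; exact: measurable_window.
rewrite -[RHS](integral_deriv_expR (p := p) r (gtrN eta0)); last 2 first.
- by rewrite hornerZ hornerM wN mul0r mulr0.
- by rewrite hornerZ hornerM wP mul0r mulr0.
apply: eq_integral => s /indic_in_box s1; congr (_%:E).
have linE : (c%:P - 'X).[s] = c - s by rewrite hornerD hornerN hornerC hornerX.
have dlinE : (c%:P - 'X)^`() = - 1 by rewrite derivB derivC derivX sub0r.
rewrite derivZ derivM dlinE hornerD hornerM !hornerZ hornerD !hornerM linE.
rewrite hornerN hornerC /window /window_deriv s1.
by field; rewrite gt_eqF.
Qed.

End window.

(** * Fingerprinting *)

Lemma sumr_indicator (R : pzRingType) (I : finType) (j : I) (F : I -> R) :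
  \sum_i (i == j)%:R * F i = F j.
Proof.
rewrite (bigD1 j) //= eqxx mul1r big1 ?addr0 // => i /negbTE ->.
by rewrite mul0r.
Qed.

(* A family of densities whose logarithm is quadratic in each of the m real
   parameters, with scores of covariance at most the identity. *)
Record quad_model (R : realType) (m : nat) d (Y : measurableType d) := QuadModel {
  null : probability Y R;
  law : m.-tuple (measurableTypeR R) -> probability Y R;
  loglik : m.-tuple (measurableTypeR R) -> Y -> R;
  score : 'I_m -> m.-tuple (measurableTypeR R) -> Y -> R;
  curvature : 'I_m -> Y -> R;
  measurable_loglik : measurable_fun setT (fun z => loglik z.1 z.2);
  measurable_score : forall j, measurable_fun setT (fun z => score j z.1 z.2);
  law_density : forall t (f : Y -> \bar R),
    measurable_fun setT f -> (forall y, (0 <= f y)%E) ->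
    (\int[law t]_y f y = \int[null]_y (f y * (expR (loglik t y))%:E))%E;
  loglik_set_tnth : forall j t s y, loglik (set_tnth j t s) y = loglik t y +
    (s - tnth t j) * score j t y - (s - tnth t j) ^+ 2 * curvature j y / 2;
  score_set_tnth : forall j t s y,
    score j (set_tnth j t s) y = score j t y - (s - tnth t j) * curvature j y;
  integral_score : forall j t, (\int[law t]_y (score j t y)%:E = 0)%E;
  integral_score_sqr_le : forall t (c : 'I_m -> R),
    (\int[law t]_y ((\sum_j c j * score j t y) ^+ 2)%:E <=
      (\sum_j c j ^+ 2)%:E)%E
}.

Section score.
Context (R : realType) (m : nat) d (Y : measurableType d)
  (M : quad_model R m Y).
Implicit Types (t : m.-tuple (measurableTypeR R)) (j : 'I_m).

Lemma measurable_score_r j t : measurable_fun setT (score M j t).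
Proof. exact: measurableT_comp (measurable_score M j) (measurable_pair1 t). Qed.

Lemma integral_score_abs_le1 j t :
  (\int[law M t]_y (`|score M j t y|)%:E <= 1)%E.
Proof.
apply: integral_norm_le1; first exact: measurable_score_r.
have := integral_score_sqr_le M t (fun i => (i == j)%:R).
under eq_integral do rewrite sumr_indicator.
by under eq_bigr do rewrite expr2; rewrite sumr_indicator eqxx.
Qed.

Lemma integrable_score j t : (law M t).-integrable setT (EFin \o score M j t).
Proof.
apply/integrableP; split; first by apply/measurable_EFinP;
  exact: measurable_score_r.
by apply: le_lt_trans (integral_score_abs_le1 j t) _; rewrite ltry.
Qed.

End score.

Section experiment.
Context (R : realType) (m : nat) dY dZ (Y : measurableType dY)
  (Z : measurableType dZ).
Local Notation Th := (m.-tuple (measurableTypeR R)).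
Variables (M : quad_model R m Y) (prior : probability Th R).
Variables (n : nat) (k : R.-pker n.-tuple Y ~> Z).
Local Notation outcome := (Th * (n.-tuple Y * Z))%type.
Local Notation null_experiment := (prior \x kernel_joint (iid (null M) n) k)%E.

Definition sample_loglik (t : Th) (ys : n.-tuple Y) : R :=
  \sum_(i < n) loglik M t (tnth ys i).

Let density (u : outcome) : R := expR (sample_loglik u.1 u.2.1).

Let density_ge0 u : 0 <= density u. Proof. exact: expR_ge0. Qed.

Lemma measurable_sample_density : measurable_fun setT density.
Proof.
apply: measurableT_comp => //; apply: measurable_sum => i.
have mi : measurable_fun setT (fun u : outcome => (u.1, tnth u.2.1 i)).
  apply: measurable_fun_pair => //; apply: measurable_fun_tnth.
  exact: measurableT_comp measurable_fst measurable_snd.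
exact: measurableT_comp (measurable_loglik M) mi.
Qed.

(* The joint law of the parameter, drawn from the prior, of n samples, and of
   the output of k on these samples. *)
Definition experiment : set outcome -> \bar R :=
  with_density null_experiment density_ge0 measurable_sample_density.

HB.instance Definition _ := Measure.on experiment.

Lemma experimentE (f : outcome -> R) : measurable_fun setT f ->
  (\int[experiment]_u (f u)%:E = \int[null_experiment]_u
     (f u * expR (sample_loglik u.1 u.2.1))%:E)%E.
Proof.
exact: (integral_density (mu := null_experiment) (nu := experiment)
  density_ge0 measurable_sample_density (fun _ _ => erefl)).
Qed.

Let weighted (f : outcome -> \bar R) (u : outcome) : \bar R :=
  (f u * (density u)%:E)%E.

Let measurable_weighted (f : outcome -> \bar R) :
  measurable_fun setT f -> measurable_fun setT (weighted f).
Proof.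
move=> mf; apply: emeasurable_funM => //; apply/measurable_EFinP.
exact: measurable_sample_density.
Qed.

Let weighted_ge0 (f : outcome -> \bar R) :
  (forall u, (0 <= f u)%E) -> forall u, (0 <= weighted f u)%E.
Proof. by move=> f0 u; rewrite mule_ge0 ?lee_fin. Qed.

Let integral_weighted (f : outcome -> \bar R) (t : Th) :
  measurable_fun setT f -> (forall u, (0 <= f u)%E) ->
  (\int[kernel_joint (iid (null M) n) k]_w weighted f (t, w) =
   \int[kernel_joint (iid (law M t) n) k]_w f (t, w))%E.
Proof.
move=> mf f0.
have mgt : measurable_fun setT (fun w => weighted f (t, w)).
  exact: measurableT_comp (measurable_weighted mf) (measurable_pair1 t).
apply: etrans
  (ge0_integral_kernel_joint _ _ mgt (fun w => weighted_ge0 f0 (t, w))) _.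
have mft : measurable_fun setT (fun w => f (t, w)).
  exact: measurableT_comp mf (measurable_pair1 t).
apply: etrans _ (esym (ge0_integral_kernel_joint _ _ mft (fun w => f0 (t, w)))).
have mfk : measurable_fun setT (fun ys => \int[k ys]_z f (t, (ys, z)))%E.
  exact: (measurable_fun_integral_finite_kernel (fun w => f (t, w)) k).
rewrite (ge0_integral_iid_density (P := law M t) (psi := id) (Q := null M)
  (l := loglik M t)) //.
- apply: eq_integral => ys _.
  have -> : map_tuple id ys = ys by apply: val_inj; rewrite /= map_id.
  rewrite muleC -ge0_integralZl ?lee_fin ?expR_ge0 //.
    by apply: eq_integral => z _; rewrite muleC.
  exact: measurableT_comp mft (measurable_pair1 ys).
- exact: measurableT_comp (measurable_loglik M) (measurable_pair1 t).
- exact: law_density.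
- by move=> ys; exact: integral_ge0.
Qed.

Lemma measurable_integral_law (f : outcome -> \bar R) :
  measurable_fun setT f -> (forall u, (0 <= f u)%E) ->
  measurable_fun setT
    (fun t => \int[kernel_joint (iid (law M t) n) k]_w f (t, w))%E.
Proof.
move=> mf f0; under eq_fun do rewrite -integral_weighted //.
apply: (measurable_fun_fubini_tonelli_F (weighted f)); last exact: weighted_ge0.
exact: measurable_weighted.
Qed.

Lemma ge0_integral_experiment (f : outcome -> \bar R) :
  measurable_fun setT f -> (forall u, (0 <= f u)%E) ->
  (\int[experiment]_u f u =
   \int[prior]_t \int[kernel_joint (iid (law M t) n) k]_w f (t, w))%E.
Proof.
move=> mf f0;
  rewrite (ge0_integral_density (mu := null_experiment) (nu := experiment)
  density_ge0 measurable_sample_density (fun _ _ => erefl) mf f0).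
rewrite (@fubini_tonelli1 _ _ _ _ _ prior (kernel_joint (iid (null M) n) k)
  (weighted f) (measurable_weighted mf) (weighted_ge0 f0)).
by apply: eq_integral => t _; exact: integral_weighted.
Qed.

Lemma ge0_integral_experiment_param (f : Th -> \bar R) :
  measurable_fun setT f -> (forall t, (0 <= f t)%E) ->
  (\int[experiment]_u f u.1 = \int[prior]_t f t)%E.
Proof.
move=> mf f0; have mf1 : measurable_fun setT (fun u : outcome => f u.1)
  by exact: measurableT_comp.
apply: etrans (ge0_integral_experiment mf1 (fun u => f0 _)) _.
apply: eq_integral => t _.
exact: (integral_probability_cst (kernel_joint (iid (law M t) n) k) (f t)).
Qed.

Lemma ge0_integral_experiment_tnth (i : 'I_n) (f : Th * Y -> \bar R) :
  measurable_fun setT f -> (forall v, (0 <= f v)%E) ->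
  (\int[experiment]_u f (u.1, tnth u.2.1 i) =
   \int[prior]_t \int[law M t]_y f (t, y))%E.
Proof.
move=> mf f0;
  have mi : measurable_fun setT (fun u : outcome => (u.1, tnth u.2.1 i)).
  apply: measurable_fun_pair => //; apply: measurable_fun_tnth.
  exact: measurableT_comp measurable_fst measurable_snd.
apply: etrans (ge0_integral_experiment (measurableT_comp mf mi) (fun u => f0 _))
  _.
apply: eq_integral => t _.
have mft : measurable_fun setT (fun y => f (t, y)).
  exact: measurableT_comp mf (measurable_pair1 t).
have mfti : measurable_fun setT (fun ys : n.-tuple Y => f (t, tnth ys i)).
  by apply: (measurableT_comp mft); exact: measurable_fun_tnth.
rewrite -(ge0_integral_iid_tnth (law M t) i mft) //.
have mftw : measurable_fun setT (fun w : n.-tuple Y * Z => f (t, tnth w.1 i)).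
  exact: measurableT_comp mfti measurable_fst.
apply: etrans (ge0_integral_kernel_joint _ _ mftw (fun w => f0 _)) _.
apply: eq_integral => ys _.
exact: (integral_probability_cst (kernel_probability k ys) (f (t, tnth ys i))).
Qed.

Let experiment_setT : experiment setT = 1%E.
Proof.
rewrite -[LHS]mul1e -[LHS](integral_cst experiment measurableT).
rewrite (ge0_integral_experiment (f := cst 1%E)) //.
rewrite -[RHS](integral_probability_cst prior); apply: eq_integral => t _.
exact: (integral_probability_cst (kernel_joint (iid (law M t) n) k)).
Qed.

HB.instance Definition _ :=
  Measure_isProbability.Build _ _ _ experiment experiment_setT.

End experiment.

Section resampled_experiment.
Context (R : realType) (m : nat) dY dZ (Y : measurableType dY)
  (Z : measurableType dZ).
Local Notation Th := (m.-tuple (measurableTypeR R)).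
Variables (M : quad_model R m Y) (P : probability (measurableTypeR R) R).
Variables (n : nat) (k : R.-pker n.-tuple Y ~> Z).
Local Notation outcome := (Th * (n.-tuple Y * Z))%type.
Local Notation E := (experiment M (iid P m) k).
Local Notation null_joint := (kernel_joint (iid (null M) n) k).

Let weighted (f : outcome -> R) (u : outcome) : R :=
  f u * expR (sample_loglik M u.1 u.2.1).

Let integrable_weighted (f : outcome -> R) : E.-integrable setT (EFin \o f) ->
  (iid P m \x null_joint)%E.-integrable setT (EFin \o weighted f).
Proof.
move=> /integrableP[/measurable_EFinP mf f_fin].
have mw : measurable_fun setT (weighted f).
  by apply: measurable_funM => //; exact: measurable_sample_density.
apply/integrableP; split; first exact/measurable_EFinP.
apply: le_lt_trans f_fin; rewrite le_eqVlt; apply/orP; left; apply/eqP.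
have mabs : measurable_fun setT (fun u => `|f u|) by exact: measurableT_comp.
apply: etrans _ (esym (experimentE M (iid P m) k mabs)).
apply: eq_integral => u _.
by rewrite /= normrM (ger0_norm (expR_ge0 _)).
Qed.

(* Fubini's theorem, resampling the parameter first. *)
Lemma integral_experiment_eq0 (j : 'I_m) (f : outcome -> R) :
  E.-integrable setT (EFin \o f) ->
  (forall t w, \int[P]_s (f (set_tnth j t s, w) *
     expR (sample_loglik M (set_tnth j t s) w.1))%:E = 0)%E ->
  (\int[E]_u (f u)%:E = 0)%E.
Proof.
move=> fi f_zero; have iw := integrable_weighted fi.
rewrite experimentE; last by apply/measurable_EFinP; exact: measurable_int fi.
rewrite -[LHS](integral21_prod_meas1 iw).
rewrite -[RHS](integral0 null_joint setT); apply: ae_eq_integral => //.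
  exact: measurable_fubini_G iw.
apply: filterS (ae_integrable2 iw) => w iww _.
apply: etrans (integral_iid_resample j iww) _.
by under eq_integral do rewrite f_zero; exact: integral0.
Qed.

End resampled_experiment.

Section fingerprinting.
Context (R : realType) (m : nat) dY dZ (Y : measurableType dY)
  (Z : measurableType dZ).
Local Notation MR := (measurableTypeR R).
Local Notation Th := (m.-tuple MR).
Variables (M : quad_model R m Y) (eta : R) (n : nat)
  (k : R.-pker n.-tuple Y ~> Z).
Variable est : Z -> Th.
Hypotheses (eta0 : 0 < eta) (mest : measurable_fun setT est).
Hypothesis est_le : forall z j, `|tnth (est z) j| <= eta.

Definition uniform_box : probability Th R := iid (uniform_prob (gtrN eta0)) m.

Local Notation outcome := (Th * (n.-tuple Y * Z))%type.
Local Notation E := (experiment M uniform_box k).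

Definition est_error (j : 'I_m) (t : Th) (z : Z) : R :=
  tnth (est z) j - tnth t j.

Definition windowed_error (j : 'I_m) (t : Th) (z : Z) : R :=
  window eta (tnth t j) * est_error j t z.

Definition correlation (t : Th) (w : Y * Z) : R :=
  \sum_j windowed_error j t w.2 * score M j t w.1.

Let measurable_tnth (j : 'I_m) : measurable_fun setT (fun t : Th => tnth t j).
Proof. exact: measurable_fun_tnth. Qed.

Lemma measurable_est_error j :
  measurable_fun setT (fun u : Th * Z => est_error j u.1 u.2).
Proof.
apply: measurable_funB; apply: measurable_fun_tnth => //.
exact: measurableT_comp.
Qed.

Lemma measurable_windowed_error j :
  measurable_fun setT (fun u : Th * Z => windowed_error j u.1 u.2).
Proof.
apply: measurable_funM; last exact: measurable_est_error.
apply: (measurableT_comp (measurable_window eta)).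
exact: measurable_fun_tnth.
Qed.

Definition sqerr (t : Th) (z : Z) : R := \sum_j est_error j t z ^+ 2.

Lemma measurable_sqerr :
  measurable_fun setT (fun u : outcome => (sqerr u.1 u.2.2)%:E).
Proof.
have m2 : measurable_fun setT (fun u : outcome => (u.1, u.2.2)).
  by apply: measurable_fun_pair => //;
    exact: measurableT_comp measurable_snd measurable_snd.
apply/measurable_EFinP; apply: measurable_sum => j; apply: measurable_funX.
exact: measurableT_comp (measurable_est_error j) m2.
Qed.

Lemma windowed_error_norm_le j t z : `|windowed_error j t z| <= 2 * eta.
Proof. exact: window_mul_le. Qed.

Lemma measurable_correlation :
  measurable_fun setT (fun v : Th * (Y * Z) => correlation v.1 v.2).
Proof.
have m1 : measurable_fun setT (fun v : Th * (Y * Z) => (v.1, v.2.1)).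
  by apply: measurable_fun_pair => //; exact: measurableT_comp.
have m2 : measurable_fun setT (fun v : Th * (Y * Z) => (v.1, v.2.2)).
  by apply: measurable_fun_pair => //; exact: measurableT_comp.
apply: measurable_sum => j; apply: measurable_funM.
  exact: measurableT_comp (measurable_windowed_error j) m2.
exact: measurableT_comp (measurable_score M j) m1.
Qed.

Let measurable_correlation_r t : measurable_fun setT (correlation t).
Proof. exact: measurableT_comp measurable_correlation (measurable_pair1 t). Qed.

Let score_bound (t : Th) (y : Y) : R := 2 * eta * \sum_j `|score M j t y|.

Let measurable_score_bound t : measurable_fun setT (score_bound t).
Proof.
apply: measurable_funM => //; apply: measurable_sum => j.
by apply: measurableT_comp => //; exact: measurable_score_r.
Qed.

Let correlation_norm_le t y z : `|correlation t (y, z)| <= score_bound t y.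
Proof.
apply: le_trans (ler_norm_sum _ _ _) _; rewrite /score_bound mulr_sumr.
by apply: ler_sum => j _; rewrite normrM ler_wpM2r // windowed_error_norm_le.
Qed.

Let integral_score_bound t :
  (\int[law M t]_y (score_bound t y)%:E <= (2 * eta * m%:R)%:E)%E.
Proof.
have eta20 : 0 <= 2 * eta by rewrite mulr_ge0 // ltW.
have mabs j : measurable_fun setT (fun y => `|score M j t y|%:E).
  by apply/measurable_EFinP; apply: measurableT_comp => //;
    exact: measurable_score_r.
under eq_integral do rewrite EFinM -sumEFin.
have msum : measurable_fun setT (fun y => \sum_j (`|score M j t y|%:E))%E.
  by apply: emeasurable_sum => j.
rewrite ge0_integralZl // ?lee_fin //; last first.
  by move=> y _; apply: sume_ge0 => j _; rewrite lee_fin.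
rewrite (EFinM (2 * eta) m%:R) lee_wpmul2l ?lee_fin // ge0_integral_sum //.
apply: le_trans (lee_sum _ (fun j _ => integral_score_abs_le1 M j t)) _.
by rewrite sumEFin sumr_const card_ord.
Qed.

Let correlation_mean t z : (\int[law M t]_y (correlation t (y, z))%:E = 0)%E.
Proof.
have is_ j : (law M t).-integrable setT
    (fun y => (windowed_error j t z)%:E * (score M j t y)%:E)%E.
  by apply: integrableZl => //; exact: integrable_score.
under eq_integral do rewrite /correlation -sumEFin.
transitivity
  (\sum_j (windowed_error j t z)%:E * \int[law M t]_y (score M j t y)%:E)%E.
  rewrite integral_sum //; apply: eq_bigr => j _.
  by rewrite -integralZl //; exact: integrable_score.
by rewrite big1 // => j _; rewrite integral_score mule0.
Qed.

Let windowed_score (j : 'I_m) (u : outcome) : R :=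
  windowed_error j u.1 u.2.2 * \sum_(i < n) score M j u.1 (tnth u.2.1 i).

Let measurable_sample_score i j :
  measurable_fun setT (fun u : outcome => score M j u.1 (tnth u.2.1 i)).
Proof.
have mi : measurable_fun setT (fun u : outcome => (u.1, tnth u.2.1 i)).
  apply: measurable_fun_pair => //; apply: measurable_fun_tnth.
  exact: measurableT_comp measurable_fst measurable_snd.
exact: measurableT_comp (measurable_score M j) mi.
Qed.

Let measurable_param_output :
  measurable_fun setT (fun u : outcome => (u.1, u.2.2)).
Proof.
by apply: measurable_fun_pair => //;
  exact: measurableT_comp measurable_snd measurable_snd.
Qed.

Lemma integrable_windowed_score i j : E.-integrable setT
  (fun u => (windowed_error j u.1 u.2.2 * score M j u.1 (tnth u.2.1 i))%:E).
Proof.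
have ms := measurable_sample_score i j.
pose f (v : Th * Y) := `|score M j v.1 v.2|%:E : \bar R.
have mf : measurable_fun setT f.
  by apply/measurable_EFinP; apply: measurableT_comp => //;
    exact: measurable_score.
have iscore : E.-integrable setT (fun u => (score M j u.1 (tnth u.2.1 i))%:E).
  apply/integrableP; split; first exact/measurable_EFinP.
  apply: (@le_lt_trans _ _ 1%E); last by rewrite ltry.
  rewrite (ge0_integral_experiment_tnth M uniform_box k i mf
    (fun v => normr_ge0 _)).
  rewrite -[leRHS](integral_probability_cst uniform_box).
  apply: ge0_le_integral_nonmeasurable => t; last exact: integral_score_abs_le1.
  by apply: integral_ge0 => y _; rewrite lee_fin.
apply: le_integrable (integrableZl measurableT (2 * eta) iscore) => //.
  apply/measurable_EFinP; apply: measurable_funM => //.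
  exact: measurableT_comp (measurable_windowed_error j) measurable_param_output.
move=> u _; rewrite -EFinM lee_fin [leLHS]normrM [leRHS]normrM ler_wpM2r //.
by apply: le_trans (windowed_error_norm_le _ _ _) _; exact: ler_norm.
Qed.

Let integrable_windowed_scores j :
  E.-integrable setT (EFin \o windowed_score j).
Proof.
have -> : EFin \o windowed_score j = fun u => (\sum_(i < n)
    (windowed_error j u.1 u.2.2 * score M j u.1 (tnth u.2.1 i))%:E)%E.
  by apply/funext => u; rewrite /= /windowed_score mulr_sumr sumEFin.
by apply: integrable_sum => // i _; exact: integrable_windowed_score.
Qed.

Lemma integrable_window_tnth j :
  E.-integrable setT (fun u => (window eta (tnth u.1 j))%:E).
Proof.
apply: (@integrable_bounded _ _ _ E
  (fun u : outcome => window eta (tnth u.1 j)) 1).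
  apply: (measurableT_comp (measurable_window eta)).
  exact: measurable_fun_tnth.
by move=> u; have /andP[w0 w1] := window_bounds eta0 (tnth u.1 j);
  rewrite ger0_norm.
Qed.

Lemma integral_window_tnth j :
  (\int[E]_u (window eta (tnth u.1 j))%:E = (2 / 3)%:E)%E.
Proof.
have mw : measurable_fun setT (fun s : MR => (window eta s)%:E).
  by apply/measurable_EFinP; exact: measurable_window.
have w0 s : (0 <= (window eta s)%:E)%E by have /andP[] := window_bounds eta0 s.
have mwj : measurable_fun setT (fun t : Th => (window eta (tnth t j))%:E).
  by apply: (measurableT_comp mw); exact: measurable_fun_tnth.
apply: etrans
  (ge0_integral_experiment_param M uniform_box k mwj (fun t => w0 _)) _.
rewrite -(integral_window eta0).
exact: (ge0_integral_iid_tnth (uniform_prob (gtrN eta0)) j mw w0).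
Qed.

Let integrable_window_deriv_error j : E.-integrable setT
  (fun u => (window_deriv eta (tnth u.1 j) * est_error j u.1 u.2.2)%:E).
Proof.
apply: (@integrable_bounded _ _ _ E
  (fun u => window_deriv eta (tnth u.1 j) * est_error j u.1 u.2.2) 4);
    last first.
  by move=> u; exact: window_deriv_mul_norm_le.
apply: measurable_funM.
  apply: (measurableT_comp (measurable_window_deriv eta)).
  exact: measurable_fun_tnth.
exact: measurableT_comp (measurable_est_error j) measurable_param_output.
Qed.

(* Integration by parts in the coordinate j of the parameter, which the output
   sees only through the samples. *)
Lemma fingerprint_identity j :
  (\int[E]_u (windowed_score j u)%:E + \int[E]_u
     (window_deriv eta (tnth u.1 j) * est_error j u.1 u.2.2)%:E = (2 / 3)%:E)%E.
Proof.
have iw := integrable_windowed_scores j; have i1 := integrable_window_tnth j.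
have id := integrable_window_deriv_error j.
suff : (\int[E]_u (windowed_score j u - window eta (tnth u.1 j) +
    window_deriv eta (tnth u.1 j) * est_error j u.1 u.2.2)%:E = 0)%E.
  under eq_integral do rewrite EFinD EFinB.
  rewrite (integralD measurableT (integrableB measurableT iw i1) id).
  rewrite (integralB measurableT iw i1) integral_window_tnth.
  rewrite -(EFin_Rintegral iw) -(EFin_Rintegral id) -EFinB -!EFinD => -[h].
  by congr (_%:E); lra.
apply: (integral_experiment_eq0 (j := j)).
  exact: (integrableD measurableT (integrableB measurableT iw i1) id).
move=> t [ys z]; set c := tnth (est z) j.
pose S := \sum_(i < n) score M j t (tnth ys i).
pose U := \sum_(i < n) curvature M j (tnth ys i).
pose X : {poly R} := 'X - (tnth t j)%:P.
pose r : {poly R} := (sample_loglik M t ys)%:P + S *: X - (U / 2) *: X ^+ 2.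
rewrite -[RHS](integral_window_ibp eta0 c r); apply: eq_integral => s _.
have XE : X.[s] = s - tnth t j by rewrite hornerD hornerN hornerX hornerC.
have rE : sample_loglik M (set_tnth j t s) ys = r.[s].
  rewrite hornerD hornerN hornerD !hornerZ hornerC horner_exp XE /sample_loglik.
  under eq_bigr do rewrite loglik_set_tnth -mulrA.
  rewrite big_split /= sumrN big_split /= -!mulr_sumr -mulr_suml.
  by rewrite -/S -/U; ring.
have drE : r^`().[s] = \sum_(i < n) score M j (set_tnth j t s) (tnth ys i).
  under eq_bigr do rewrite score_set_tnth.
  have dX : X^`() = 1 by rewrite derivB derivX derivC subr0.
  have dX2 : (X ^+ 2)^`() = X *+ 2 by rewrite deriv_exp dX mul1r.
  rewrite sumrB -mulr_sumr -/S -/U derivB derivD derivC !derivZ dX dX2.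
  rewrite !hornerD hornerN !hornerZ hornerMn XE !hornerC.
  by field.
rewrite /= rE /windowed_score -drE /windowed_error /est_error !tnth_set_tnth
  eqxx.
by congr (_%:E); ring.
Qed.

Definition sample_correlation (i : 'I_n) (u : outcome) : R :=
  correlation u.1 (tnth u.2.1 i, u.2.2).

Lemma measurable_sample_correlation i :
  measurable_fun setT (sample_correlation i).
Proof.
have m1 : measurable_fun setT (fun u : outcome => (u.1, (tnth u.2.1 i, u.2.2))).
  apply: measurable_fun_pair => //; apply: measurable_fun_pair.
    by apply: measurable_fun_tnth;
      exact: measurableT_comp measurable_fst measurable_snd.
  exact: measurableT_comp measurable_snd measurable_snd.
exact: measurableT_comp measurable_correlation m1.
Qed.

Lemma integrable_sample_correlation i :
  E.-integrable setT (EFin \o sample_correlation i).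
Proof.
have -> : EFin \o sample_correlation i = fun u => (\sum_j
    (windowed_error j u.1 u.2.2 * score M j u.1 (tnth u.2.1 i))%:E)%E.
  by apply/funext => u; rewrite /= sumEFin.
by apply: integrable_sum => // j _; exact: integrable_windowed_score.
Qed.

Section upper_bound.
Variable beta : R.
Hypothesis beta0 : 0 < beta.

Let half_bound (t : Th) (z : Z) : R :=
  ((\sum_j windowed_error j t z ^+ 2) / beta + beta) / 4.

(* |c| <= c^2 / (2 beta) + beta / 2. *)
Let correlation_abs_le t z :
  (\int[law M t]_y `|correlation t (y, z)|%:E <= (2 * half_bound t z)%:E)%E.
Proof.
have mc : measurable_fun setT (fun y => correlation t (y, z)).
  exact: measurableT_comp (measurable_correlation_r t) (measurable_pair2 z).
have mc2 : measurable_fun setT (fun y => (correlation t (y, z) ^+ 2)%:E).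
  by apply/measurable_EFinP; exact: measurable_funX.
have c20 y : (0 <= (correlation t (y, z) ^+ 2)%:E)%E by rewrite lee_fin sqr_ge0.
have b20 : (0 <= ((2 * beta)^-1)%:E)%E
  by rewrite lee_fin invr_ge0 mulr_ge0 // ltW.
apply: (@le_trans _ _ (\int[law M t]_y
    (((2 * beta)^-1)%:E * (correlation t (y, z) ^+ 2)%:E + (beta / 2)%:E))%E).
  apply: ge0_le_integral_nonmeasurable => y; first by rewrite lee_fin.
  rewrite -EFinM -EFinD lee_fin -subr_ge0; set c := correlation t (y, z).
  have -> : (2 * beta)^-1 * c ^+ 2 + beta / 2 - `|c| =
            (`|c| - beta) ^+ 2 / (2 * beta).
    by rewrite -(real_normK (num_real c)); field; rewrite gt_eqF.
  by rewrite divr_ge0 ?sqr_ge0 // mulr_ge0 // ltW.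
rewrite ge0_integralD //; last 3 first.
- by move=> y _; rewrite mule_ge0.
- exact: measurable_funeM.
- by move=> y _; rewrite lee_fin divr_ge0 // ltW.
rewrite integral_probability_cst ge0_integralZl //.
have := integral_score_sqr_le M t (fun j => windowed_error j t z).
move=> /(lee_wpmul2l b20) /(leeD2r (beta / 2)%:E) /le_trans; apply.
rewrite -EFinM -EFinD lee_fin le_eqVlt; apply/orP; left; apply/eqP.
by rewrite /half_bound; field; rewrite gt_eqF.
Qed.


Variables (eps delta : R).
Hypotheses (eps0 : 0 <= eps) (delta0 : 0 <= delta)
  (kdp : diff_private eps delta k).
Hypothesis sqerr_le : (\int[E]_u (sqerr u.1 u.2.2)%:E <= (beta ^+ 2)%:E)%E.

Let measurable_half_bound :
  measurable_fun setT (fun u : outcome => half_bound u.1 u.2.2).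
Proof.
have m2 : measurable_fun setT (fun u : outcome => (u.1, u.2.2)).
  by apply: measurable_fun_pair => //;
    exact: measurableT_comp measurable_snd measurable_snd.
apply: measurable_funM => //; apply: measurable_funD => //;
  apply: measurable_funM => //.
apply: measurable_sum => j; apply: measurable_funX.
exact: measurableT_comp (measurable_windowed_error j) m2.
Qed.

Let half_bound_ge0 t z : 0 <= half_bound t z.
Proof.
apply: divr_ge0 => //; apply: addr_ge0; last exact: ltW.
by apply: divr_ge0; [apply: sumr_ge0 => j _; exact: sqr_ge0|exact: ltW].
Qed.

Let sample_correlation_pos_le i :
  (\int[E]_u ((sample_correlation i)^\+ u)%:E <=
   \int[E]_u (((sample_correlation i)^\- u)%:E +
     ((2 * (expR eps - 1))%:E * (half_bound u.1 u.2.2)%:E +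
      (2 * delta * (2 * eta * m%:R))%:E)))%E.
Proof.
have ms := measurable_sample_correlation i.
have mpos : measurable_fun setT (EFin \o (sample_correlation i)^\+).
  by apply/measurable_EFinP; exact: measurable_funrpos.
have mneg : measurable_fun setT (EFin \o (sample_correlation i)^\-).
  by apply/measurable_EFinP; exact: measurable_funrneg.
have e1 : 0 <= 2 * (expR eps - 1)
  by rewrite mulr_ge0 // subr_ge0 -expR0 ler_expR.
have C0 : 0 <= 2 * delta * (2 * eta * m%:R) by rewrite !mulr_ge0 // ltW.
have mhb : measurable_fun setT (fun u : outcome => (half_bound u.1 u.2.2)%:E).
  exact/measurable_EFinP.
have hb0 (u : outcome) : (0 <= (half_bound u.1 u.2.2)%:E)%E by rewrite lee_fin.
have pos0 u : (0 <= ((sample_correlation i)^\+ u)%:E)%E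
  by rewrite lee_fin funrpos_ge0.
have neg0 u : (0 <= ((sample_correlation i)^\- u)%:E)%E
  by rewrite lee_fin funrneg_ge0.
have mr (f : outcome -> \bar R) t : measurable_fun setT f ->
    measurable_fun setT (fun w => f (t, w)).
  by move=> mf; exact: measurableT_comp mf (measurable_pair1 t).
rewrite (ge0_integral_experiment M uniform_box k mpos pos0)
  ge0_integral_experiment; last 2 first.
- by apply: emeasurable_funD => //; apply: emeasurable_funD => //;
    exact: measurable_funeM.
- by move=> u; rewrite adde_ge0 // adde_ge0 // mule_ge0.
apply: ge0_le_integral_nonmeasurable => t.
  by apply: integral_ge0 => w _; exact: pos0.
rewrite ge0_integralD //; last 3 first.
- exact: (mr _ t mneg).
- by move=> w _; rewrite adde_ge0 // mule_ge0.
- by apply: emeasurable_funD => //; apply: measurable_funeM;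
    exact: (mr _ t mhb).
rewrite ge0_integralD //; last 2 first.
- by move=> w _; rewrite mule_ge0.
- by apply: measurable_funeM; exact: (mr _ t mhb).
rewrite integral_probability_cst ge0_integralZl //; last exact: (mr _ t mhb).
rewrite (ge0_integral_kernel_joint _ _ (mr _ t mpos) (fun w => pos0 _)).
rewrite (ge0_integral_kernel_joint _ _ (mr _ t mneg) (fun w => neg0 _)).
rewrite (ge0_integral_kernel_joint _ _ (mr _ t mhb) (fun w => hb0 _)).
exact: (private_correlation_le eps0 delta0 kdp i (measurable_correlation_r t)
  (measurable_score_bound t) (correlation_norm_le t) (integral_score_bound t)
  (correlation_mean t) (correlation_abs_le t)).
Qed.

Let integral_half_bound_le :
  (\int[E]_u (half_bound u.1 u.2.2)%:E <= (beta / 2)%:E)%E.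
Proof.
have b40 : (0 <= ((4 * beta)^-1)%:E)%E
  by rewrite lee_fin invr_ge0 mulr_ge0 // ltW.
have sq0 (u : outcome) : (0 <= (sqerr u.1 u.2.2)%:E)%E.
  by rewrite lee_fin; apply: sumr_ge0 => j _; exact: sqr_ge0.
apply: (@le_trans _ _ (\int[E]_u
    (((4 * beta)^-1)%:E * (sqerr u.1 u.2.2)%:E + (beta / 4)%:E))%E).
  apply: ge0_le_integral_nonmeasurable => u; first by rewrite lee_fin.
  have -> : (((4 * beta)^-1)%:E * (sqerr u.1 u.2.2)%:E + (beta / 4)%:E)%E =
      ((sqerr u.1 u.2.2 / beta + beta) / 4)%:E.
    by rewrite -EFinM -EFinD; congr (_%:E); field; rewrite gt_eqF.
  rewrite lee_fin /half_bound ler_pM2r // lerD2r ler_pM2r ?invr_gt0 //.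
  apply: ler_sum => j _; rewrite exprMn; apply: ler_piMl; first exact: sqr_ge0.
  by have /andP[w0 w1] := window_bounds eta0 (tnth u.1 j); exact: exprn_ile1.
rewrite ge0_integralD //; last 3 first.
- by move=> u _; rewrite mule_ge0.
- by apply: measurable_funeM; exact: measurable_sqerr.
- by move=> u _; rewrite lee_fin divr_ge0 // ltW.
rewrite integral_probability_cst ge0_integralZl //;
  last exact: measurable_sqerr.
apply: le_trans (leeD2r _ (lee_wpmul2l b40 sqerr_le)) _.
rewrite -EFinM -EFinD lee_fin le_eqVlt; apply/orP; left; apply/eqP.
by field; rewrite gt_eqF.
Qed.

Lemma integral_sample_correlation_le i :
  (\int[E]_u (sample_correlation i u)%:E <=
  ((expR eps - 1) * beta + 4 * delta * eta * m%:R)%:E)%E.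
Proof.
have isc := integrable_sample_correlation i.
have := sample_correlation_pos_le i.
have e1 : 0 <= 2 * (expR eps - 1)
  by rewrite mulr_ge0 // subr_ge0 -expR0 ler_expR.
have ms := measurable_sample_correlation i.
have mhb : measurable_fun setT (fun u : outcome => (half_bound u.1 u.2.2)%:E).
  exact/measurable_EFinP.
have hb0 (u : outcome) : (0 <= (half_bound u.1 u.2.2)%:E)%E by rewrite lee_fin.
have C0 : 0 <= 2 * delta * (2 * eta * m%:R) by rewrite !mulr_ge0 // ltW.
rewrite ge0_integralD //; last 4 first.
- by move=> u _; rewrite lee_fin funrneg_ge0.
- by apply/measurable_EFinP; exact: measurable_funrneg.
- by move=> u _; rewrite adde_ge0 // mule_ge0.
- by apply: emeasurable_funD => //; exact: measurable_funeM.
rewrite ge0_integralD //; last 2 first.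
- by move=> u _; rewrite mule_ge0.
- exact: measurable_funeM.
rewrite ge0_integralZl // integral_probability_cst => pos_le.
have {}pos_le := le_trans pos_le (leeD2l _ (leeD2r _
  (lee_wpmul2l (e1 : (0 <= (2 * (expR eps - 1))%:E)%E)
    integral_half_bound_le))).
rewrite integralE funerpos funerneg leeBlDl; last first.
  by have := integrable_neg_fin_num measurableT isc; rewrite funerneg.
apply: le_trans pos_le _; rewrite leeD2l // -EFinM -EFinD lee_fin.
by rewrite le_eqVlt; apply/orP; left; apply/eqP; field.
Qed.

Let window_deriv_error (j : 'I_m) (u : outcome) : R :=
  window_deriv eta (tnth u.1 j) * est_error j u.1 u.2.2.

Let integral_windowed_scores_le : (\int[E]_u (\sum_j (windowed_score j u)%:E) <=
  (n%:R * ((expR eps - 1) * beta + 4 * delta * eta * m%:R))%:E)%E.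
Proof.
have -> : (\int[E]_u (\sum_j (windowed_score j u)%:E) =
           \int[E]_u (\sum_(i < n) (sample_correlation i u)%:E))%E.
  apply: eq_integral => u _; rewrite !sumEFin [in RHS]exchange_big /=.
  by congr (_%:E); apply: eq_bigr => j _; rewrite /windowed_score mulr_sumr.
rewrite integral_sum //; last by move=> i; exact: integrable_sample_correlation.
apply: le_trans (lee_sum _ (fun i _ => integral_sample_correlation_le i)) _.
by rewrite sumEFin sumr_const card_ord [n%:R * _]mulr_natl.
Qed.

Let integrable_sqerr : E.-integrable setT (fun u => (sqerr u.1 u.2.2)%:E).
Proof.
apply/integrableP; split; first exact: measurable_sqerr.
apply: le_lt_trans (ltry (beta ^+ 2)); apply: le_trans sqerr_le.
apply: ge0_le_integral_nonmeasurable => u; first exact: abse_ge0.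
by rewrite lee_fin ger0_norm //; apply: sumr_ge0 => j _; exact: sqr_ge0.
Qed.

Let integral_window_deriv_errors_le :
  (\int[E]_u (\sum_j (window_deriv_error j u)%:E) <=
   (m%:R / 6 + 6 / eta ^+ 2 * beta ^+ 2)%:E)%E.
Proof.
have coef0 : 0 <= 6 / eta ^+ 2 by rewrite divr_ge0 // sqr_ge0.
have ic : E.-integrable setT (fun=> (m%:R / 6)%:E).
  exact: finite_measure_integrable_cst.
have isq := integrableZl measurableT (6 / eta ^+ 2) integrable_sqerr.
apply: (@le_trans _ _ (\int[E]_u
    ((m%:R / 6)%:E + (6 / eta ^+ 2)%:E * (sqerr u.1 u.2.2)%:E))%E).
  apply: le_integral (integrableD measurableT ic isq) _ => //.
    by apply: integrable_sum => // j _; exact: integrable_window_deriv_error.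
  move=> u _; rewrite sumEFin -EFinM -EFinD lee_fin.
  have -> : m%:R / 6 + 6 / eta ^+ 2 * sqerr u.1 u.2.2 =
      \sum_j (1 / 6 + 6 / eta ^+ 2 * est_error j u.1 u.2.2 ^+ 2).
    rewrite big_split /= sumr_const card_ord -mulr_sumr.
    by rewrite -[1 / 6 *+ m]mulr_natl div1r.
  by apply: ler_sum => j _; exact: window_deriv_mul_le.
rewrite (integralD measurableT ic isq) integral_probability_cst.
rewrite (integralZl measurableT integrable_sqerr) EFinD leeD2l //.
by rewrite (EFinM (6 / eta ^+ 2)) lee_wpmul2l // lee_fin.
Qed.

(* Summing the fingerprint identities over the coordinates and bounding the
   correlation with each sample by privacy. *)
Lemma fingerprinting_bound : m%:R / 2 - 6 / eta ^+ 2 * beta ^+ 2 <=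
  n%:R * ((expR eps - 1) * beta + 4 * delta * eta * m%:R).
Proof.
have iws j := integrable_windowed_scores j.
have iwd j : E.-integrable setT (EFin \o window_deriv_error j) :=
  integrable_window_deriv_error j.
have identities : (\int[E]_u (\sum_j (windowed_score j u)%:E) +
    \int[E]_u (\sum_j (window_deriv_error j u)%:E) = (m%:R * (2 / 3))%:E)%E.
  rewrite !integral_sum // -big_split /=.
  under eq_bigr do rewrite fingerprint_identity.
  by rewrite sumEFin sumr_const card_ord [m%:R * _]mulr_natl.
have := leeD integral_windowed_scores_le integral_window_deriv_errors_le.
by rewrite identities -EFinD lee_fin; lra.
Qed.

End upper_bound.

End fingerprinting.

(** * Gaussian linear regression *)

Section regression.
Context (R : realType) (p q : nat).
Local Notation Y := ('rV[R]_p * 'rV[R]_q)%type.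
Local Notation Th := ((q * p).-tuple (measurableTypeR R)).
Implicit Types (t : Th) (y : Y).

Definition coef_mx t : 'M[R]_(q, p) := vec_mx (\row_j tnth t j).

Definition residual t y : 'rV[R]_q := y.2 - y.1 *m (coef_mx t)^T.

Definition regression_null : probability Y R :=
  (stdnormal R p \x stdnormal R q)%E.

Definition regression_shear t y : Y := (y.1, y.2 + y.1 *m (coef_mx t)^T).

Definition regression_loglik t y : R :=
  (sqnorm y.2 - sqnorm (residual t y)) / 2.

Definition regression_score (j : 'I_(q * p)) t y : R :=
  mxvec ((residual t y)^T *m y.1) 0 j.

Definition regression_curvature (j : 'I_(q * p)) y : R :=
  mxvec (\matrix_(a < q, b < p) (y.1 0 b) ^+ 2) 0 j.

Let score_entry t y a b :
  regression_score (mxvec_index a b) t y = residual t y 0 a * y.1 0 b.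
Proof. by rewrite /regression_score mxvecE mxE big_ord1 mxE. Qed.

Let residual_set_tnth t y a b s :
  residual (set_tnth (mxvec_index a b) t s) y =
  residual t y - ((s - tnth t (mxvec_index a b)) * y.1 0 b) *: delta_mx 0 a.
Proof.
have coefE : coef_mx (set_tnth (mxvec_index a b) t s) =
    coef_mx t + (s - tnth t (mxvec_index a b)) *: delta_mx a b.
  rewrite -vec_mx_delta -linearZ -linearD; congr vec_mx; apply/rowP => j.
  rewrite !mxE tnth_set_tnth eqxx /=.
  by case: eqP => [->|_]; rewrite ?mulr1 ?mulr0 ?addr0 // addrC subrK.
rewrite /residual coefE linearD linearZ /= trmx_delta mulmxDr opprD addrA.
congr (_ - _); rewrite -scalemxAr -scalerA; congr (_ *: _).
apply/rowP => a'; rewrite !mxE (bigD1 b) //= big1 ?addr0.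
  by rewrite mxE eqxx.
by move=> b' /negbTE b'b; rewrite mxE b'b mulr0.
Qed.

Lemma measurable_coef_mx : measurable_fun setT coef_mx.
Proof.
apply/measurable_fun_matrixP => a b; under eq_fun do rewrite !mxE.
exact: measurable_fun_tnth.
Qed.

Lemma measurable_residual :
  measurable_fun setT (fun z : Th * Y => residual z.1 z.2).
Proof.
have mB : measurable_fun setT (fun z : Th * Y => coef_mx z.1).
  exact: measurableT_comp measurable_coef_mx measurable_fst.
have mNB : measurable_fun setT (fun z : Th * Y => z.2.1 *m (- (coef_mx z.1)^T)).
  apply: measurable_fun_mulmx; first by measurability.
  apply/measurable_fun_matrixP => a b; under eq_fun do rewrite mxE.
  by apply: (measurableT_comp (@oppr_measurable _ _)); measurability.
rewrite /residual; under eq_fun do rewrite -mulmxN.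
by measurability.
Qed.

Lemma measurable_regression_loglik :
  measurable_fun setT (fun z : Th * Y => regression_loglik z.1 z.2).
Proof.
by have mr := measurable_residual; apply: measurable_funM => //; measurability.
Qed.

Lemma measurable_regression_score j :
  measurable_fun setT (fun z : Th * Y => regression_score j z.1 z.2).
Proof.
have mr := measurable_residual; case/mxvec_indexP: j => a b.
by under eq_fun do rewrite score_entry; measurability.
Qed.

Lemma measurable_regression_shear t : measurable_fun setT (regression_shear t).
Proof.
apply: measurable_fun_pair => //; by measurability.
Qed.

HB.instance Definition _ t := isMeasurableFun.Build _ _ _ _
  (regression_shear t) (@measurable_regression_shear t).

Definition regression_law t : probability Y R :=
  distribution regression_null (regression_shear t).

Let residual_shear t y : residual t (regression_shear t y) = y.2.
Proof. by rewrite /residual addrK. Qed.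

Lemma ge0_integral_regression_law t (f : Y -> \bar R) :
  measurable_fun setT f -> (forall y, (0 <= f y)%E) ->
  (\int[regression_law t]_y f y = \int[stdnormal R p]_x \int[stdnormal R q]_g
     f (x, g + x *m (coef_mx t)^T)%R)%E.
Proof.
move=> mf f0;
  apply: etrans (ge0_integral_distribution (regression_shear t) mf f0) _.
have mfs : measurable_fun setT (fun y => f (regression_shear t y)).
  exact: measurableT_comp mf (@measurable_regression_shear t).
exact: (@fubini_tonelli1 _ _ _ _ _ (stdnormal R p) (stdnormal R q) _ mfs
  (fun y => f0 _)).
Qed.

Lemma regression_law_density t (f : Y -> \bar R) :
  measurable_fun setT f -> (forall y, (0 <= f y)%E) ->
  (\int[regression_law t]_y f y =
   \int[regression_null]_y (f y * (expR (regression_loglik t y))%:E))%E.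
Proof.
move=> mf f0; rewrite ge0_integral_regression_law //.
pose h y := (f y * (expR (regression_loglik t y))%:E)%E.
have ml : measurable_fun setT (regression_loglik t).
  exact: (measurableT_comp measurable_regression_loglik (measurable_pair1 t)).
have mh : measurable_fun setT h.
  apply: emeasurable_funM => //; apply/measurable_EFinP.
  exact: measurableT_comp (@measurable_expR _) ml.
have h0 y : (0 <= h y)%E by rewrite mule_ge0 // lee_fin expR_ge0.
rewrite -/h; apply: etrans _ (esym (@fubini_tonelli1 _ _ _ _ _
  (stdnormal R p) (stdnormal R q) h mh h0)).
apply: eq_integral => x _.
have mfx : measurable_fun setT (fun g => f (x, g)).
  exact: measurableT_comp mf (measurable_pair1 x).
rewrite (stdnormal_translate (x *m (coef_mx t)^T) mfx (fun g => f0 _)).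
apply: eq_integral => g _; congr (_ * (expR _)%:E)%E.
by rewrite /regression_loglik /residual sqnormB_rV /=; field.
Qed.

Lemma regression_loglik_set_tnth j t s y :
  regression_loglik (set_tnth j t s) y = regression_loglik t y +
    (s - tnth t j) * regression_score j t y -
    (s - tnth t j) ^+ 2 * regression_curvature j y / 2.
Proof.
case/mxvec_indexP: j => a b.
rewrite score_entry /regression_curvature mxvecE mxE /regression_loglik.
have dotE k : (residual t y *m (k *: delta_mx 0 a : 'rV[R]_q)^T) 0 0 =
  k * residual t y 0 a.
  by rewrite linearZ /= trmx_delta -scalemxAr -colE !mxE.
rewrite residual_set_tnth sqnormB_rV dotE.
by rewrite sqnormZ sqnorm_delta_mx; field.
Qed.

Lemma regression_score_set_tnth j t s y :
  regression_score j (set_tnth j t s) y =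
  regression_score j t y - (s - tnth t j) * regression_curvature j y.
Proof.
case/mxvec_indexP: j => a b.
rewrite !score_entry /regression_curvature mxvecE mxE residual_set_tnth.
by move: (residual t y) => e; rewrite !mxE !eqxx /= mulr1; ring.
Qed.

Let sum_score t y (C : 'M[R]_(q, p)) :
  \sum_j mxvec C 0 j * regression_score j t y =
    (residual t y *m (C *m y.1^T)) 0 0.
Proof.
rewrite mulmxA -mxvec_dotmul mxE; apply: eq_bigr => j _.
by rewrite mxE mulrC.
Qed.

Let measurable_score_r j t : measurable_fun setT (regression_score j t).
Proof. exact: measurableT_comp (measurable_regression_score j)
  (measurable_pair1 t). Qed.

Lemma integral_regression_score_sqr t (c : 'I_(q * p) -> R) :
  (\int[regression_law t]_y ((\sum_j c j * regression_score j t y) ^+ 2)%:E =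
   (\sum_j c j ^+ 2)%:E)%E.
Proof.
pose C : 'M[R]_(q, p) := vec_mx (\row_j c j).
have cE j : c j = mxvec C 0 j by rewrite vec_mxK mxE.
have -> : \sum_j c j ^+ 2 = sqnorm C.
  by rewrite -sqnorm_mxvec /sqnorm big_ord1; apply: eq_bigr => j _; rewrite cE.
rewrite ge0_integral_regression_law; last 2 first.
- apply/measurable_EFinP; apply: measurable_funX; apply: measurable_sum => j.
  by apply: measurable_funM => //; exact: measurable_score_r.
- by move=> y; rewrite lee_fin sqr_ge0.
transitivity (\int[stdnormal R p]_x \sum_a
    (((x *m (C^T *m delta_mx a (0 : 'I_1))) 0 0 + 0) ^+ 2)%:E)%E.
  apply: eq_integral => x _; rewrite sumEFin.
  have -> : \sum_a ((x *m (C^T *m delta_mx a (0 : 'I_1))) 0 0 + 0) ^+ 2 =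
    sqnorm (C *m x^T).
    rewrite -sqnorm_tr trmx_mul trmxK /sqnorm big_ord1; apply: eq_bigr => a _.
    by rewrite mulmxA -colE mxE addr0.
  have := integral_stdnormal_affine_sqr (C *m x^T) 0;
    rewrite expr0n /= addr0 => <-.
  apply: eq_integral => g _; rewrite addr0; congr ((_ ^+ 2)%:E).
  under eq_bigr do rewrite cE.
  by rewrite (sum_score t (regression_shear t (x, g))) residual_shear.
rewrite ge0_integral_sum //; last 2 first.
- by move=> a; measurability.
- by move=> a x _; rewrite lee_fin sqr_ge0.
under eq_bigr do rewrite integral_stdnormal_affine_sqr expr0n addr0.
by rewrite sumEFin -sqnorm_sum_col sqnorm_tr.
Qed.

Lemma integral_regression_score j t :
  (\int[regression_law t]_y (regression_score j t y)%:E = 0)%E.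
Proof.
have ms := measurable_score_r j t; pose f := regression_score j t.
pose A (h : Y -> R) := (\int[stdnormal R p]_x \int[stdnormal R q]_g
  (h (regression_shear t (x, g)))%:E)%E.
have flip : A f^\+ = A f^\-.
  apply: eq_integral => x _.
  have mneg :
    measurable_fun setT (fun g => (f^\- (regression_shear t (x, g)))%:E).
    apply/measurable_EFinP.
    apply: (measurableT_comp (measurableT_comp (measurable_funrneg ms)
      (@measurable_regression_shear t)) (measurable_pair1 x)).
  rewrite -(stdnormal_opp mneg); last by move=> g; rewrite lee_fin funrneg_ge0.
  apply: eq_integral => g _; congr (_%:E).
  rewrite /funrpos /funrneg /f; case/mxvec_indexP: j @f ms {mneg} => a b _ _.
  by rewrite !score_entry !residual_shear /= mxE mulNr opprK.
have AE (h : Y -> R) : measurable_fun setT h -> (forall y, 0 <= h y) ->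
    (\int[regression_law t]_y (h y)%:E = A h)%E.
  by move=> mh h0; rewrite ge0_integral_regression_law //;
    exact/measurable_EFinP.
have fi : (regression_law t).-integrable setT (EFin \o f).
  apply/integrableP; split; first exact/measurable_EFinP.
  apply: (@le_lt_trans _ _ 1%E); last by rewrite ltry.
  apply: integral_norm_le1 => //.
  have := integral_regression_score_sqr t (fun i => (i == j)%:R).
  under eq_integral do rewrite sumr_indicator.
  by under eq_bigr do rewrite expr2; rewrite sumr_indicator eqxx => ->.
have posE : (\int[regression_law t]_y ((EFin \o f)^\+ y) = A (f^\+)%R)%E.
  by rewrite funerpos; apply: AE;
    [exact: measurable_funrpos|exact: funrpos_ge0].
have negE : (\int[regression_law t]_y ((EFin \o f)^\- y) = A (f^\-)%R)%E.
  by rewrite funerneg; apply: AE;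
    [exact: measurable_funrneg|exact: funrneg_ge0].
have := integrable_pos_fin_num measurableT fi; rewrite posE flip => /subee fin.
by apply: etrans (integralE _ _ (EFin \o f)) _; rewrite posE negE flip.
Qed.

Definition regression_model : quad_model R (q * p) Y :=
  QuadModel measurable_regression_loglik measurable_regression_score
    regression_law_density regression_loglik_set_tnth regression_score_set_tnth
    integral_regression_score
    (fun t c =>
      eq_ind_r (fun I => I <= _)%E (lexx _)
      (integral_regression_score_sqr t c)).

End regression.

(** * From covariance estimation to parameter estimation *)

Section parameter_box.
Context (R : realType) (m : nat) (eta : R).
Local Notation MR := (measurableTypeR R).
Hypothesis eta0 : 0 < eta.

Definition box (t : m.-tuple MR) : Prop := forall j, `|tnth t j| <= eta.

Lemma uniform_box_ae : {ae uniform_box m eta0, forall t, box t}.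
Proof.
apply: filter_forall => j; pose C : set MR := [set x | ~ `|x| <= eta].
have mC : measurable C.
  have -> : C = ~` `[- eta, eta]%classic.
    by apply/seteqP; split => x /=; rewrite /C /= in_itv /= ler_norml.
  by apply: measurableC; exact: measurable_itv.
have mCj : measurable [set t : m.-tuple MR | C (tnth t j)].
  have mj : measurable_fun setT (fun t : m.-tuple MR => tnth t j).
    exact: measurable_fun_tnth.
  by have := mj measurableT _ mC; rewrite setTI.
exists [set t : m.-tuple MR | C (tnth t j)]; split => //.
transitivity (\int[uniform_box m eta0]_t (\1_C (tnth t j))%:E)%E.
  by rewrite -[in LHS](setIT [set t | _]) -integral_indic.
have m1 : measurable_fun setT (fun x : MR => (\1_C x)%:E : \bar R).
  by apply/measurable_EFinP; exact: measurable_indic.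
have c0 (x : MR) : (0 <= (\1_C x)%:E :> \bar R)%E by rewrite lee_fin.
rewrite (ge0_integral_iid_tnth (uniform_prob (gtrN eta0)) j m1 c0).
rewrite integral_uniform // integral0_eq ?mule0 // => x /=.
rewrite in_itv /= -ler_norml => xe.
by rewrite indicE memNset // /C /= => /(_ xe).
Qed.

End parameter_box.

(* The model sits inside the centred Gaussian covariance model: for a parameter
   t in the box, N(0, cov t) is the law of the statistic obs, and est is a
   Lipschitz left inverse of cov. *)
Record cov_embedding (R : realType) m d dY (Y : measurableType dY)
    (M : quad_model R m Y) (eta : R) := CovEmbedding {
  cov : m.-tuple (measurableTypeR R) -> 'M[R]_d;
  obs : Y -> 'rV[R]_d;
  cov_est : 'M[R]_d -> m.-tuple (measurableTypeR R);
  measurable_cov : measurable_fun setT cov;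
  measurable_obs : measurable_fun setT obs;
  measurable_cov_est : measurable_fun setT cov_est;
  cov_est_box : forall A, box eta (cov_est A);
  cov_psd_sqrt : forall t, box eta t -> exists B, psd B /\ B *m B = cov t;
  cov_loewner : forall t, box eta t ->
    loewner_le 1%:M (cov t) /\ loewner_le (cov t) 2%:M;
  integral_mvnormal_cov : forall t (f : 'rV[R]_d -> \bar R), box eta t ->
    measurable_fun setT f -> (forall x, (0 <= f x)%E) ->
    (\int[mvnormal (cov t)]_x f x = \int[law M t]_y f (obs y))%E;
  cov_est_lipschitz : forall t A, box eta t ->
    \sum_j (tnth (cov_est A) j - tnth t j) ^+ 2 <= 4 * sqnorm (A - cov t)
}.

Section cov_embedding.
Context (R : realType) (m d : nat) dY (Y : measurableType dY).
Variables (M : quad_model R m Y) (eta : R) (C : cov_embedding d M eta).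
Hypotheses (eta0 : 0 < eta) (d0 : (0 < d)%N).
Local Notation Th := (m.-tuple (measurableTypeR R)).
Local Notation prior := (uniform_box m eta0).
Local Notation est := (cov_est C).

Lemma cov_covK t : box eta t -> est (cov C t) = t.
Proof.
move=> bt; have := cov_est_lipschitz C (cov C t) bt.
rewrite subrr sqnorm0 mulr0 => sum_le0; apply: eq_from_tnth => j.
have sq0 (i : 'I_m) : 0 <= (tnth (est (cov C t)) i - tnth t i) ^+ 2
  by exact: sqr_ge0.
have sum_eq0 : \sum_i (tnth (est (cov C t)) i - tnth t i) ^+ 2 = 0.
  by apply/eqP; rewrite eq_le sum_le0; exact: sumr_ge0.
have /eqP := psumr_eq0P (fun i _ => sq0 i) sum_eq0 (i := j) isT.
by rewrite sqrf_eq0 subr_eq0 => /eqP.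
Qed.

Let cov_mfun : {mfun Th >-> 'M[R]_d} := mfun_Sub (mem_set (measurable_cov C)).

Definition cov_prior : probability 'M[R]_d R := distribution prior cov_mfun.

(* Up to a set of measure zero, the range of cov on the box. *)
Let cov_range : set 'M[R]_d := [set S | cov C (est S) = S].

Let measurable_cov_range : measurable cov_range.
Proof.
have mcov := measurable_cov C; have mest := measurable_cov_est C.
pose g (S : 'M[R]_d) : R := sqnorm (cov C (est S) + (-1) *: S).
have mg : measurable_fun setT g.
  have mce : measurable_fun setT (fun S : 'M[R]_d => cov C (est S)).
    exact: measurableT_comp.
  by rewrite /g; measurability.
have -> : cov_range = g @^-1` [set 0].
  apply/seteqP; split=> S; rewrite /cov_range /g /= scaleN1r.
    by move=> ->; rewrite subrr sqnorm0.
  by move=> /eqP; rewrite sqnorm_eq0 subr_eq0 => /eqP.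
by have := mg measurableT _ (measurable_set1 (0 : measurableTypeR R));
  rewrite setTI.
Qed.

Let cov_in_range t : box eta t -> cov_range (cov C t).
Proof. by move=> bt; rewrite /cov_range /= cov_covK. Qed.

Lemma cov_prior_loewner :
  {ae cov_prior, forall S, loewner_le 1%:M S /\ loewner_le S 2%:M}.
Proof.
have mV := measurableC measurable_cov_range.
exists (~` cov_range); split => //.
  have mp : measurable (cov C @^-1` (~` cov_range)).
    by have := measurable_cov C measurableT mV; rewrite setTI.
  apply: (measure_negligible (mu := prior) mp).
  apply: negligibleS (uniform_box_ae m eta0) => t /= nV bt.
  exact: (nV (cov_in_range bt)).
move=> S /=; apply: contra_not => <-.
by apply: cov_loewner; exact: cov_est_box.
Qed.

Section mechanism.
Variables (n : nat) (Mech : R.-pker n.-tuple 'rV[R]_d ~> 'M[R]_d).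

Let k : R.-pker n.-tuple Y ~> 'M[R]_d :=
  kernel_precomp Mech (measurable_map_tuple (measurable_obs C)).

Let scaled_error (u : Th * (n.-tuple Y * 'M[R]_d)) : \bar R :=
  ((16 * d%:R)^-1 * sqerr est u.1 u.2.2)%:E.

Let risk (t : Th) : \bar R :=
  (\int[kernel_joint (iid (law M t) n) k]_w scaled_error (t, w))%E.

Let scale0 : 0 <= (16 * d%:R)^-1 :> R.
Proof. by rewrite invr_ge0. Qed.

Let sqerr_ge0 t A : 0 <= sqerr est t A.
Proof. by apply: sumr_ge0 => j _; exact: sqr_ge0. Qed.

Let scaled_error_ge0 u : (0 <= scaled_error u)%E.
Proof. by rewrite lee_fin mulr_ge0. Qed.

Let measurable_est_sqerr : measurable_fun setT
  (fun u : Th * (n.-tuple Y * 'M[R]_d) => (sqerr est u.1 u.2.2)%:E).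
Proof. by apply: measurable_sqerr; exact: measurable_cov_est. Qed.

Let measurable_scaled_error : measurable_fun setT scaled_error.
Proof.
rewrite /scaled_error; under eq_fun do rewrite EFinM.
exact: measurable_funeM measurable_est_sqerr.
Qed.

Let risk_ge0 t : (0 <= risk t)%E.
Proof. by apply: integral_ge0 => w _; exact: scaled_error_ge0. Qed.

Let measurable_risk : measurable_fun setT risk.
Proof. exact:
  (measurable_integral_law M k measurable_scaled_error scaled_error_ge0). Qed.

Let risk_le t : box eta t ->
  (risk t <= \int[iid (mvnormal (cov C t)) n]_x \int[Mech x]_A
    (cov_error (cov C t) A)%:E)%E.
Proof.
move=> bt; pose h A : \bar R := ((16 * d%:R)^-1 * sqerr est t A)%:E.
have mw :
  measurable_fun setT (fun w : n.-tuple Y * 'M[R]_d => scaled_error (t, w)).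
  exact: measurableT_comp measurable_scaled_error (measurable_pair1 t).
have mh : measurable_fun setT h.
  exact: measurableT_comp mw (measurable_pair1 (point : n.-tuple Y)).
have h0 A : (0 <= h A)%E by rewrite lee_fin mulr_ge0.
have mH : measurable_fun setT (fun x => \int[Mech x]_A h A)%E.
  apply: (measurable_fun_integral_finite_kernel (fun v => h v.2) Mech) => //.
  exact: measurableT_comp mh measurable_snd.
have -> : risk t = (\int[iid (mvnormal (cov C t)) n]_x \int[Mech x]_A h A)%E.
  apply: etrans (ge0_integral_kernel_joint _ _ mw (fun w => scaled_error_ge0 _))
    _.
  apply: etrans _ (esym (ge0_integral_iid_density (P := mvnormal (cov C t))
    (Q := law M t) (psi := obs C) (l := cst 0) (measurable_obs C) _ _ mH _)) =>
      //.
  - apply: eq_integral => ys _; rewrite big1 // expR0 mule1.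
    by [].
  - move=> f mf f0; rewrite (integral_mvnormal_cov C bt mf f0).
    by apply: eq_integral => y _; rewrite expR0 mule1.
  - by move=> x; apply: integral_ge0.
apply: ge0_le_integral_nonmeasurable => x; first exact: integral_ge0.
apply: ge0_le_integral_nonmeasurable => A //; rewrite lee_fin.
rewrite mulrC ler_pdivrMr ?mulr_gt0 ?ltr0n //.
apply: le_trans (cov_est_lipschitz C A bt) _.
have [l1 l2] := cov_loewner C bt.
have := sqnorm_le_cov_error A (cov_psd_sqrt C bt) l1 l2.
by rewrite -(ler_pM2l (x := 4)) // => /le_trans; apply; lra.
Qed.

Let integral_risk_le :
  (\int[prior]_t risk t <= expected_cov_error cov_prior Mech)%E.
Proof.
pose h (S : 'M[R]_d) : \bar R := ((\1_cov_range S)%:E * risk (est S))%E.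
have h0 S : (0 <= h S)%E by rewrite mule_ge0 // lee_fin.
have mh : measurable_fun setT h.
  apply: emeasurable_funM; first by apply/measurable_EFinP;
    exact: measurable_indic.
  exact: measurableT_comp measurable_risk (measurable_cov_est C).
have -> : (\int[prior]_t risk t = \int[prior]_t h (cov C t))%E.
  apply: ae_eq_integral => //;
    first exact: measurableT_comp mh (measurable_cov C).
  apply: filterS (uniform_box_ae m eta0) => t bt _.
  by rewrite /h cov_covK // indicE mem_set ?mul1e //; exact: cov_in_range.
have <- : (\int[cov_prior]_S h S = \int[prior]_t h (cov C t))%E.
  exact: (ge0_integral_distribution cov_mfun mh h0).
apply: ge0_le_integral_nonmeasurable => // S; rewrite /h indicE.
case: (boolP (S \in cov_range)) => [|_]; last first.
  rewrite mul0e; apply: integral_ge0 => x _; apply: integral_ge0 => A _.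
  by rewrite lee_fin sqr_ge0.
rewrite inE mul1e => SE; have := risk_le (cov_est_box C S).
by rewrite SE.
Qed.

Lemma cov_embedding_bound (alpha eps delta : R) :
  0 < alpha -> 0 <= eps -> 0 <= delta -> diff_private eps delta Mech ->
  (expected_cov_error cov_prior Mech <= (alpha ^+ 2)%:E)%E ->
  m%:R / 2 - 6 / eta ^+ 2 * (16 * d%:R * alpha ^+ 2) <=
  n%:R * ((expR eps - 1) * (4 * Num.sqrt d%:R * alpha) + 4 * delta * eta *
    m%:R).
Proof.
move=> a0 eps0 delta0 Mdp err_le.
have betaE : 16 * d%:R * alpha ^+ 2 = (4 * Num.sqrt d%:R * alpha) ^+ 2.
  by rewrite !exprMn sqr_sqrtr //; ring.
have kdp : diff_private eps delta k.
  exact: (diff_private_map_tuple eps0 delta0 (measurable_obs C) Mdp).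
rewrite betaE;
  apply: (fingerprinting_bound (eta0 := eta0) (measurable_cov_est C)
  (cov_est_box C) _ eps0 delta0 kdp).
  by rewrite !mulr_gt0 // sqrtr_gt0 ltr0n.
have d16 : 0 < 16 * d%:R :> R by rewrite mulr_gt0 // ltr0n.
have sq0 (u : Th * (n.-tuple Y * 'M[R]_d)) :
  setT u -> (0 <= (sqerr est u.1 u.2.2)%:E)%E.
  by rewrite lee_fin.
have riskE : (\int[prior]_t risk t = ((16 * d%:R)^-1)%:E *
    \int[experiment M prior k]_u (sqerr est u.1 u.2.2)%:E)%E.
  have := ge0_integralZl_EFin (experiment M prior k) measurableT sq0
    measurable_est_sqerr scale0.
  apply: etrans; apply/esym.
  exact: (ge0_integral_experiment M prior k measurable_scaled_error
    scaled_error_ge0).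
have rescale (x : \bar R) : (((16 * d%:R)^-1)%:E * x <= (alpha ^+ 2)%:E)%E ->
    (x <= (16 * d%:R * alpha ^+ 2)%:E)%E.
  by rewrite muleC -lee_pdivlMr ?invr_gt0 // invrK -EFinM [alpha ^+ 2 * _]mulrC.
rewrite -betaE; apply: rescale;
  apply: le_trans (le_trans integral_risk_le err_le).
by rewrite riskE.
Qed.

End mechanism.

End cov_embedding.

(** * Two families of covariances *)

Section clip.
Context (R : realType) (eta : R).
Hypothesis eta0 : 0 < eta.

Definition clip (x : R) : R := Num.max (- eta) (Num.min x eta).

Lemma clip_norm_le x : `|clip x| <= eta.
Proof.
rewrite ler_norml /clip le_max lexx /= ge_max ge_min lexx orbT andbT.
by have := eta0; lra.
Qed.

Lemma sqr_clip_dist_le x y : `|y| <= eta -> (clip x - y) ^+ 2 <= (x - y) ^+ 2.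
Proof.
rewrite ler_norml => /andP[y_ge y_le]; rewrite /clip.
case: (leP x eta) => xe.
  case: (leP (- eta) x) => // x_lt.
  have : 0 <= (- x - eta) * (y + eta + (y - x)) by apply: mulr_ge0; lra.
  by lra.
rewrite max_r; last by have := eta0; lra.
have : 0 <= (x - eta) * (x - y + (eta - y)) by apply: mulr_ge0; lra.
by lra.
Qed.

Lemma measurable_clip : measurable_fun setT clip.
Proof. by apply: measurable_maxr => //; apply: measurable_minr. Qed.

End clip.

Lemma scaled_perturbed_identity (R : realType) d (E : 'M[R]_d) (c : R) :
  E^T = E -> `|E| <= 1 / 4 / d%:R -> 4 / 3 <= c <= 8 / 5 ->
  let S := c *: (1%:M - E) in
  [/\ exists B, psd B /\ B *m B = S, S \in unitmx &
      loewner_le 1%:M S /\ loewner_le S 2%:M].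
Proof.
move=> sE Eb /andP[c1 c2] S; have c0 : 0 <= c by lra.
have dE : d%:R * `|E| <= 1 / 4 by apply: ler_natl_div => //; lra.
have dV0 : 0 <= d%:R^-1 :> R by rewrite invr_ge0.
have [S1 S2] : loewner_le 1%:M S /\ loewner_le S 2%:M.
  by apply: (loewner_perturbed_identity sE dE) => //; lra.
have sS : S^T = S by rewrite /S linearZ /= linearB /= trmx1 sE.
split=> //; last exact: (loewner_le_scalar_unitmx ltr01 sS S1).
apply: psd_square_root_perturbed_identity => //.
by apply: le_trans Eb _; rewrite ler_wpM2r //; lra.
Qed.

(* The covariance of 6/5 (x, x B^T + g), for independent standard normal vectors
   x and g: B is its lower left block, up to the factor (6/5)^2. *)
Section split_model.
Context (R : realType) (p q : nat).
Hypothesis p0 : (0 < p)%N.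
Local Notation d := (p + q)%N.
Local Notation Th := ((q * p).-tuple (measurableTypeR R)).
Local Notation Y := ('rV[R]_p * 'rV[R]_q)%type.
Local Notation eta := ((8 * d%:R)^-1 : R).

Definition split_factor (t : Th) : 'M[R]_d :=
  (6 / 5) *: block_mx 1%:M (coef_mx t)^T 0 1%:M.

Definition split_cov (t : Th) : 'M[R]_d := (split_factor t)^T *m split_factor t.

Definition split_obs (y : Y) : 'rV[R]_d := (6 / 5) *: row_mx y.1 y.2.

Definition split_est (A : 'M[R]_d) : Th :=
  [tuple clip eta ((6 / 5) ^- 2 * mxvec (dlsubmx A) 0 j) | j < q * p].

Let d0 : 0 < d%:R :> R. Proof. by rewrite ltr0n addn_gt0 p0. Qed.

Let eta0 : 0 < eta. Proof. by rewrite invr_gt0 mulr_gt0. Qed.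

Let perturbation (t : Th) : 'M[R]_d :=
  block_mx 0 (- (coef_mx t)^T) (- coef_mx t) (- (coef_mx t *m (coef_mx t)^T)).

Let split_covE t : split_cov t = (6 / 5) ^+ 2 *: (1%:M - perturbation t).
Proof.
rewrite /split_cov /split_factor; set K := block_mx _ _ _ _.
have -> : ((6 / 5) *: K)^T = (6 / 5) *: K^T by rewrite linearZ.
rewrite -scalemxAl -scalemxAr scalerA -expr2; congr (_ *: _);
  rewrite /K tr_block_mx !trmx1 trmx0 trmxK mulmx_block.
rewrite (scalar_mx_block p q 1) opp_block_mx add_block_mx !opprK oppr0.
by rewrite !(mulmx1, mul1mx, mulmx0, mul0mx, addr0, add0r) [in RHS]addrC.
Qed.

Let split_cov_dl t a b :
  split_cov t (rshift p a) (lshift q b) = (6 / 5) ^+ 2 * coef_mx t a b.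
Proof.
rewrite split_covE /perturbation (scalar_mx_block p q 1) opp_block_mx
  add_block_mx.
by rewrite mxE block_mxEdl sub0r opprK.
Qed.

Let tr_perturbation t : (perturbation t)^T = perturbation t.
Proof.
by rewrite /perturbation tr_block_mx trmx0 !linearN /= trmxK trmx_mul trmxK.
Qed.

Let coef_mx_norm_le (t : Th) (a : 'I_q) (b : 'I_p) :
  box eta t -> `|coef_mx t a b| <= eta.
Proof. by move=> bt; rewrite !mxE; exact: bt. Qed.

Let etaE : eta = 1 / 8 / d%:R. Proof. by rewrite invfM mul1r. Qed.

Let perturbation_norm_le t : box eta t -> `|perturbation t| <= 1 / 4 / d%:R.
Proof.
move=> bt; have dV0 : 0 < d%:R^-1 :> R by rewrite invr_gt0.
have e4 : eta <= 1 / 4 / d%:R by rewrite etaE ler_pM2r //; lra.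
have z4 : 0 <= 1 / 4 / d%:R :> R by rewrite mulr_ge0 // ltW.
apply: mx_norm_le => // i j; case: (split_ordP i) => a ->;
  case: (split_ordP j) => b ->.
- by rewrite block_mxEul mxE normr0.
- by rewrite block_mxEur !mxE normrN; apply: le_trans e4; exact: bt.
- by rewrite block_mxEdl mxE normrN; apply: le_trans e4; exact: coef_mx_norm_le.
rewrite block_mxEdr mxE normrN mxE; apply: le_trans (ler_norm_sum _ _ _) _.
apply: (@le_trans _ _ (\sum_(k < p) eta * eta)).
  apply: ler_sum => k _; rewrite normrM; apply: ler_pM => //; last rewrite mxE;
  exact: coef_mx_norm_le.
have -> : \sum_(k < p) eta * eta = eta * (eta * p%:R).
  by rewrite sumr_const card_ord mulrA [RHS]mulr_natr.
apply: le_trans e4;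
  rewrite -[leRHS]mulr1 ler_pM2l // etaE mulrAC ler_pdivrMr // mul1r.
have : p%:R <= d%:R :> R by rewrite ler_nat leq_addr.
by have : 0 <= p%:R :> R by []; lra.
Qed.

Let split_cov_regular t : box eta t ->
  [/\ exists B, psd B /\ B *m B = split_cov t, split_cov t \in unitmx &
      loewner_le 1%:M (split_cov t) /\ loewner_le (split_cov t) 2%:M].
Proof.
move=> bt; rewrite split_covE.
by apply: scaled_perturbed_identity => //; [exact: perturbation_norm_le|lra].
Qed.

Let measurable_split_cov : measurable_fun setT split_cov.
Proof.
have mB := @measurable_coef_mx R p q.
have mfactor : measurable_fun setT split_factor.
  rewrite /split_factor /block_mx; measurability.
by rewrite /split_cov; measurability.
Qed.

Let measurable_split_obs : measurable_fun setT split_obs.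
Proof. by rewrite /split_obs; measurability. Qed.

Let measurable_split_est : measurable_fun setT split_est.
Proof.
apply/measurable_fun_tnthP => j; rewrite /comp.
under eq_fun do rewrite tnth_mktuple.
apply: (measurableT_comp (measurable_clip eta)); case/mxvec_indexP: j => a b.
by under eq_fun do rewrite mxvecE !mxE; measurability.
Qed.

Let split_est_box A : box eta (split_est A).
Proof. by move=> j; rewrite tnth_mktuple; exact: clip_norm_le. Qed.

Let integral_mvnormal_split_cov t (f : 'rV[R]_d -> \bar R) : box eta t ->
  measurable_fun setT f -> (forall x, (0 <= f x)%E) ->
  (\int[mvnormal (split_cov t)]_x f x =
   \int[law (regression_model R p q) t]_y f (split_obs y))%E.
Proof.
move=> bt mf f0; have [sqrtS uS _] := split_cov_regular bt.
rewrite (ge0_integral_mvnormal_gram (A := split_factor t) sqrtS uS erefl mf f0).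
have mfA : measurable_fun setT (fun x : 'rV[R]_d => f (x *m split_factor t)).
  by apply: (measurableT_comp mf); measurability.
rewrite (ge0_integral_stdnormal_row_mx mfA (fun x => f0 _)).
have mfo : measurable_fun setT (fun y => f (split_obs y))
  by exact: measurableT_comp.
rewrite (ge0_integral_regression_law t mfo (fun y => f0 _)).
apply: eq_integral => x _; apply: eq_integral => g _.
rewrite -scalemxAr mul_row_block !mulmx1 mulmx0 addr0 /split_obs /=.
by rewrite [g + _]addrC.
Qed.

Let split_est_lipschitz t A : box eta t ->
  \sum_j (tnth (split_est A) j - tnth t j) ^+ 2 <= 4 * sqnorm (A - split_cov t).
Proof.
move=> bt; set D := A - _.
have dlD : dlsubmx D = dlsubmx A - (6 / 5) ^+ 2 *: coef_mx t.
  have dlE (X : 'M[R]_d) a b : dlsubmx X a b = X (rshift p a) (lshift q b).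
    by rewrite !mxE.
  apply/matrixP => a b; rewrite dlE 2!mxE split_cov_dl [RHS]mxE dlE.
  by congr (_ + _); apply/esym; rewrite mxE; congr (- _); rewrite mxE.
apply: (@le_trans _ _ ((6 / 5) ^- 2 ^+ 2 * sqnorm (dlsubmx D))).
  rewrite -sqnorm_mxvec /sqnorm big_ord1 mulr_sumr; apply: ler_sum => j _.
  rewrite tnth_mktuple; apply: le_trans (sqr_clip_dist_le eta0 _ (bt j)) _.
  have -> : tnth t j = mxvec (coef_mx t) 0 j by rewrite vec_mxK mxE.
  rewrite dlD linearB /= linearZ /= -exprMn le_eqVlt; apply/orP; left;
    apply/eqP.
  by congr (_ ^+ 2); rewrite !mxE; field.
have dl_le : sqnorm (dlsubmx D) <= sqnorm D.
  rewrite -[in leRHS](submxK D) sqnorm_col_mx !sqnorm_row_mx.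
  have := sqnorm_ge0 (ulsubmx D); have := sqnorm_ge0 (ursubmx D).
  by have := sqnorm_ge0 (drsubmx D); lra.
by have := sqnorm_ge0 (dlsubmx D); have := sqnorm_ge0 D; lra.
Qed.

Definition split_embedding : cov_embedding d (regression_model R p q) eta :=
  CovEmbedding measurable_split_cov measurable_split_obs measurable_split_est
    split_est_box
      (fun t bt => let: And3 sqrtS _ _ := split_cov_regular bt in sqrtS)
    (fun t bt => let: And3 _ _ S12 := split_cov_regular bt in S12)
    integral_mvnormal_split_cov split_est_lipschitz.

End split_model.

Lemma sqr_sqrtr_dist_le (R : realType) (x C : R) : 7 / 8 <= C ->
  (Num.sqrt x - C) ^+ 2 <= 64 / 49 * (x - C ^+ 2) ^+ 2.
Proof.
move=> C7; have C2 : 49 / 64 <= C ^+ 2 by nra.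
have [x0|x0] := leP 0 x.
  have z0 := sqrtr_ge0 x; rewrite -[in leRHS](sqr_sqrtr x0);
    set z := Num.sqrt x in z0 *.
  have sum_ge : 49 / 64 <= (z + C) ^+ 2 by nra.
  have diff_ge0 := sqr_ge0 (z - C).
  have -> : (z ^+ 2 - C ^+ 2) ^+ 2 = (z - C) ^+ 2 * (z + C) ^+ 2 by ring.
  by have := ler_wpM2l diff_ge0 sum_ge; lra.
rewrite ler0_sqrtr; last exact: ltW.
set y := C ^+ 2 in C2 *; rewrite sub0r sqrrN -/y.
have : 0 <= (- x) * (y - x + y) by apply: mulr_ge0; lra.
have : 0 <= (y - 49 / 64) * y by apply: mulr_ge0; lra.
by lra.
Qed.

(* In dimension 1 there is no room for two blocks: instead the variance of
   5/6 (x + b x + g) determines b, as 1 + b is bounded away from 0. *)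
Section line_model.
Context (R : realType).
Local Notation Th := ((1 * 1).-tuple (measurableTypeR R)).
Local Notation Y := ('rV[R]_1 * 'rV[R]_1)%type.
Local Notation eta := ((8 * 1%:R)^-1 : R).

Let slope (t : Th) : R := coef_mx t 0 0.

Definition line_cov (t : Th) : 'M[R]_1 :=
  (25 / 36 * (1 + (1 + slope t) ^+ 2))%:M.

Definition line_obs (y : Y) : 'rV[R]_1 := (5 / 6) *: (y.1 + y.2).

Definition line_est (A : 'M[R]_1) : Th :=
  [tuple clip eta (Num.sqrt (A 0 0 * (36 / 25) - 1) - 1) | j < 1 * 1].

Let eta0 : 0 < eta. Proof. by rewrite mulr1 invr_gt0. Qed.

Let perturbation (t : Th) : 'M[R]_1 := (- (slope t + slope t ^+ 2 / 2))%:M.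

Let line_covE t : line_cov t = (25 / 18) *: (1%:M - perturbation t).
Proof.
rewrite /line_cov /perturbation -raddfB /= scale_scalar_mx; congr (_%:M).
by field.
Qed.

Let slope_bounds t : box eta t -> - (1 / 8) <= slope t <= 1 / 8.
Proof.
move=> bt; rewrite -ler_norml /slope !mxE; apply: le_trans (bt _) _.
by rewrite mulr1 mul1r.
Qed.

Let line_cov_regular t : box eta t ->
  [/\ exists B, psd B /\ B *m B = line_cov t, line_cov t \in unitmx &
      loewner_le 1%:M (line_cov t) /\ loewner_le (line_cov t) 2%:M].
Proof.
move=> /slope_bounds/andP[b1 b2]; rewrite line_covE.
apply: scaled_perturbed_identity; [by rewrite tr_scalar_mx| |lra].
apply: mx_norm_le; first by rewrite divr1; lra.
move=> i j; rewrite !ord1 mxE eqxx mulr1n normrN divr1 ler_norml.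
have : 0 <= (1 / 8 - slope t) * (slope t + 1 / 8) by apply: mulr_ge0; lra.
by have := sqr_ge0 (slope t) => sqr_ge prod_ge; apply/andP; split; lra.
Qed.

Let measurable_line_cov : measurable_fun setT line_cov.
Proof.
have mB := @measurable_coef_mx R 1 1.
by rewrite /line_cov /slope; measurability.
Qed.

Let measurable_line_obs : measurable_fun setT line_obs.
Proof. by rewrite /line_obs; measurability. Qed.

Let measurable_line_est : measurable_fun setT line_est.
Proof.
apply/measurable_fun_tnthP => j; rewrite /comp.
under eq_fun do rewrite tnth_mktuple.
apply: (measurableT_comp (measurable_clip eta)); apply: measurable_funB => //.
apply: (measurableT_comp (continuous_measurable_fun (@sqrt_continuous R))).
by measurability.
Qed.

Let line_est_box A : box eta (line_est A).
Proof. by move=> j; rewrite tnth_mktuple; exact: clip_norm_le. Qed.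

Let line_est_lipschitz t A : box eta t ->
  \sum_j (tnth (line_est A) j - tnth t j) ^+ 2 <= 4 * sqnorm (A - line_cov t).
Proof.
move=> bt; have /andP[b1 b2] := slope_bounds bt.
rewrite /sqnorm !big_ord1 tnth_mktuple.
apply: le_trans (sqr_clip_dist_le eta0 _ (bt _)) _.
have -> : tnth t ord0 = slope t.
  rewrite /slope !mxE; congr tnth.
  by case: (mxvec_index _ _) => -[|k] // k_lt; exact: val_inj.
rewrite !mxE eqxx mulr1n; set x := A 0 0; set b := slope t in b1 b2 *.
have := sqr_sqrtr_dist_le (x * (36 / 25) - 1) (_ : 7 / 8 <= 1 + b).
have -> : x * (36 / 25) - 1 - (1 + b) ^+ 2 =
    36 / 25 * (x - 25 / 36 * (1 + (1 + b) ^+ 2)) by field.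
rewrite opprD addrA exprMn; have := sqr_ge0 (x - 25 / 36 * (1 + (1 + b) ^+ 2)).
by move=> sq0 /(_ ltac:(lra)); lra.
Qed.

(* (1 + b) x + g has the law of sqrt ((1 + b)^2 + 1) x: both are the first
   coordinate of a linear image of (x, g) with the same Gram matrix. *)
Let stdnormal_rotate (C r : R) (f : 'rV[R]_1 -> \bar R) :
  0 < r -> r ^+ 2 = C ^+ 2 + 1 -> measurable_fun setT f ->
    (forall x, (0 <= f x)%E) ->
  (\int[stdnormal R 1]_x \int[stdnormal R 1]_g f (C *: x + g)%R =
   \int[stdnormal R 1]_x f (r *: x)%R)%E.
Proof.
move=> r0 r2 mf f0; pose K : 'M[R]_(1 + 1) := block_mx C%:M (- 1%:M) 1%:M C%:M.
have KK : K^T *m K = r%:M^T *m (r%:M : 'M[R]_(1 + 1)).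
  have trN1 : (- 1%:M : 'M[R]_1)^T = - 1%:M by rewrite linearN /= tr_scalar_mx.
  rewrite tr_block_mx mulmx_block trN1 !tr_scalar_mx.
  rewrite -[RHS]scalar_mxM -expr2 r2 (scalar_mx_block 1 1) raddfD /=.
  rewrite !(mulNmx, mulmxN, mulmx1, mul1mx) opprK -!scalar_mxM -!expr2 !addNr.
  by rewrite [X in block_mx _ _ _ X]addrC.
have uK : K^T *m K \in unitmx.
  by rewrite KK tr_scalar_mx -scalar_mxM unitmxE det_scalar unitfE expf_eq0
    mulf_eq0 gt_eqF.
pose F (z : 'rV[R]_(1 + 1)) := f (lsubmx z).
have mlsub : measurable_fun setT (fun z : 'rV[R]_(1 + 1) => lsubmx z).
  by apply/measurable_fun_matrixP => i j; under eq_fun do rewrite mxE;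
    measurability.
have mF : measurable_fun setT F by exact: measurableT_comp.
have mFA (A : 'M[R]_(1 + 1)) :
  measurable_fun setT (fun z : 'rV[R]_(1 + 1) => F (z *m A)).
  by apply: (measurableT_comp mF); measurability.
transitivity (\int[stdnormal R (1 + 1)]_z F (z *m K))%E.
  rewrite (ge0_integral_stdnormal_row_mx (mFA K) (fun z => f0 _)).
  apply: eq_integral => x _; apply: eq_integral => g _.
  by rewrite /F mul_row_block row_mxKl mul_mx_scalar mulmx1.
rewrite (stdnormal_gram uK KK mF (fun z => f0 _)).
rewrite (ge0_integral_stdnormal_row_mx (mFA _) (fun z => f0 _)).
apply: eq_integral => x _;
  rewrite -[RHS](integral_probability_cst (stdnormal R 1)).
by apply: eq_integral => g _; rewrite /F mul_mx_scalar scale_row_mx row_mxKl.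
Qed.

Let integral_mvnormal_line_cov t (f : 'rV[R]_1 -> \bar R) : box eta t ->
  measurable_fun setT f -> (forall x, (0 <= f x)%E) ->
  (\int[mvnormal (line_cov t)]_x f x =
   \int[law (regression_model R 1 1) t]_y f (line_obs y))%E.
Proof.
move=> bt mf f0; have [sqrtS uS _] := line_cov_regular bt.
pose C := 1 + slope t; pose r := Num.sqrt (C ^+ 2 + 1).
have r2 : r ^+ 2 = C ^+ 2 + 1 by rewrite sqr_sqrtr // addr_ge0 ?sqr_ge0.
have r0 : 0 < r by rewrite sqrtr_gt0 ltr_wpDl ?sqr_ge0.
have gram : ((5 / 6 * r)%:M^T *m (5 / 6 * r)%:M : 'M[R]_1) = line_cov t.
  rewrite tr_scalar_mx -scalar_mxM -expr2 exprMn r2 /C; congr (_%:M).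
  by field.
rewrite (ge0_integral_mvnormal_gram sqrtS uS gram mf f0).
pose h (x : 'rV[R]_1) := f ((5 / 6) *: x).
have mh : measurable_fun setT h by apply: (measurableT_comp mf); measurability.
have mfo : measurable_fun setT (fun y => f (line_obs y))
  by exact: measurableT_comp.
rewrite (ge0_integral_regression_law t mfo (fun y => f0 _)).
transitivity (\int[stdnormal R 1]_x h (r *: x)%R)%E.
  by apply: eq_integral => x _; rewrite mul_mx_scalar /h scalerA.
rewrite -(stdnormal_rotate r0 r2 mh (fun x => f0 _)).
apply: eq_integral => x _; apply: eq_integral => g _.
rewrite /h /line_obs /= [coef_mx t]mx11_scalar tr_scalar_mx mul_mx_scalar
  -/(slope t).
by rewrite /C scalerDl scale1r -addrA [g + _]addrC.
Qed.

Definition line_embedding : cov_embedding 1 (regression_model R 1 1) eta :=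
  CovEmbedding measurable_line_cov measurable_line_obs measurable_line_est
    line_est_box
      (fun t bt => let: And3 sqrtS _ _ := line_cov_regular bt in sqrtS)
    (fun t bt => let: And3 _ _ S12 := line_cov_regular bt in S12)
    integral_mvnormal_line_cov line_est_lipschitz.

End line_model.

(** * The sample complexity bound *)

Lemma half_square_le_mul (d : nat) : (1 < d)%N ->
  exists p q, [/\ d = (p + q)%N, (0 < p)%N & (d ^ 2 <= 6 * (q * p))%N].
Proof.
move=> d1; exists (d - d %/ 2)%N, (d %/ 2)%N; split; [lia|lia|].
have : (d = d %/ 2 * 2 + d %% 2)%N by lia.
have : (d %% 2 < 2)%N by lia.
move: (d %/ 2)%N (d %% 2)%N => m s s2 dE.
have -> : (d - m = m + s)%N by lia.
have m0 : (0 < m)%N by lia.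
by rewrite dE -mulnn; case: s s2 {dE} => [|[|//]] _; nia.
Qed.

Lemma private_covariance_tradeoff (R : realType) (d : nat) : (0 < d)%N ->
  exists (D : probability 'M[R]_d R) (m : nat), [/\ (d ^ 2 <= 6 * m)%N,
    {ae D, forall S : 'M[R]_d, loewner_le 1%:M S /\ loewner_le S 2%:M} &
    forall (n : nat) (M : R.-pker (n.-tuple 'rV[R]_d) ~> 'M[R]_d)
      (alpha eps delta : R),
      0 < alpha -> 0 <= eps -> 0 <= delta -> diff_private eps delta M ->
      (expected_cov_error D M <= (alpha ^+ 2)%:E)%E ->
      m%:R / 2 - 6 / ((8 * d%:R)^-1) ^+ 2 * (16 * d%:R * alpha ^+ 2) <=
      n%:R * ((expR eps - 1) * (4 * Num.sqrt d%:R * alpha) +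
              4 * delta * (8 * d%:R)^-1 * m%:R)].
Proof.
move=> d0; have eta0 : 0 < (8 * d%:R)^-1 :> R
  by rewrite invr_gt0 mulr_gt0 // ltr0n.
have [d1|/half_square_le_mul[p [q [dE p0 d2]]]] := leqP d 1.
  have dE : d = 1%N by apply/eqP; rewrite eqn_leq d1 d0.
  subst d; exists (cov_prior (line_embedding R) eta0), (1 * 1)%N; split=> //.
    exact: cov_prior_loewner.
  by move=> n M alpha eps delta; exact: cov_embedding_bound.
subst d; exists (cov_prior (split_embedding R q p0) eta0), (q * p)%N;
  split=> //.
  exact: cov_prior_loewner.
by move=> n M alpha eps delta; exact: cov_embedding_bound.
Qed.

Lemma expR_sub1_le (R : realType) (x : R) : 0 <= x <= 1 -> expR x - 1 <= 3 * x.
Proof.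
move=> /andP[x0 x1].
have half_le : 1 - x / 2 <= expR (- (x / 2)) by have := expR_ge1Dx (- (x / 2)).
have half_sqr : expR (- (x / 2)) ^+ 2 * expR x = 1.
  by rewrite expr2 -!expRD (_ : _ + x = 0) ?expR0 //; field.
have sqr_le : (1 - x / 2) ^+ 2 <= expR (- (x / 2)) ^+ 2.
  by rewrite ler_sqr ?nnegrE ?expR_ge0 //; lra.
have := ler_wpM2r (expR_ge0 x) sqr_le; rewrite half_sqr => exp_le.
have : (1 - x / 2) ^+ 2 * expR x <= (1 - x / 2) ^+ 2 * (1 + 3 * x).
  have : 0 <= (x * (1 - x)) * (8 - 3 * x) by rewrite !mulr_ge0 //; lra.
  by lra.
by rewrite ler_pM2l ?exprn_gt0 //; lra.
Qed.

(* With u = alpha sqrt d, the tradeoff reads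
   m / 2 - 6144 d^2 u^2 <= 4 n u (exp eps - 1) + n delta m / (2 d). *)
Lemma tradeoff_sample_bound (R : realType) (d n m : nat) (alpha eps delta : R) :
  (0 < d)%N -> (0 < n)%N -> (d ^ 2 <= 6 * m)%N ->
  0 < alpha -> alpha <= 1 / 600 / Num.sqrt d%:R -> 0 <= eps <= 1 ->
  0 <= delta -> delta <= 1 / 24 * delta_max d n ->
  m%:R / 2 - 6 / ((8 * d%:R)^-1) ^+ 2 * (16 * d%:R * alpha ^+ 2) <=
    n%:R * ((expR eps - 1) * (4 * Num.sqrt d%:R * alpha) +
            4 * delta * (8 * d%:R)^-1 * m%:R) ->
  d%:R * Num.sqrt d%:R <= 200 * (n%:R * (alpha * eps)).
Proof.
move=> d0 n0 dm a0 alpha_le eps01 delta0 delta_le.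
have D1 : 1 <= d%:R :> R by rewrite ler1n.
have N0 : 0 < n%:R :> R by rewrite ltr0n.
have deltaN : delta * n%:R <= 1 / 24.
  have : delta_max d n <= n%:R^-1 :> R.
    by rewrite /delta_max; case: ifP => // _; rewrite ge_min lexx.
  by rewrite -ler_pdivlMr // => h; apply: le_trans delta_le _;
    rewrite ler_pM2l //; lra.
have w0 : 0 < Num.sqrt d%:R :> R by rewrite sqrtr_gt0 ltr0n.
have w2 : Num.sqrt d%:R ^+ 2 = d%:R :> R by rewrite sqr_sqrtr.
have dmR : d%:R ^+ 2 <= 6 * m%:R :> R by rewrite -natrX -natrM ler_nat.
have m0 : 0 <= m%:R :> R by [].
rewrite ler_pdivlMr // in alpha_le; have e_le := expR_sub1_le eps01.
set w := Num.sqrt d%:R in w0 w2 alpha_le *; set D : R := d%:R in D1 w2 dmR *.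
set m' : R := m%:R in m0 dmR *; set N : R := n%:R in N0 deltaN *.
set e := expR eps in e_le *.
have D0 : 0 < D by lra.
have -> : 6 / ((8 * D)^-1) ^+ 2 * (16 * D * alpha ^+ 2) =
    64 * 96 * (D ^+ 2 * (alpha * w) ^+ 2).
  by rewrite exprMn w2; field; rewrite gt_eqF.
have -> : N * ((e - 1) * (4 * w * alpha) + 4 * delta * (8 * D)^-1 * m') =
    4 * (N * (alpha * w) * (e - 1)) + (delta * N) * (m' / D) / 2.
  by field; rewrite gt_eqF.
have u0 : 0 < alpha * w by exact: mulr_gt0.
have u2 : (alpha * w) ^+ 2 <= 1 / 600 * (1 / 600).
  by rewrite expr2; apply: ler_pM => //; exact: ltW.
have quad_le := ler_wpM2l (sqr_ge0 D) u2.
have privacy_le : N * (alpha * w) * (e - 1) <= N * (alpha * w) * (3 * eps).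
  by rewrite ler_wpM2l // ltW // mulr_gt0.
have mD : m' / D <= m' by rewrite ler_pdivrMr // ler_peMr.
have mD0 : 0 <= m' / D by rewrite divr_ge0 // ltW.
have delta_term_le := ler_wpM2r mD0 deltaN.
move=> tradeoff; rewrite -(ler_pM2r w0).
have -> : D * w * w = D ^+ 2 by rewrite -mulrA -!expr2 w2 expr2.
by lra.
Qed.

(* If alpha vanished, arbitrarily small positive values a could replace it. *)
Lemma sample_bound_extend (R : realType) (n K alpha eps c : R) :
  0 < n -> 1 <= K -> 0 < c -> 0 <= alpha -> alpha <= c -> 0 <= eps <= 1 ->
  (forall a, 0 < a -> a <= c -> alpha <= a -> K <= 200 * (n * (a * eps))) ->
  0 < alpha * eps /\ K <= 200 * (n * (alpha * eps)).
Proof.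
move=> n0 K1 c0 a0 ac /andP[eps0 eps1] bound.
have [alpha_le0|alpha_gt0] := leP alpha 0; last first.
  have K_le := bound alpha alpha_gt0 ac (lexx _); split=> //.
  by rewrite ltNge; apply/negP => /(mulr_ge0_le0 (ltW n0)); lra.
pose a := Num.min c (1 / 400 / n).
have a_gt0 : 0 < a by rewrite lt_min c0 divr_gt0 //; lra.
have an : a * n <= 1 / 400 by rewrite -ler_pdivlMr // ge_min lexx orbT.
have ane : n * (a * eps) <= a * n.
  by rewrite mulrCA mulrA ler_piMr // mulr_ge0 // ltW.
have ac' : a <= c by rewrite ge_min lexx.
have K_le := bound a a_gt0 ac' (le_trans alpha_le0 (ltW a_gt0)).
have : (1 : R) < 0 by lra.
by rewrite ltr10.
Qed.

Lemma powR_three_halves (R : realType) (x : R) :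
  0 < x -> x `^ (3 / 2) = x * Num.sqrt x.
Proof.
move=> x0; have -> : (3 / 2 : R) = 1 + 2^-1 by field.
by rewrite powRD ?powRr1 ?powR12_sqrt ?ltW // gt_eqF ?implybT.
Qed.

(* The conclusion is stated in \bar R, where 1 / 0 = +oo: for eps = 0 or
   alpha = 0 it says that no such mechanism exists. *)
Theorem theorem4p11 (R : realType) :
  exists c1 c2 c3 : R, [/\ 0 < c1, 0 < c2 & 0 < c3] /\
  forall d : nat, (0 < d)%N ->
  exists D : probability 'M[R]_d R,
    {ae D, forall S : 'M[R]_d, loewner_le 1%:M S /\ loewner_le S 2%:M} /\
    forall (n : nat) (alpha eps delta : R)
      (M : R.-pker (n.-tuple 'rV[R]_d) ~> 'M[R]_d),
      (0 < n)%N ->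
      0 <= alpha -> alpha <= c1 / Num.sqrt d%:R ->
      0 <= eps <= 1 -> 0 <= delta <= 1 ->
      delta <= c2 * delta_max d n ->
      diff_private eps delta M ->
      (expected_cov_error D M <= (alpha ^+ 2)%:E)%E ->
      ((c3 * d%:R `^ (3 / 2))%:E / (alpha * eps)%:E <= n%:R%:E)%E.
Proof.
exists (1 / 600), (1 / 24), (1 / 200); split; first by split; lra.
move=> d d0; have [D [m [dm D_loewner tradeoff]]] :=
  private_covariance_tradeoff R d0.
exists D; split=> // n alpha eps delta M n0 a0 a_le eps01 /andP[delta0 _].
move=> delta_le Mdp err_le; have /andP[eps0 _] := eps01.
have sample_bound a : 0 < a -> a <= 1 / 600 / Num.sqrt d%:R -> alpha <= a ->
    d%:R * Num.sqrt d%:R <= 200 * (n%:R * (a * eps)).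
  move=> a_gt0 a_small alpha_le.
  apply: (tradeoff_sample_bound d0 n0 dm a_gt0 a_small eps01 delta0 delta_le).
  apply: (tradeoff n M) => //; apply: le_trans err_le _.
  by rewrite lee_fin ler_sqr ?nnegrE // ltW.
have w1 : 1 <= Num.sqrt d%:R :> R by rewrite -[leLHS]sqrtr1 ler_sqrt // ler1n.
have dw1 : 1 <= d%:R * Num.sqrt d%:R :> R by rewrite mulr_ege1 // ler1n.
have c0 : 0 < 1 / 600 / Num.sqrt d%:R :> R by apply: divr_gt0; lra.
have [nR dR] : 0 < n%:R :> R /\ 0 < d%:R :> R by rewrite !ltr0n.
have [ae_gt0 n_ge] := sample_bound_extend nR dw1 c0 a0 a_le eps01 sample_bound.
rewrite inver gt_eqF // -EFinM lee_fin ler_pdivrMr // (powR_three_halves dR).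
by lra.
Qed.
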